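(* Let $m\ge 1$ be an integer and let $K_1:=\min\left(\frac1m,\ \frac{0.95+\log^+\lambda}{\lambda}\right)$. Then $$\|\Delta h^{(m)}\|\le \frac1\lambda+(m+1)K_1,$$ and if $\lambda>m+2$, $$\|\Delta h^{(m)}\|\le \frac{1}{\lambda(\lambda-m)}+\frac{\lambda}{\lambda-m}K_1 .$$ Here $\|\Delta h^{(m)}\|:=\sup_{\xi}\sup_{f,\alpha}\left|h_f^{(m)}(\xi+\delta_\alpha)-h_f^{(m)}(\xi)\right|$, the suprema being over finite configurations $\xi$ on $\Gamma$ with $|\xi|\ge m$, over $f\in\mathcal F_{\bar d}$ and over $\alpha\in\Gamma$.
   Context: $\Gamma$ is a locally compact complete separable metric space with metric $d_0\le 1$; $\mathcal H$ is the space of locally finite point measures (configurations) on $\Gamma$; $|\xi|=\xi(\Gamma)$ is the number of points of $\xi$; $\delta_x$ is the unit mass at $x$. $\bm\lambda$ is a diffuse (atomless) measure on $\Gamma$ with total mass $\lambda=\bm\lambda(\Gamma)\in(0,\infty)$. $\log^+x=\max(\log x,0)$. Conditional Poisson process: $\mathrm{Pn}^{(m)}(\bm\lambda)$ is the law of a Poisson point process with mean measure $\bm\lambda$ conditioned on having at least $m$ points in $\Gamma$, and $\mathrm{Pn}^{(m)}(\bm\lambda)(f)$ is the expectation of $f$ under this law. The process $Z_\xi^{(m)}(\cdot)$: for a finite configuration $\xi$ with $|\xi|\ge m$, $Z_\xi^{(m)}(\cdot)$ is the continuous-time pure-jump Markov process of configurations with $Z_\xi^{(m)}(0)=\xi$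 which, when in configuration $\eta$ ($|\eta|\ge m$), stays there for an exponential time with mean $1/(|\eta|\mathbf 1_{|\eta|>m}+\lambda)$; then with probability $\lambda/(|\eta|\mathbf 1_{|\eta|>m}+\lambda)$ a new point is added at a location with law $\bm\lambda/\lambda$, and with probability $|\eta|\mathbf 1_{|\eta|>m}/(|\eta|\mathbf 1_{|\eta|>m}+\lambda)$ a uniformly chosen existing point is removed. Stein solution: for bounded $f$, $h_f^{(m)}(\xi)=-\int_0^\infty \mathbb E\left[f(Z_\xi^{(m)}(t))-\mathrm{Pn}^{(m)}(\bm\lambda)(f)\right]dt$. Metric and test functions: for $\xi=\sum_{i=1}^{n}\delta_{x_i}$ and $\eta=\sum_{i=1}^{k}\delta_{y_i}$ with $n\ge k$, $n\ge1$, set $\bar d_1(\xi,\eta)=\frac1n\left(\min_{\pi}\sum_{i=1}^{k}d_0(x_{\pi(i)},y_i)+(n-k)\right)$, the minimum being over permutations $\pi$ of $\{1,\dots,n\}$ (extended symmetrically, with $\bar d_1(\emptyset,\emptyset)=0$). $\mathcal F_{\bar d}$ is the set of $f:\mathcal H\to[0,1]$ with $|f(\xi)-f(\eta)|\le\bar d_1(\xi,\eta)$ for all finite $\xi,\eta$. *)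

(* Defs.v *)
From HB Require Import structures.
From mathcomp Require Import all_boot all_order all_algebra all_fingroup.
From mathcomp Require Import all_classical all_reals all_analysis measurable_realfun.

Set Implicit Arguments.
Unset Strict Implicit.
Unset Printing Implicit Defensive.

Import Order.TTheory GRing.Theory Num.Theory.
Import numFieldNormedType.Exports.

Local Open Scope classical_set_scope.
Local Open Scope ring_scope.

(* [mdist] is the metric d_0.  [Complete] brings a base point; this is harmless,
   as the space carries a measure of positive mass. *)
#[short(type="completeMetricType")]
HB.structure Definition CompleteMetric (R : numDomainType) :=
  {T of Complete T & Metric R T}.

Definition separable (T : topologicalType) :=
  exists2 S : set T, countable S & dense S.

Notation borel T := (@g_sigma_algebraType T open).

Section configurations.
Context {R : realType} (T : completeMetricType R).

(* The defining equation of a point measure is required on every set, measurable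
   or not.  A point measure on the Borel sets has exactly one such extension, so
   that equality of measures on Borel sets is equality of functions. *)
Record config := Config {
  config_measure :> {measure set (borel T) -> \bar R} ;
  config_point : exists (D : set nat) (x : nat -> T), forall A : set T,
    config_measure A = (\esum_(i in D) \d_(x i : borel T) A)%E ;
  config_locally_finite :
    forall K : set T, compact K -> (config_measure K < +oo)%E
}.

Lemma config0_point : exists (D : set nat) (x : nat -> T), forall A : set T,
  (mzero : {measure set (borel T) -> \bar R}) A =
  (\esum_(i in D) \d_(x i : borel T) A)%E.
Proof. by exists set0, (fun=> point) => A; rewrite esum_set0. Qed.

Lemma config0_locally_finite (K : set T) : compact K ->
  ((mzero : {measure set (borel T) -> \bar R}) K < +oo)%E.
Proof. by move=> _; rewrite /mzero ltry. Qed.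

Definition config0 : config := Config config0_point config0_locally_finite.

HB.instance Definition _ := gen_eqMixin config.
HB.instance Definition _ := gen_choiceMixin config.
HB.instance Definition _ := isPointed.Build config config0.

Definition evaluation_sets : set (set config) :=
  [set C | exists2 B : set (borel T), measurable B &
    exists2 S : set (\bar R), measurable S &
      C = (fun xi : config => xi B) @^-1` S].

Definition config_measurable := <<s evaluation_sets >>.

Definition config_display : measure_display.
Proof. by constructor. Qed.

HB.instance Definition _ :=
  @isMeasurable.Build config_display config config_measurable
    (@sigma_algebra0 _ setT evaluation_sets)
    (@sigma_algebraC _ evaluation_sets)
    (@sigma_algebra_bigcup _ setT evaluation_sets).

Definition npoints (xi : config) : \bar R := xi setT.

Lemma config_add_point (xi : config) (a : T) :
  exists (D : set nat) (x : nat -> T), forall A : set T,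
    measure_add xi (\d_(a : borel T)) A =
    (\esum_(i in D) \d_(x i : borel T) A)%E.
Proof.
have [D [x xiE]] := config_point xi.
pose Z : set nat := [set 0%N]; pose D' : set nat := S @` D.
have ZD : (Z `|` D') `&` Z = Z by apply/setIidPr => i; left.
have DZ : (Z `|` D') `&` ~` Z = D'.
  apply/seteqP; split=> [i [[//|]]//|i D'i].
  by split; [right | case: D'i => j _ <-].
exists (Z `|` D'), (fun i => if i is j.+1 then x j else a) => A.
have dirac_ge0 i : (Z `|` D') i ->
    (0 <= \d_((if i is j.+1 then x j else a) : borel T) A :> \bar R)%E by [].
rewrite measure_addE xiE addeC (esumID Z _ _ dirac_ge0) ZD DZ esum_set1//.
by rewrite esum_image// => i j _ _ [].
Qed.

Lemma config_add_locally_finite (xi : config) (a : T) (K : set T) :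
  compact K -> (measure_add xi (\d_(a : borel T)) K < +oo)%E.
Proof.
move=> cK; rewrite measure_addE; apply: lte_add_pinfty; last exact: ltry.
exact: config_locally_finite.
Qed.

Definition add_point (xi : config) (a : T) : config :=
  Config (config_add_point xi a) (@config_add_locally_finite xi a).

Definition finite_ge (m : nat) (xi : config) :=
  ((m%:R%:E <= npoints xi) /\ (npoints xi < +oo))%E.

Lemma finite_ge_add_point m (xi : config) (a : T) :
  finite_ge m xi -> finite_ge m (add_point xi a).
Proof.
move=> [mx xfin]; rewrite /finite_ge.
have -> : npoints (add_point xi a) = (npoints xi + \d_(a : borel T) setT)%E.
  exact: measure_addE.
split; first by rewrite (le_trans mx)// leeDl.
by apply: lte_add_pinfty => //; exact: ltry.
Qed.

Definition enumerates n (x : 'I_n -> T) (xi : config) :=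
  forall A : set T, xi A = (\sum_(i < n) \d_(x i : borel T) A)%E.

(* The metric d_1 between sum_(i < n) delta_(x i) and sum_(i < k) delta_(y i) for
   k <= n.  The value is 0 for n = 0, as 0^-1 = 0. *)
Definition dbar1 n k (le_kn : (k <= n)%N) (x : 'I_n -> T) (y : 'I_k -> T) : R :=
  let cost (s : 'S_n) :=
    \sum_(i < k) mdist (x (s (widen_ord le_kn i))) (y i) in
  n%:R^-1 * (\big[Num.min/cost 1%g]_(s : 'S_n) cost s + (n - k)%:R).

Definition Fdbar : set (config -> R) :=
  [set f | (forall xi, 0 <= f xi <= 1) /\
    forall n k (le_kn : (k <= n)%N) (x : 'I_n -> T) (y : 'I_k -> T) xi eta,
      enumerates x xi -> enumerates y eta ->
      `|f xi - f eta| <= dbar1 le_kn x y].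

Variable lam : {finite_measure set (borel T) -> \bar R}.

Definition mass : R := fine (lam setT).

(* The library's [poisson_pmf] is not used: it is 1 everywhere at rate 0, whereas
   here a set of measure 0 has to contain no point almost surely. *)
Definition poisson_weight (r : R) (k : nat) : R :=
  r ^+ k / k`!%:R * expR (- r).

(* The law of a Poisson point process with mean measure lam: the numbers of points
   in disjoint sets are independent Poisson variables. *)
Definition poisson_process (Pi : probability config R) :=
  forall n (B : 'I_n -> set (borel T)) (k : 'I_n -> nat),
    (forall i, measurable (B i)) -> trivIset setT B ->
    Pi [set xi | forall i, xi (B i) = (k i)%:R%:E] =
    (\prod_(i < n) poisson_weight (fine (lam (B i))) (k i))%:E.

(* The expectation of f under the law Pi conditioned on at least m points. *)
Definition conditional_mean (Pi : probability config R) (m : nat)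
    (f : config -> R) : \bar R :=
  let A := [set xi | (m%:R%:E <= npoints xi)%E] in
  ((fine (Pi A))^-1%:E * \int[Pi]_(xi in A) (f xi)%:E)%E.

Definition death_rate (m : nat) (eta : config) : R :=
  if (m%:R%:E < npoints eta)%E then fine (npoints eta) else 0.

Definition jump_rate (m : nat) (eta : config) : R := death_rate m eta + mass.

(* The probability that the jump out of eta leads into B.  A new point has law
   lam / mass, the removed point has law eta / npoints eta. *)
Definition jump_law (m : nat) (eta : config) (B : set config) : \bar R :=
  ((mass / jump_rate m eta)%:E *
     (mass^-1%:E * lam [set a | B (add_point eta a)]) +
   (death_rate m eta / jump_rate m eta)%:E *
     ((fine (npoints eta))^-1%:E *
      eta [set a | exists2 zeta, B zeta & add_point zeta a = eta]))%E.

(* Events determined by the states Y 0, ..., Y n and the first n holding times. *)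
Definition history d (Om : measurableType d) (Y : nat -> Om -> config)
    (W : nat -> Om -> R) (n : nat) : set (set Om) :=
  <<s [set C | (exists2 i, (i <= n)%N &
                 exists2 B, measurable B & C = Y i @^-1` B) \/
               (exists2 i, (i < n)%N &
                 exists2 S, measurable S & C = W i @^-1` S)] >>.

(* A realization Z of the process Z_xi^(m) on some probability space, with its
   embedded chain Y and holding times W.  [Z_jump] is the joint conditional law of
   the n-th holding time and of the next state, given the history. *)
Record immigration_death (m : nat) (xi : config) := ImmigrationDeath {
  Z_display : measure_display ;
  Z_space : measurableType Z_display ;
  Z_prob : probability Z_space R ;
  Z_state : nat -> Z_space -> config ;
  Z_wait : nat -> Z_space -> R ;
  Z_at : R -> Z_space -> config ;
  Z_state_measurable : forall n, measurable_fun setT (Z_state n) ;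
  Z_wait_measurable : forall n, measurable_fun setT (Z_wait n) ;
  Z_at_measurable : forall t, measurable_fun setT (Z_at t) ;
  Z_wait_gt0 : forall n w, 0 < Z_wait n w ;
  Z_init : forall w, Z_state 0 w = xi ;
  Z_path : forall t w, 0 <= t -> exists2 n : nat,
    \sum_(i < n) Z_wait i w <= t < \sum_(i < n.+1) Z_wait i w &
    Z_at t w = Z_state n w ;
  Z_jump : forall n (A : set Z_space) (S : set R) (B : set config),
    history Z_state Z_wait n A -> measurable S -> measurable B ->
    Z_prob (A `&` Z_wait n @^-1` S `&` Z_state n.+1 @^-1` B) =
    (\int[Z_prob]_(w in A)
       (exponential_prob (jump_rate m (Z_state n w)) S *
        jump_law m (Z_state n w) B))%E
}.

Arguments Z_state {m xi} i n w : rename.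
Arguments Z_wait {m xi} i n w : rename.
Arguments Z_at {m xi} i t w : rename.

(* All integrals are in the extended reals, so that an integral over time that
   fails to converge is not given a finite value. *)
Definition stein_solution (Pi : probability config R) (m : nat)
    (f : config -> R) (xi : config) (Z : immigration_death m xi) : \bar R :=
  (- \int[lebesgue_measure]_(t in `[0%R, +oo[)
       (\int[Z_prob Z]_w (f (Z_at Z t w))%:E - conditional_mean Pi m f))%E.

Definition norm_Delta_h (Pi : probability config R) (m : nat)
    (Z : forall xi, finite_ge m xi -> immigration_death m xi) : \bar R :=
  ereal_sup [set r | exists (xi : config) (hxi : finite_ge m xi)
    (f : config -> R) (a : T), Fdbar f /\
    r = `|stein_solution Pi f (Z _ (finite_ge_add_point a hxi)) -
          stein_solution Pi f (Z _ hxi)|%E].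

End configurations.

(* Main.v *)
Require Import Defs.
From HB Require Import structures.
From mathcomp Require Import all_boot all_order all_algebra all_fingroup.
From mathcomp Require Import all_classical all_reals all_analysis measurable_realfun.
From mathcomp Require Import ring lra zify.
Set Implicit Arguments.
Unset Strict Implicit.
Unset Printing Implicit Defensive.
Import Order.TTheory GRing.Theory Num.Theory.
Import numFieldNormedType.Exports.
Local Open Scope classical_set_scope.
Local Open Scope ring_scope.

(** Write G_t f(xi) for the expectation of f at time t of the process started
from xi.  As G_t f converges exponentially fast to the conditional Poisson mean
of f, the difference of the Stein solutions at xi + delta_a and at xi is, up to
sign, the limit as T tends to infinity of O_T(xi + delta_a) - O_T(xi), where the
occupation O_T is the integral of G_t f over 0 <= t <= T.  The occupation
satisfies d O_T / dT = f + A O_T and O_0 = 0, with A the generator, so it is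
enough to bound its differences for every T.

Two kinds of differences are bounded together: those of adding a point,
O_T(xi + delta_a) - O_T(xi), and those of moving one,
O_T(xi + delta_a) - O_T(xi + delta_b).  Let n be the number of points of
xi + delta_a.  Couple the two processes so that they share all the births and
the deaths of the points of xi.  A difference of level n then jumps to one
of level n + 1 at rate lambda, to one of level n - 1 at rate n - 1, and to 0 at rate
1, when the distinguished point dies; at level m there are no deaths, and only
moves have to be considered.  For f in the class of test functions both source
terms are at most 1 / n.  Hence every function phi of n with
  1 / n <= lambda (phi n - phi (n + 1)) + (n - 1) (phi n - phi (n - 1)) + phi n
for n > m, and 1 / m <= lambda (phi m - phi (m + 1)), bounds both kinds of
differences: this is [max_principle], applied in [occupation_contrast].  The
statement follows from two such barriers, found in [barriers_exist].  One is
constant above m and equal to 1 / m + 1 / lambda there.  The other is built from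
U n = (1 / 2 + the sum of 1 / (n + k) over k < L) / lambda, with L the least
integer greater than lambda; the telescoping of this sum makes it a supersolution and
its size gives the logarithm.

The state space of configurations is uncountable, and the process is only given
by the law of its jumps.  Both difficulties disappear after discretization.
Cut the space into the cells of the points whose nearest neighbour among the
first K + 1 terms of a dense sequence is a given term.  The rates of the process
depend on the number of points only, so the vector of the numbers of points in
the cells is a Markov chain on a countable set.  Its semigroup is constructed
here as an increasing limit of Picard iterates, and [path_expectation] shows, by
conditioning on the successive jumps, that it gives the law of the counts of
every realization ([expectation_cells]).  The test function f is replaced by its
value at the configuration in which every point is moved to the centre of its
cell.  All the bounds for the chain are independent of K, and K tends to infinity
by dominated convergence.

The convergence to equilibrium comes from the same maximum principle, now
without source term: it bounds |G_t f(xi + delta_a) - G_t f(xi)| by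
(m + 2) exp(- kappa t) for some kappa > 0 ([semigroup_contrast]), hence
|G_t f(xi) - G_t f(eta)| by a multiple of (|xi| + |eta|) exp(- kappa t).
Averaging over eta with the law of the conditional Poisson process, which is
stationary because the chain is reversible with respect to the Poisson law of the
counts, gives the exponential rate ([semigroup_cvg_mean]).

A test function need not be measurable, but its restriction to the finite
configurations is a limit of functions of the counts, and infinite
configurations have probability 0; [ge0_integral_off_null] makes this enough. *)

(** * Differential inequalities and dominated limits *)

Section calculus.
Context {R : realType}.
Implicit Types (F w b h : R -> R).

Lemma le_of_derive_ge0 F (dF : R -> R) (a b : R) : a <= b -> continuous F ->
  (forall t : R, a < t -> is_derive t 1 F (dF t)) ->
  (forall t : R, a < t -> t < b -> 0 <= dF t) -> F a <= F b.
Proof.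
rewrite le_eqVlt => /predU1P[->//|ab] cF derF dF0.
have [c] : exists2 c, c \in `]a, b[%R & F b - F a = dF c * (b - a).
  apply: MVT => //; first by move=> x; rewrite in_itv/= => /andP[x0 _]; exact: derF.
  exact: continuous_subspaceT.
rewrite in_itv/= => /andP[c0 cT] FE; rewrite -subr_ge0 FE.
by rewrite mulr_ge0 ?dF0// subr_ge0 ltW.
Qed.

Lemma continuous_expM (r : R) : continuous (fun t : R => expR (r * t)).
Proof.
move=> t; apply: continuous_comp; last exact: continuous_expR.
by apply: cvgM; [exact: cvg_cst | exact: cvg_id].
Qed.

(** The function t |-> exp(r t) (b t - w t) is nondecreasing. *)
Lemma ode_le w b (dw db : R -> R) (r T : R) : 0 <= T ->
  continuous w -> continuous b ->
  (forall t : R, 0 < t -> is_derive t 1 w (dw t)) ->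
  (forall t : R, 0 < t -> is_derive t 1 b (db t)) ->
  (forall t : R, 0 < t -> t < T -> dw t + r * w t <= db t + r * b t) ->
  w 0 <= b 0 -> w T <= b T.
Proof.
move=> T0 cw cb dwE dbE dwdb wb0.
pose F t := expR (r * t) * (b t - w t).
pose dF t := expR (r * t) * ((db t + r * b t) - (dw t + r * w t)).
have F0T : F 0 <= F T.
  apply: (@le_of_derive_ge0 _ dF 0 T) => //.
  - move=> t; apply: cvgM; first exact: continuous_expM.
    by apply: cvgB; [exact: cb | exact: cw].
  - move=> t t0; have ? := dwE _ t0; have ? := dbE _ t0.
    rewrite /F; apply: is_derive_eq.
    by rewrite /dF /GRing.scale/=; ring.
  - move=> t t0 tT; rewrite /dF mulr_ge0 ?expR_ge0// subr_ge0.
    exact: dwdb.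
have : 0 <= F 0 by rewrite /F mulr_ge0 ?expR_ge0// subr_ge0.
move=> /le_trans/(_ F0T); rewrite /F pmulr_rge0 ?expR_gt0// subr_ge0//.
Qed.

Lemma ode_norm_le w b (dw db : R -> R) (r T : R) : 0 <= T ->
  continuous w -> continuous b ->
  (forall t : R, 0 < t -> is_derive t 1 w (dw t)) ->
  (forall t : R, 0 < t -> is_derive t 1 b (db t)) ->
  (forall t : R, 0 < t -> t < T -> `|dw t + r * w t| <= db t + r * b t) ->
  `|w 0| <= b 0 -> `|w T| <= b T.
Proof.
move=> T0 cw cb dwE dbE dwdb; rewrite ler_norml => /andP[wb0 wb0'].
rewrite ler_norml lerNl; apply/andP; split; last first.
  apply: (@ode_le w b dw db r) => // t t0 tT.
  by apply: le_trans (dwdb _ t0 tT); exact: ler_norm.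
apply: (@ode_le (fun t => - w t) b (fun t => - dw t) db r) => //.
- by move=> t; apply: cvgN; exact: cw.
- by move=> t t0; have ? := dwE _ t0; apply: is_derive_eq.
- move=> t t0 tT; apply: le_trans (dwdb _ t0 tT).
  by rewrite mulrN -opprD -normrN ler_norm.
- by rewrite lerNl.
Qed.

End calculus.

Lemma cvg_rsum {R : realType} {T J : Type} (F : set_system T) {FF : Filter F}
    (r : seq J) (g : J -> T -> R) (a : J -> R) :
  (forall j, g j x @[x --> F] --> a j) ->
  (\sum_(j <- r) g j x) @[x --> F] --> \sum_(j <- r) a j.
Proof.
move=> ga; elim: r => [|j r ih].
  by rewrite big_nil; under eq_fun do rewrite big_nil; exact: cvg_cst.
by rewrite big_cons; under eq_fun do rewrite big_cons; exact: cvgD.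
Qed.

Lemma cvg_integral_dominated {R : realType} {d} {T : measurableType d}
    (mu : {measure set T -> \bar R}) (D : set T) (fn : nat -> T -> R) (f g : T -> R) :
  measurable D -> (forall n, measurable_fun D (fn n)) -> measurable_fun D f ->
  (forall x, D x -> fn n x @[n --> \oo] --> f x) ->
  mu.-integrable D (EFin \o g) -> (forall n x, D x -> `|fn n x| <= g x) ->
  (\int[mu]_(x in D) (fn n x)%:E @[n --> \oo] --> \int[mu]_(x in D) (f x)%:E)%E.
Proof.
move=> mD mfn mf fnf ig fng.
have h1 n : measurable_fun D (EFin \o fn n) by exact/measurable_EFinP.
have h2 : measurable_fun D (EFin \o f) by exact/measurable_EFinP.
have h3 : {ae mu, forall x, D x -> ((EFin \o fn n) x @[n --> \oo] --> (EFin \o f) x)%E}.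
  apply: aeW => x Dx; apply: cvg_EFin; first exact: nearW.
  exact: fnf.
have h4 : {ae mu, forall x, forall n, D x -> (`|(EFin \o fn n) x| <= (EFin \o g) x)%E}.
  by apply: aeW => x n Dx; rewrite /= lee_fin; exact: fng.
by have [] := dominated_convergence mD h1 h2 h3 ig h4.
Qed.

Lemma is_derive_rsum {R : realType} {J : Type} (r : seq J) (g : J -> R -> R)
    (dg : J -> R) (x : R) : (forall j, is_derive x 1 (g j) (dg j)) ->
  is_derive x 1 (fun y => \sum_(j <- r) g j y) (\sum_(j <- r) dg j).
Proof.
move=> gdg; elim: r => [|j r ih].
  by rewrite big_nil; under eq_fun do rewrite big_nil; exact: is_derive_cst.
by rewrite big_cons; under eq_fun do rewrite big_cons; exact: is_deriveD.
Qed.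

(** * Vectors of counts and the maximum principle *)

(** A configuration is seen through the vector c of the numbers of its points in
finitely many cells; [up c i] and [dn c i] add and remove a point in cell i. *)
Section states.
Context {R : realType} {I : finType}.
Implicit Types (c : {ffun I -> nat}) (i j : I).

Definition tot c : nat := (\sum_i c i)%N.
Definition up c i : {ffun I -> nat} := [ffun j => (c j + (j == i))%N].
Definition dn c i : {ffun I -> nat} := [ffun j => (c j - (j == i))%N].

Lemma tot_up c i : tot (up c i) = (tot c).+1.
Proof.
rewrite /tot; under eq_bigr do rewrite ffunE.
rewrite big_split/= -addn1; congr addn.
by rewrite (bigD1 i)//= eqxx big1// => j /negPf ->.
Qed.

Lemma upK c i : dn (up c i) i = c.
Proof. by apply/ffunP => j; rewrite !ffunE addnK. Qed.

Lemma dnK c i : (0 < c i)%N -> up (dn c i) i = c.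
Proof.
move=> ci; apply/ffunP => j; rewrite !ffunE.
by case: eqP => [->|_]; rewrite ?subn0 ?addn0// subnK.
Qed.

Lemma tot_dn c i : (0 < c i)%N -> (tot (dn c i)).+1 = tot c.
Proof. by move=> ci; rewrite -[in RHS](dnK ci) tot_up. Qed.

Lemma up_comm c i j : up (up c i) j = up (up c j) i.
Proof. by apply/ffunP => k; rewrite !ffunE addnAC. Qed.

Lemma dn_up c i j : (0 < c j)%N -> dn (up c i) j = up (dn c j) i.
Proof.
move=> cj; apply/ffunP => k; rewrite !ffunE.
by case: (k =P j) => [->|_]; rewrite ?subn0// addnBAC.
Qed.

Lemma up_inj i : injective (up ^~ i).
Proof. by move=> c c' /(congr1 (dn ^~ i)); rewrite !upK. Qed.

End states.

(** Minus the generator of the number n of points in two coupled configurations (in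
the larger one, if they differ by an additional point), killed at rate 1 by the death of the point in which they differ.
The other n - 1 points die together, and nobody dies when n = m. *)
Definition level_drift {R : realType} (lam : R) (m : nat) (phi : nat -> R) (n : nat) : R :=
  lam * (phi n - phi n.+1) +
  (if (m < n)%N then n.-1%:R * (phi n - phi n.-1) + phi n else 0).

(** The intensities l are the masses of the cells.  The generator is
g |-> jumps g - rate * g, and [s] is a source term in u' = s + jumps u - rate * u. *)
Section generator.
Context {R : realType} {I : finType}.
Variables (l : I -> R) (m : nat).
Implicit Types (c : {ffun I -> nat}) (i j : I) (g : {ffun I -> nat} -> R).

Definition total : R := \sum_i l i.
Definition death (n : nat) : R := if (m < n)%N then n%:R else 0.
Definition rate c : R := death (tot c) + total.
Definition jumps g c : R := \sum_i l i * g (up c i) +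
  (if (m < tot c)%N then \sum_i (c i)%:R * g (dn c i) else 0).

Local Notation Lop := (level_drift total m).

Definition evolves (s : {ffun I -> nat} -> R) (u : R -> {ffun I -> nat} -> R) :=
  (forall c, continuous (u ^~ c)) /\
  forall c (t : R), 0 < t ->
    is_derive t 1 (u ^~ c) (s c + jumps (u t) c - rate c * u t c).

(** The two kinds of differences have to be bounded together: at the level where
deaths are blocked in the smaller configuration only, adding a point turns into
moving one. *)
Definition contrast_le (u : R -> {ffun I -> nat} -> R) (T : R) (B : R -> nat -> R) :=
  (forall c i (t : R), 0 <= t <= T -> (m <= tot c)%N ->
     `|u t (up c i) - u t c| <= B t (tot c).+1) /\
  (forall c i j (t : R), 0 <= t <= T -> (m <= (tot c).+1)%N ->
     `|u t (up c i) - u t (up c j)| <= B t (tot c).+1).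

Lemma sum_tot c : \sum_i (c i)%:R = (tot c)%:R :> R.
Proof. by rewrite /tot natr_sum. Qed.

(** The deaths in [up c i] are those of the points of [c], with the additional point
kept, and the death of the additional point, which leads back to [c]. *)
Lemma sum_up_dn c i g : 
  \sum_j (up c i j)%:R * g (dn (up c i) j) =
  \sum_j (c j)%:R * g (up (dn c j) i) + g c.
Proof.
transitivity (\sum_j ((c j)%:R * g (up (dn c j) i) + (j == i)%:R * g c)); last first.
  rewrite big_split/=; congr (_ + _).
  by rewrite (bigD1 i)//= eqxx mul1r big1 ?addr0// => j /negPf ->; rewrite mul0r.
apply: eq_bigr => j _; rewrite ffunE natrD mulrDl; congr (_ + _).
- have [->|cj] := posnP (c j); first by rewrite !mul0r.
  by rewrite dn_up.
- by case: eqP => [->|]; rewrite ?mul0r// !mul1r upK.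
Qed.

Lemma sum_mulBr (a x y : I -> R) :
  \sum_i a i * (x i - y i) = \sum_i a i * x i - \sum_i a i * y i.
Proof. by rewrite -sumrB; apply: eq_bigr => i _; rewrite mulrBr. Qed.

Hypothesis l_ge0 : forall i, 0 <= l i.

Lemma sum_le_bound (a : I -> R) (x : I -> R) (M : R) :
  (forall i, 0 <= a i) -> (forall i, 0 < a i -> `|x i| <= M) ->
  `|\sum_i a i * x i| <= (\sum_i a i) * M.
Proof.
move=> a0 xM; rewrite mulr_suml; apply: le_trans (ler_norm_sum _ _ _) _.
apply: ler_sum => i _; rewrite normrM ger0_norm//.
have := a0 i; rewrite le0r => /orP[/eqP ->|ai]; first by rewrite !mul0r.
by rewrite ler_pM2l// xM.
Qed.

(** A contrast at level n solves a linear equation with damping rate total + n (total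
when n = m) whose right-hand side is the source together with contrasts at levels
n + 1 and n - 1.  Bounds B on the latter are thus turned into new bounds b on the
former, as soon as b is a supersolution of the equation driven by B. *)
Lemma contrast_step (u : R -> {ffun I -> nat} -> R) s (sig : nat -> R) (T : R)
    (B b db : R -> nat -> R) :
  evolves s u ->
  (forall c i, (m <= tot c)%N -> `|s (up c i) - s c| <= sig (tot c).+1) ->
  (forall c i j, (m <= (tot c).+1)%N ->
    `|s (up c i) - s (up c j)| <= sig (tot c).+1) ->
  (forall c i, (m <= tot c)%N -> `|u 0 (up c i) - u 0 c| <= b 0 (tot c).+1) ->
  (forall c i j, (m <= (tot c).+1)%N ->
    `|u 0 (up c i) - u 0 (up c j)| <= b 0 (tot c).+1) ->
  (forall n, continuous (b ^~ n)) ->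
  (forall n (t : R), 0 < t -> is_derive t 1 (b ^~ n) (db t n)) ->
  (forall n (t : R), (m <= n)%N -> 0 < t -> t < T ->
     sig n + total * B t n.+1 + (if (m < n)%N then n.-1%:R * B t n.-1 else 0)
     <= db t n + (if (m < n)%N then total + n%:R else total) * b t n) ->
  contrast_le u T B -> contrast_le u T b.
Proof.
move=> [cu du] s1 s2 u1 u2 cb dbE dbB [B1 B2].
have wcont c c' : continuous (fun t => u t c - u t c').
  by move=> t; apply: cvgB; exact: cu.
have wder c c' (t : R) : 0 < t -> is_derive t 1 (fun t => u t c - u t c')
    ((s c + jumps (u t) c - rate c * u t c) -
     (s c' + jumps (u t) c' - rate c' * u t c')).
  by move=> t0; have ? := du c _ t0; have ? := du c' _ t0; apply: is_derive_eq.
split.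
- move=> c i T' /andP[T'0 T'T] mc.
  apply: (@ode_norm_le _ _ (b ^~ (tot c).+1) _ (db ^~ (tot c).+1)
    (total + (tot c).+1%:R) T' T'0 (wcont _ _) (cb _) (wder _ _) (dbE _)).
    move=> t t0 tT'; have tT : t < T by rewrite (lt_le_trans tT').
    have tT2 : 0 <= t <= T by rewrite !ltW.
    have := dbB (tot c).+1 t (leqW mc) t0 tT; rewrite ltnS mc/=; apply: le_trans.
    have -> : s (up c i) + jumps (u t) (up c i) - rate (up c i) * u t (up c i)
        - (s c + jumps (u t) c - rate c * u t c)
        + (total + (tot c).+1%:R) * (u t (up c i) - u t c) =
      (s (up c i) - s c) + \sum_j l j * (u t (up (up c j) i) - u t (up c j)) +
      (if (m < tot c)%N then \sum_j (c j)%:R * (u t (up (dn c j) i) - u t (dn c j))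
       else \sum_j (c j)%:R * (u t (up (dn c j) i) - u t c)).
      rewrite /jumps tot_up ltnS mc sum_up_dn /rate /death tot_up ltnS mc.
      under eq_bigr do rewrite up_comm.
      case: ifPn => mc'; rewrite !sum_mulBr; first by rewrite -natr1; ring.
      by rewrite -mulr_suml sum_tot -natr1; ring.
    apply: le_trans (ler_normD _ _) _; apply: lerD.
      apply: le_trans (ler_normD _ _) _; apply: lerD; first exact: s1.
      apply: sum_le_bound => // j _; rewrite -(tot_up c j).
      by apply: B1; rewrite ?tot_up// leqW.
    (* if tot c = m, a death in up c i is compared with the unchanged c: this is a move *)
    rewrite /= -sum_tot; case: ifPn => mc'; apply: sum_le_bound => // j;
      rewrite ltr0n => cj.
      rewrite -(tot_dn cj); apply: B1 => //.
      by move: mc'; rewrite -(tot_dn cj) ltnS.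
    rewrite -{2}(dnK cj) -(tot_dn cj); apply: B2 => //.
    by rewrite (tot_dn cj).
  exact: u1.
- move=> c i j T' /andP[T'0 T'T] mc.
  apply: (@ode_norm_le _ _ (b ^~ (tot c).+1) _ (db ^~ (tot c).+1)
    (if (m < (tot c).+1)%N then total + (tot c).+1%:R else total)
    T' T'0 (wcont _ _) (cb _) (wder _ _) (dbE _)).
    move=> t t0 tT'; have tT : t < T by rewrite (lt_le_trans tT').
    have tT2 : 0 <= t <= T by rewrite !ltW.
    have := dbB (tot c).+1 t mc t0 tT; apply: le_trans.
    have -> : s (up c i) + jumps (u t) (up c i) - rate (up c i) * u t (up c i)
        - (s (up c j) + jumps (u t) (up c j) - rate (up c j) * u t (up c j))
        + (if (m < (tot c).+1)%N then total + (tot c).+1%:R else total)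
          * (u t (up c i) - u t (up c j)) =
      (s (up c i) - s (up c j)) +
       \sum_k l k * (u t (up (up c k) i) - u t (up (up c k) j)) +
      (if (m < (tot c).+1)%N then
       \sum_k (c k)%:R * (u t (up (dn c k) i) - u t (up (dn c k) j)) else 0).
      rewrite /jumps /rate /death !tot_up !sum_up_dn.
      under eq_bigr do rewrite up_comm.
      under [X in _ - (_ + (X + _) - _)]eq_bigr do rewrite up_comm.
      by case: ifPn => mc'; rewrite !sum_mulBr; ring.
    apply: le_trans (ler_normD _ _) _; apply: lerD.
      apply: le_trans (ler_normD _ _) _; apply: lerD; first exact: s2.
      apply: sum_le_bound => // k _; rewrite -(tot_up c k).
      by apply: B2; rewrite ?tot_up// leqW.
    case: ifPn => mc'; last by rewrite normr0.
    rewrite /= -sum_tot; apply: sum_le_bound => // k; rewrite ltr0n => ck.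
    rewrite -(tot_dn ck); apply: B2 => //.
    by rewrite (tot_dn ck); move: mc'; rewrite ltnS.
  exact: u2.
Qed.

Hypothesis total_gt0 : 0 < total.

(** A supersolution that grows linearly, to be added with a small factor to a barrier
since the number of points is unbounded.  The value at m is raised so that the
drift is positive there although no point dies. *)
Definition weight (n : nat) : R := (if n == m then m.+2 else n)%:R + total.

Lemma level_drift_weight n : (m <= n)%N -> Num.min total 1 <= Lop weight n.
Proof.
rewrite leq_eqVlt => /predU1P[<-|mn].
  rewrite /level_drift /weight eqxx ltnn gtn_eqF// -[m.+2%:R]natr1 addr0.
  by rewrite ge_min; apply/orP; left; lra.
rewrite ge_min; apply/orP; right.
have [n' n'E] : exists n', n = n'.+1 by exists n.-1; rewrite prednK// (leq_trans _ mn).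
move: mn; rewrite n'E ltnS => mn.
have e1 : (n'.+1 == m) = false by rewrite gtn_eqF.
have e2 : (n'.+2 == m) = false by rewrite gtn_eqF// ltnS leqW.
rewrite /level_drift /weight ltnS mn [n'.+1.-1]/= e1 e2.
have [->|n'm] := eqVneq n' m.
  by rewrite -!natr1; lra.
have : m%:R + 1 <= n'%:R :> R by rewrite natr1 ler_nat ltn_neqAle eq_sym n'm.
have : 0 <= m%:R :> R by [].
by rewrite -!natr1; nra.
Qed.

Lemma weight_ge n : n%:R + total <= weight n.
Proof. by rewrite /weight lerD2r ler_nat; case: eqP => [->|//]; lia. Qed.

Lemma weight_le n : weight n <= n.+2%:R + total.
Proof. by rewrite /weight lerD2r ler_nat; case: eqP => [->|//]; lia. Qed.

(** The a priori bound C gives the bound b + M weight for M = C.  A use of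
[contrast_step] improves M weight n into M (weight n - c0 / (total + n)), which
is at most (1 - del) M weight n for the finitely many levels n < n0; for n >= n0
the bound C is already below e weight n.  Iterating, M decreases to e, and e is
arbitrary. *)
Lemma max_principle (u : R -> {ffun I -> nat} -> R) s (sig : nat -> R) (T C : R)
    (b db : R -> nat -> R) : (0 < m)%N ->
  evolves s u ->
  (forall c i, (m <= tot c)%N -> `|s (up c i) - s c| <= sig (tot c).+1) ->
  (forall c i j, (m <= (tot c).+1)%N ->
    `|s (up c i) - s (up c j)| <= sig (tot c).+1) ->
  (forall c i, (m <= tot c)%N -> `|u 0 (up c i) - u 0 c| <= b 0 (tot c).+1) ->
  (forall c i j, (m <= (tot c).+1)%N ->
    `|u 0 (up c i) - u 0 (up c j)| <= b 0 (tot c).+1) ->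
  (forall n, continuous (b ^~ n)) ->
  (forall n (t : R), 0 < t -> is_derive t 1 (b ^~ n) (db t n)) ->
  (forall n (t : R), (m <= n)%N -> 0 < t -> sig n <= db t n + Lop (b t) n) ->
  (forall n (t : R), (m <= n)%N -> 0 <= t -> 0 <= b t n) ->
  (forall c c' (t : R), 0 <= t <= T -> `|u t c - u t c'| <= C) ->
  contrast_le u T b.
Proof.
move=> m0 evu s1 s2 u1 u2 cb dbE bL b0 uC.
pose c0 := Num.min total 1.
have c0_gt0 : 0 < c0 by rewrite lt_min total_gt0/=.
have w1 n : (m <= n)%N -> 1 <= weight n.
  move=> mn; apply: le_trans (weight_ge n).
  have : 1 <= n%:R :> R by rewrite ler1n (leq_trans m0).
  by move: total_gt0; lra.
have frac1 n : (m <= n)%N -> c0 / (total + n%:R) <= 1.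
  move=> mn; have n1 : 1 <= n%:R :> R by rewrite ler1n (leq_trans m0).
  have cl : c0 <= 1 by rewrite /c0 ge_min lexx orbT.
  by move: total_gt0 => ?; rewrite ler_pdivrMr ?mul1r; lra.
pose bd M := contrast_le u T (fun t n => b t n + M * weight n).
(* one step of the improvement of the bound *)
have improve (M : R) : 0 <= M -> bd M -> contrast_le u T
    (fun t n => b t n + M * (weight n - c0 / (total + n%:R))).
  move=> M0; apply: (@contrast_step u s sig T _ _ db evu s1 s2) => //.
  - move=> c i mc; rewrite (le_trans (u1 _ _ mc))// lerDl mulr_ge0// subr_ge0.
    by rewrite (le_trans (frac1 _ (leqW mc)))// w1// leqW.
  - move=> c i j mc; rewrite (le_trans (u2 _ _ _ mc))// lerDl mulr_ge0// subr_ge0.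
    by rewrite (le_trans (frac1 _ mc))// w1.
  - by move=> n t; apply: cvgD; [exact: cb | exact: cvg_cst].
  - move=> n t t0; have ? := dbE n t t0; apply: is_derive_eq.
    by rewrite addr0.
  move=> n t mn t0 tT.
  have := bL n t mn t0; have := level_drift_weight mn; rewrite -/c0 /level_drift.
  have d0 : 0 < total + n%:R by rewrite ltr_wpDr.
  have [mn'|mn'] := ltnP m n.
    move=> h1 h2.
    have n1 : n%:R = n.-1%:R + 1 :> R by rewrite natr1 prednK// (leq_trans _ mn').
    have -> : (total + n%:R) * (b t n + M * (weight n - c0 / (total + n%:R))) =
      (total + n%:R) * b t n + M * ((total + n%:R) * weight n - c0).
      by field; rewrite gt_eqF.
    rewrite n1.
    have := ler_wpM2l M0 h1; move: h2; lra.
  rewrite !addr0 => h1 h2.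
  have h3 : M * (total * (c0 / (total + n%:R))) <= M * c0.
    apply: ler_wpM2l => //; rewrite mulrA ler_pdivrMr// mulrC ler_wpM2l ?(ltW c0_gt0)//.
    by rewrite lerDl.
  have := ler_wpM2l M0 h1; move: h2 h3; lra.
have bdC : 0 <= C -> bd C.
  move=> C0; have gen (x t : R) n : (m <= n)%N -> 0 <= t <= T -> x <= C ->
      x <= b t n + C * weight n.
    move=> mn /andP[t0 _] /le_trans; apply; apply: ler_wpDl; first exact: b0.
    by rewrite ler_peMr// w1.
  split=> [c i t tT mc|c i j t tT mc]; apply: gen => //; try exact: uC.
  exact: leqW.
have [C0|Cn] := leP 0 C; last first.
  by split=> [c i t tT mc|c i j t tT mc]; have := uC c c t tT;
    rewrite subrr normr0 leNgt Cn.
have bdeps (e : R) : 0 < e -> bd e.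
  move=> e0.
  have [n0 n0C] : exists n0 : nat, forall n, (n0 <= n)%N -> C <= e * weight n.
    exists (Num.truncn (C / e)).+1 => n nn.
    have : C / e <= weight n.
      apply: le_trans (weight_ge n); apply: ler_wpDr; first exact: ltW.
      apply: le_trans (ltW (truncnS_gt _)) _.
      by rewrite ler_nat.
    by rewrite ler_pdivrMr// mulrC.
  pose D := (total + n0%:R) * (n0.+2%:R + total).
  have D1 : 0 < total + n0%:R by rewrite ltr_wpDr.
  have D2 : 0 < n0.+2%:R + total by rewrite addr_gt0.
  pose del := c0 / D.
  have D0 : 0 < D by rewrite mulr_gt0.
  have del0 : 0 < del by rewrite divr_gt0.
  (* the gain at the finitely many levels below n0 is a fixed proportion of the weight *)
  have key n : (m <= n)%N -> (n < n0)%N ->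
      weight n - c0 / (total + n%:R) <= (1 - del) * weight n.
    move=> mn nn0; have d0 : 0 < total + n%:R by rewrite ltr_wpDr.
    suff : del * weight n <= c0 / (total + n%:R) by lra.
    rewrite /del mulrAC -mulrA; apply: ler_wpM2l; first exact: ltW.
    rewrite ler_pdivrMr// mulrC ler_pdivlMr//.
    have n0n : n%:R <= n0%:R :> R by rewrite ler_nat ltnW.
    rewrite /D mulrC; apply: ler_pM.
    - exact: ltW.
    - by rewrite (le_trans _ (w1 _ mn)).
    - by rewrite lerD2l.
    - by apply: le_trans (weight_le n) _; rewrite lerD2r ler_nat !ltnS ltnW.
  have del1 : del <= 1.
    rewrite /del ler_pdivrMr// mul1r (@le_trans _ _ total)//.
      by rewrite /c0 ge_min lexx.
    rewrite /D; have : 1 <= n0.+2%:R + total.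
      by rewrite -natr1; have : 0 <= n0.+1%:R :> R by []; move: total_gt0; lra.
    move=> h; rewrite (@le_trans _ _ (total + n0%:R))//.
      by rewrite lerDl.
    by rewrite ler_peMr// ltW.
  have it (j : nat) : bd (Num.max e (C * (1 - del) ^+ j)).
    elim: j => [|j ih].
      have [h1 h2] := bdC C0; rewrite expr0 mulr1.
      split=> [c i t tT mc|c i j t tT mc];
       (apply: le_trans; [by [apply: h1|apply: h2]|]);
       rewrite lerD2l ler_wpM2r ?le_max ?lexx ?orbT//;
       by rewrite (le_trans _ (w1 _ _))// leqW.
    have M0 : 0 <= Num.max e (C * (1 - del) ^+ j) by rewrite le_max ltW.
    have [h1 h2] := improve _ M0 ih.
    have gen (x : R) (t : R) n : (m <= n)%N -> 0 <= t <= T -> x <= C ->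
       x <= b t n + Num.max e (C * (1 - del) ^+ j) * (weight n - c0 / (total + n%:R)) ->
       x <= b t n + Num.max e (C * (1 - del) ^+ j.+1) * weight n.
      move=> mn tT xC xb; have wn0 : 0 <= weight n by rewrite (le_trans _ (w1 _ mn)).
      have [nn|nn] := leqP n0 n.
        apply: (le_trans xC); apply: ler_wpDl; first by apply: b0 => //; case/andP: tT.
        by apply: (le_trans (n0C _ nn)); rewrite ler_wpM2r// le_max lexx.
      apply: (le_trans xb); rewrite lerD2l.
      apply: le_trans (ler_wpM2l M0 (key _ mn nn)) _.
      rewrite mulrA; apply: ler_wpM2r => //.
      rewrite maxr_pMl ?subr_ge0// exprSr mulrA.
      rewrite ge_max !le_max lexx orbT andbT; apply/orP; left.
      by rewrite ler_piMr// ?ltW//; lra.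
    split=> [c i t tT mc|c i k t tT mc]; apply: gen => //.
    - exact: leqW.
    - exact: uC.
    - exact: h1.
    - exact: uC.
    - exact: h2.
  have [j jC] : exists j : nat, C * (1 - del) ^+ j <= e.
    have : (fun j : nat => C * (1 - del) ^+ j) @ \oo --> C * 0.
      apply: cvgMr; apply: cvg_expr; rewrite ger0_norm ?subr_ge0//; lra.
    rewrite mulr0 => /cvgrPdist_le/(_ e e0)[j _ /(_ j (leqnn _))]/=.
    rewrite sub0r normrN => /(le_trans (ler_norm _)) h; exists j; exact: h.
  by have := it j; rewrite (max_idPl jC).
split=> [c i t tT mc|c i j t tT mc]; apply/ler_addgt0Pr => e e0.
- have wn : 0 < weight (tot c).+1 by rewrite (lt_le_trans _ (w1 _ (leqW mc))).
  have [h _] := bdeps _ (divr_gt0 e0 wn).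
  by have := h c i t tT mc; rewrite divfK// gt_eqF.
- have wn : 0 < weight (tot c).+1 by rewrite (lt_le_trans _ (w1 _ mc)).
  have [_ h] := bdeps _ (divr_gt0 e0 wn).
  by have := h c i j t tT mc; rewrite divfK// gt_eqF.
Qed.

End generator.

(** * Barriers on the number of points *)

Section supersolutions.
Context {R : realType}.
Implicit Types (lam : R) (m n : nat) (phi U : nat -> R).

(** The source 1 / n is the Lipschitz constant of a test function for adding or moving
a point in a configuration of n points. *)
Definition barrier lam m phi := (forall n, 0 <= phi n) /\
  forall n, (m <= n)%N -> n%:R^-1 <= level_drift lam m phi n.

(** Above m the barrier is constant and the killing term phi n alone dominates 1 / n;
the jump of height 1 / (m lam) at m compensates the missing deaths at m, and
its effect on level m + 1 is what 1 / lam is for. *)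
Lemma flat_barrier lam m : 0 < lam -> (0 < m)%N ->
  barrier lam m (fun n =>
    m%:R^-1 + (if n == m then m.+1%:R / (m%:R * lam) else lam^-1)).
Proof.
move=> lam0 m0; have m0' : 0 < m%:R :> R by rewrite ltr0n.
have ml0 : 0 < m%:R * lam by rewrite mulr_gt0.
split=> [n|n]; first by case: ifP => _; rewrite addr_ge0// ?invr_ge0 ?divr_ge0 ?ltW.
rewrite leq_eqVlt => /predU1P[<-|].
  rewrite /level_drift eqxx ltnn gtn_eqF// addr0 -natr1.
  rewrite le_eqVlt; apply/orP; left; apply/eqP.
  by field; rewrite !gt_eqF.
case: n => // n; rewrite ltnS => mn.
have e1 : (n.+1 == m) = false by rewrite gtn_eqF.
have e2 : (n.+2 == m) = false by rewrite gtn_eqF// ltnS leqW.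
rewrite /level_drift ltnS mn [n.+1.-1]/= e1 e2.
have nm : n.+1%:R^-1 <= m%:R^-1 :> R.
  by rewrite lef_pV2 ?posrE ?ltr0n// ler_nat leqW.
have [->|_] := eqVneq n m; last first.
  rewrite !subrr !mulr0 !add0r; apply: (le_trans nm).
  by rewrite lerDl invr_ge0 ltW.
rewrite subrr mulr0 add0r.
have -> : m%:R * (m%:R^-1 + lam^-1 - (m%:R^-1 + m.+1%:R / (m%:R * lam))) = - lam^-1.
  by rewrite -natr1; field; rewrite !gt_eqF.
by rewrite addrCA addNr addr0 lef_pV2 ?posrE ?ltr0n// ler_nat.
Qed.

(** A nonincreasing supersolution U of the problem without blocked deaths lacks at
level m the term U m, but never more than 1 / m.  A drop of
c = min (1 / m) (U m) / lam between m and m + 1 supplies it at rate lam; the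
price above m is the constant c m, for which the killing term pays at level
m + 1. *)
Lemma lift_barrier lam m U : 0 < lam -> (0 < m)%N -> (forall n, 0 <= U n) ->
  (forall n, (0 < n)%N -> U n.+1 <= U n) ->
  (forall n, (0 < n)%N -> n%:R^-1 <=
     lam * (U n - U n.+1) + n.-1%:R * (U n - U n.-1) + U n) ->
  barrier lam m (fun n => U n +
    Num.min m%:R^-1 (U m) / lam * (if n == m then m.+1 else m)%:R).
Proof.
move=> lam0 m0 U0 Udec Usup; set c := Num.min _ _ / lam.
have c0 : 0 <= c.
  by apply: divr_ge0; [rewrite le_min U0 invr_ge0 ler0n | exact: ltW].
split=> [n|n]; first by rewrite addr_ge0// mulr_ge0.
rewrite leq_eqVlt => /predU1P[<-|].
  rewrite /level_drift eqxx ltnn gtn_eqF// addr0 -natr1.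
  have -> : lam * (U m + c * (m%:R + 1) - (U m.+1 + c * m%:R)) =
    lam * (U m - U m.+1) + c * lam by ring.
  rewrite /c divfK ?gt_eqF//.
  have [_|_] := leP (m%:R^-1) (U m).
    by rewrite lerDr mulr_ge0 ?subr_ge0 ?Udec// ltW.
  have := Usup _ m0.
  have : m.-1%:R * (U m - U m.-1) <= 0.
    case: m m0 {c c0} => // -[|k] _; first by rewrite mul0r.
    by rewrite mulr_ge0_le0// subr_le0 Udec.
  lra.
case: n => // n; rewrite ltnS => mn.
have e1 : (n.+1 == m) = false by rewrite gtn_eqF.
have e2 : (n.+2 == m) = false by rewrite gtn_eqF// ltnS leqW.
rewrite /level_drift ltnS mn [n.+1.-1]/= e1 e2.
apply: (le_trans (Usup n.+1 isT)) => /=.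
have [->|_] := eqVneq n m; rewrite -?natr1; last by have := mulr_ge0 c0 (ler0n R m); lra.
lra.
Qed.

Definition harm (L n : nat) : R := \sum_(k < L) (n + k)%:R^-1.

Lemma harm_ge0 L n : 0 <= harm L n.
Proof. by apply: sumr_ge0 => i _; rewrite invr_ge0. Qed.

Lemma harm_sub L n : harm L n - harm L n.+1 = n%:R^-1 - (n + L)%:R^-1.
Proof.
rewrite /harm; elim: L => [|L ih]; first by rewrite !big_ord0 addn0 !subrr.
by rewrite !big_ord_recr/= opprD addrACA ih addnS addSn addrA subrK.
Qed.

Lemma ln_le_harm L n : (0 < n)%N -> ln ((n + L)%:R / n%:R) <= harm L n.
Proof.
move=> n0; rewrite /harm; elim: L => [|L ih].
  by rewrite big_ord0 addn0 divff ?ln1// pnatr_eq0 -lt0n.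
have h k : (0 < k + n)%N by rewrite addn_gt0 n0 orbT.
have p k : 0 < (n + k)%:R :> R by rewrite ltr0n addnC h.
rewrite big_ord_recr/=.
have -> : (n + L.+1)%:R / n%:R = (n + L)%:R / n%:R * (1 + (n + L)%:R^-1) :> R.
  rewrite addnS -natr1; field.
  by rewrite -natrD !pnatr_eq0 -!lt0n n0 addn_gt0 n0.
have pn : 0 < n%:R :> R by rewrite ltr0n.
rewrite lnM ?posrE ?divr_gt0//; apply: lerD => //; apply: le_ln1Dx.
by rewrite (@lt_trans _ _ 0)// invr_gt0.
Qed.

(** Each new term is compared with the increment of the logarithm by
ln (1 - 1 / y) <= - 1 / y. *)
Lemma harm2_le L : harm L 2 <= 2^-1 + ln (L.+1%:R / 2) \/ L = 0%N.
Proof.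
case: L => [|L]; [by right|left].
rewrite /harm; elim: L => [|L ih].
  by rewrite big_ord_recr big_ord0/= add0r addn0 divff ?pnatr_eq0// ln1 addr0.
rewrite big_ord_recr/=; apply: le_trans (lerD ih (lexx _)) _.
rewrite -addrA lerD2l add2n.
have p k : 0 < k.+1%:R :> R by rewrite ltr0n.
have -> : L.+2%:R / 2 = L.+3%:R / 2 * (1 + (- L.+3%:R^-1)) :> R.
  have := p L.+2; rewrite -[L.+2%:R](addrK 1) natr1.
  by move: (L.+3%:R) => y y0; field; rewrite gt_eqF.
have q : 0 < 1 + (- L.+3%:R^-1) :> R.
  by rewrite subr_gt0 invf_lt1// ltr1n.
rewrite lnM ?posrE ?divr_gt0//.
have := @le_ln1Dx R (- L.+3%:R^-1); rewrite ltrN2 invf_lt1// ltr1n => /(_ isT) h.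
by rewrite -addrA gerDl -lerBrDr sub0r.
Qed.

(** 2 = 5/4 * 6/5 * 7/6 * 8/7 and ln x >= 1 - 1 / x, so that
ln 2 >= 1/5 + 1/6 + 1/7 + 1/8. *)
Lemma ln2_ge : 1/2 + 4 / 30 <= ln 2 :> R.
Proof.
have h (x : R) : 0 < x -> 1 - x^-1 <= ln x.
  move=> x0; have := @le_ln1Dx R (x^-1 - 1); rewrite ltrBrDl subrr invr_gt0 x0.
  by move=> /(_ isT); rewrite addrC subrK lnV ?posrE//; lra.
have h1 : 1 - (5 / 4)^-1 <= ln (5 / 4) :> R by apply: h; lra.
have h2 : 1 - (6 / 5)^-1 <= ln (6 / 5) :> R by apply: h; lra.
have h3 : 1 - (7 / 6)^-1 <= ln (7 / 6) :> R by apply: h; lra.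
have h4 : 1 - (8 / 7)^-1 <= ln (8 / 7) :> R by apply: h; lra.
rewrite !invf_div in h1 h2 h3 h4.
have -> : ln 2 = ln (5 / 4) + ln (6 / 5) + (ln (7 / 6) + ln (8 / 7)) :> R.
  rewrite -!lnM ?posrE; [|lra..].
  by congr ln; field.
lra.
Qed.

(** The profile harm L n / lam telescopes: the births contribute
1 / n - 1 / (n + L) to the drift.  The rest of the drift, that
is the term 1 / (n + L) and the deaths, is bounded by 1/2 and by the logarithmic
size of harm L n. *)
Definition harmonic_profile lam (L n : nat) : R := (1/2 + harm L n) / lam.

(** What remains after the telescoping is, for x = n >= 2 and up to a small error,
2 L / (x + L) <= 1/2 + ln ((x + L) / x).  With y = 2 x / (x + L) and
ln y <= y - 1 this reduces to 2 - y <= 1/2 + ln 2 + 1 - y, that is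
ln 2 >= 1/2; the margin 4/30 covers the error. *)
Lemma harmonic_profile_super lam (L : nat) n : 0 < lam -> lam <= L%:R -> (4 <= L)%N ->
  (0 < n)%N -> let U := harmonic_profile lam L in
  n%:R^-1 <= lam * (U n - U n.+1) + n.-1%:R * (U n - U n.-1) + U n.
Proof.
move=> lam0 lamL L4 n0 /=.
have pn : 0 < n%:R :> R by rewrite ltr0n.
have pL : 4 <= L%:R :> R by rewrite (ler_nat R 4).
have -> : lam * (harmonic_profile lam L n - harmonic_profile lam L n.+1) =
    n%:R^-1 - (n + L)%:R^-1.
  rewrite -harm_sub /harmonic_profile; field; rewrite gt_eqF//.
suff : lam * (n + L)%:R^-1 + n.-1%:R * (harm L n.-1 - harm L n) <= 1/2 + harm L n.
  rewrite /harmonic_profile => h; rewrite -(ler_pM2l lam0).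
  have -> : lam * (n%:R^-1 - (n + L)%:R^-1 +
   n.-1%:R * ((1 / 2 + harm L n) / lam - (1 / 2 + harm L n.-1) / lam) +
    (1 / 2 + harm L n) / lam) = lam * n%:R^-1 - lam * (n + L)%:R^-1 +
    n.-1%:R * (harm L n - harm L n.-1) + (1 / 2 + harm L n).
    by field; rewrite -natrD !gt_eqF// ltr0n addn_gt0 n0.
  lra.
have pnL : 0 < n%:R + L%:R :> R by rewrite addr_gt0//; lra.
case: n n0 pn pnL => // -[|n] _ pn pnL.
  rewrite mul0r addr0 natrD.
  apply: (@le_trans _ _ 1); first by rewrite ler_pdivrMr// mul1r; lra.
  rewrite /harm; case: L lamL L4 pL pnL => // L _ _ _ _.
  rewrite big_ord_recl/= addn0 invr1.
  have : 0 <= \sum_(i < L) (1 + bump 0 i)%:R^-1 :> R.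
    by apply: sumr_ge0 => i _; rewrite invr_ge0.
  lra.
rewrite [n.+2.-1]/= harm_sub.
have n1 : 0 < n.+1%:R :> R by rewrite ltr0n.
have -> : n.+1%:R * (n.+1%:R^-1 - (n.+1 + L)%:R^-1) = L%:R / (n.+1%:R + L%:R) :> R.
  have : 0 < n.+1%:R + L%:R :> R by rewrite addr_gt0//; lra.
  rewrite natrD; move: (n.+1%:R) n1 => a a0 aL.
  by field; rewrite !gt_eqF.
have hl := @ln_le_harm L n.+2 isT.
set x : R := n.+2%:R in pn pnL hl *.
have x2 : 2 <= x by rewrite /x (ler_nat R 2).
have xE : n.+1%:R = x - 1 by rewrite /x -[in RHS]natr1 addrK.
rewrite xE natrD -/x; rewrite natrD -/x in hl.
set l := L%:R in pL pnL lamL hl *.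
have l2 : ln 2 + 1 - 2 * x / (x + l) <= ln ((x + l) / x).
  have q : 0 < 2 * x / (x + l) by rewrite divr_gt0// mulr_gt0.
  have := @le_ln1Dx R (2 * x / (x + l) - 1).
  rewrite ltrBrDl subrr q => /(_ isT).
  have -> : 1 + (2 * x / (x + l) - 1) = 2 * ((x + l) / x)^-1.
    by field; rewrite !gt_eqF.
  have z0 : 0 < (x + l) / x by rewrite divr_gt0.
  move: ((x + l) / x) (2 * x / (x + l)) z0 => z y z0.
  rewrite lnM ?posrE ?invr_gt0//.
  rewrite lnV ?posrE//.
  move=> {hl pn x2 xE lamL pL pnL q}.
  lra.
have l3 := ln2_ge.
have pd : 0 < x - 1 + l by lra.
have e1 : lam / (x + l) <= l / (x + l) by rewrite ler_pM2r ?invr_gt0.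
have e2 : l / (x - 1 + l) <= l / (x + l) + 4 / 30.
  have -> : l / (x - 1 + l) = l / (x + l) + l / ((x - 1 + l) * (x + l)).
    by field; rewrite !gt_eqF.
  rewrite lerD2l ler_pdivrMr ?mulr_gt0//; nra.
have e3 : 2 * x / (x + l) = 2 - 2 * (l / (x + l)) by field; rewrite gt_eqF.
lra.
Qed.

Lemma harmonic_profile_dec lam L n : 0 < lam -> (0 < n)%N ->
  harmonic_profile lam L n.+1 <= harmonic_profile lam L n.
Proof.
move=> lam0 n0; rewrite /harmonic_profile ler_pM2r ?invr_gt0// lerD2l -subr_ge0.
by rewrite harm_sub subr_ge0 lef_pV2 ?posrE ?ltr0n ?addn_gt0 ?n0// ler_nat leq_addr.
Qed.

Lemma harmonic_profile_ge0 lam L n : 0 < lam -> 0 <= harmonic_profile lam L n.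
Proof. 
move=> lam0; apply: divr_ge0; last exact: ltW.
by apply: addr_ge0; [lra | exact: harm_ge0].
 Qed.

Lemma harmonic_profile1 lam L : 0 < lam ->
  harmonic_profile lam L 1 <= harmonic_profile lam L 2 + lam^-1.
Proof.
move=> lam0; rewrite /harmonic_profile -(ler_pM2r lam0) [leRHS]mulrDl.
rewrite !divfK ?mulVf ?gt_eqF//; have := harm_sub L 1; rewrite invr1.
have : 0 <= (1 + L)%:R^-1 :> R by rewrite invr_ge0.
lra.
Qed.

(** The constant 0.95: 1/2 + harm L 2 <= 1 + ln ((L + 1) / 2), where
(L + 1) / 2 <= (lam + 2) / 2 <= 5/6 lam as lam > 3, and
1 + ln (5/6) <= 1 - 1/6 < 0.95. *)
Lemma harmonic_profile2 lam L : 3 < lam -> (0 < L)%N -> L%:R <= lam + 1 ->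
  harmonic_profile lam L 2 <= (95%:R / 100%:R + ln lam) / lam.
Proof.
move=> lam3 L0 Llam; have lam0 : 0 < lam by lra.
rewrite ler_pM2r ?invr_gt0//.
have [h|L0'] := harm2_le L; last by rewrite L0' in L0.
have h1 : ln (L.+1%:R / 2) <= ln (lam * (5/6)) :> R.
  rewrite ler_ln ?posrE ?divr_gt0 ?ltr0n// -?[L.+1%:R]natr1; last by rewrite mulr_gt0//; lra.
  by rewrite ler_pdivrMr//; lra.
have h2 : ln (lam * (5/6)) <= ln lam - 1/6.
  rewrite lnM ?posrE//.
  have := @le_ln1Dx R (- (1/6)); have -> : 1 + - (1/6) = 5/6 :> R by field.
  have p : - 1 < - (1 / 6) :> R by lra.
  by move=> /(_ p); lra.
lra.
Qed.

Definition K1 lam m : R :=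
  Num.min (m%:R^-1) ((95%:R / 100%:R + Num.max (ln lam) 0) / lam).

(** The flat barrier is used when the minimum in [K1] is 1 / m, and also when
lam <= 3, where twice the logarithmic term of K1 is at least 1.  In the other cases
the lifted harmonic profile gives the bound; in the second estimate the case
m = 1 is separate because there the height of the lift involves U 1, which may
exceed U 2 by 1 / lam. *)
Lemma barriers_exist lam m : 0 < lam -> (0 < m)%N ->
  (exists2 phi, barrier lam m phi & forall n, (m < n)%N ->
     phi n <= lam^-1 + (m%:R + 1) * K1 lam m) /\
  (m%:R + 2 < lam -> exists2 phi, barrier lam m phi & forall n, (m < n)%N ->
     phi n <= 1 / (lam * (lam - m%:R)) + lam / (lam - m%:R) * K1 lam m).
Proof.
move=> lam0 m0; have m1 : 1 <= m%:R :> R by rewrite ler1n.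
have mp : 0 < m%:R :> R by rewrite ltr0n.
have flat b : m%:R^-1 + lam^-1 <= b ->
    exists2 phi, barrier lam m phi & forall n, (m < n)%N -> phi n <= b.
  move=> hb; eexists; first exact: flat_barrier.
  by move=> n mn /=; rewrite gtn_eqF.
have logb : 3 < lam -> exists L : nat,
    let U := harmonic_profile lam L in
    [/\ U 2 <= (95%:R / 100%:R + ln lam) / lam, U 1 <= U 2 + lam^-1,
      forall n, (0 < n)%N -> U n.+1 <= U n,
      forall n, 0 <= U n
     & barrier lam m (fun n => U n +
    Num.min m%:R^-1 (U m) / lam * (if n == m then m.+1 else m)%:R)].
  move=> lam3; exists (Num.truncn lam).+1 => U.
  have L1 : lam <= (Num.truncn lam).+1%:R by rewrite ltW// truncnS_gt.
  have L2 : (Num.truncn lam).+1%:R <= lam + 1.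
    by rewrite -natr1 lerD2r truncn_le// ltW.
  have L4 : (4 <= (Num.truncn lam).+1)%N.
    by rewrite ltnS truncn_ge_nat ltW.
  split; first exact: harmonic_profile2.
  - exact: harmonic_profile1.
  - by move=> n; exact: harmonic_profile_dec.
  - by move=> n; exact: harmonic_profile_ge0.
  - apply: lift_barrier => // [n|n n0|n n0].
    + exact: harmonic_profile_ge0.
    + exact: harmonic_profile_dec.
    + exact: harmonic_profile_super.
have Udec2 U : (forall n, (0 < n)%N -> U n.+1 <= U n) -> forall n, (1 < n)%N -> U n <= U 2.
  move=> Ud; case=> // -[//|]; elim=> [//|n ih] _.
  by apply: le_trans (Ud _ _) (ih _).
have lnge : 1 - lam^-1 <= ln lam.
  have := @le_ln1Dx R (lam^-1 - 1); rewrite ltrBrDl subrr invr_gt0 lam0.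
  by move=> /(_ isT); rewrite addrC subrK lnV ?posrE//; lra.
have lamV : lam * lam^-1 = 1 by rewrite divff// gt_eqF.
split; last move=> lamm; rewrite /K1; have [K|K] := leP (m%:R^-1) _.
- apply: flat; rewrite mulrDl mul1r divff ?gt_eqF//.
  have : m%:R^-1 <= 1 :> R by rewrite invf_le1.
  have : 0 <= m%:R^-1 :> R by rewrite invr_ge0.
  lra.
- set q := (_ / lam) in K *.
  have [lam3|lam3] := leP lam 3.
    apply: flat; rewrite addrC lerD2l.
    have : m%:R^-1 <= 1 :> R by rewrite invf_le1.
    suff : 1 <= 2 * q.
      have q0 : 0 <= q.
        apply: divr_ge0; last exact: ltW.
        by rewrite addr_ge0// le_max lexx orbT.
      have : 1 * q <= m%:R * q by rewrite ler_wpM2r.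
      lra.
    rewrite /q mulrA ler_pdivlMr// mul1r.
    have : 0 <= Num.max (ln lam) 0 by rewrite le_max lexx orbT.
    (* 2 * 0.95 covers lam <= 1.9; beyond, ln lam >= 1 - 1 / lam is added *)
    have [lam19|lam19] := leP lam (19/10); first lra.
    have : ln lam <= Num.max (ln lam) 0 by rewrite le_max lexx.
    nra.
  have [L] := logb lam3; set U := harmonic_profile lam L => -[U2 U1 Ud U0 bar].
  eexists; [exact: bar | move=> n mn /=; rewrite gtn_eqF//].
  have h1 : U n <= U 2 by apply: Udec2 => //; rewrite (leq_ltn_trans _ mn).
  have h2 : U n <= q.
    apply: (le_trans h1); apply: (le_trans U2).
    by rewrite ler_pM2r ?invr_gt0// lerD2l le_max lexx.
  have h3 : Num.min m%:R^-1 (U m) / lam * m%:R <= lam^-1.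
    rewrite mulrAC; apply: ler_piMl; first by rewrite invr_ge0 ltW.
    by rewrite -ler_pdivlMr// div1r ge_min lexx.
  have q0 : 0 <= q by apply: le_trans h2.
  have : 0 <= m%:R * q by rewrite mulr_ge0.
  lra.
- apply: flat; have lm : 0 < lam - m%:R by lra.
  have -> : lam / (lam - m%:R) * m%:R^-1 = m%:R^-1 + (lam - m%:R)^-1.
    by field; rewrite !gt_eqF.
  have : 0 <= 1 / (lam * (lam - m%:R)) by rewrite divr_ge0// mulr_ge0// ltW.
  have : lam^-1 <= (lam - m%:R)^-1 by rewrite lef_pV2 ?posrE//; lra.
  lra.
- have lam3 : 3 < lam by lra.
  have lm : 0 < lam - m%:R by lra.
  have [L] := logb lam3; set U := harmonic_profile lam L => -[U2 U1 Ud U0 bar].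
  eexists; [exact: bar | move=> n mn /=; rewrite gtn_eqF//].
  have h1 : U n <= U 2 by apply: Udec2 => //; rewrite (leq_ltn_trans _ mn).
  have -> : Num.max (ln lam) 0 = ln lam.
    apply/max_idPl; have : lam^-1 <= 1 by rewrite invf_le1//; lra.
    lra.
  set A := 95%:R / 100%:R + ln lam in U2 *.
  have A0 : 0 <= A.
    by have := le_trans (U0 2) U2; rewrite pmulr_lge0// invr_gt0.
  have -> : 1 / (lam * (lam - m%:R)) + lam / (lam - m%:R) * (A / lam) =
     (1 + lam * A) / (lam * (lam - m%:R)).
    by field; rewrite !gt_eqF.
  rewrite ler_pdivlMr ?mulr_gt0//.
  have h3 : Num.min m%:R^-1 (U m) / lam * m%:R <= m%:R * U m / lam.
    rewrite mulrAC (mulrC m%:R) ler_pM2r ?invr_gt0// ler_pM2r//.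
    by rewrite ge_min lexx orbT.
  have [m1'|m1'] := eqVneq m 1%N.
    rewrite m1' in h3 *; rewrite m1' in lm lamm.
    have h4 : U 2 * lam <= A by rewrite -ler_pdivlMr.
    have h5 : U 1 * lam <= A + 1.
      by have := ler_wpM2r (ltW lam0) U1; rewrite mulrDl mulVf ?gt_eqF//; lra.
    rewrite mul1r in h3.
    have h6 : U 1 / lam * lam = U 1 by rewrite divfK ?gt_eqF.
    have h7 : Num.min 1%:R^-1 (U 1) / lam * 1%:R <= U 1 / lam by [].
    set d := Num.min _ _ / lam * _ in h7 *.
    have h8 : (U n + d) * lam <= A + U 1.
      have : (U n + d) * lam <= (U 2 + U 1 / lam) * lam by rewrite ler_pM2r//; lra.
      rewrite (mulrDl (U 2)) h6; lra.
    rewrite mulrA; have : (A + U 1) * (lam - 1) <= 1 + lam * A by nra.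
    have : (U n + d) * lam * (lam - 1%:R) <= (A + U 1) * (lam - 1) by rewrite ler_pM2r.
    lra.
  have h4 : U 2 * lam <= A by rewrite -ler_pdivlMr.
  have Um : U m <= U 2 by apply: Udec2 => //; move: m0 m1'; case: (m) => // -[].
  set d := Num.min _ _ / lam * _ in h3 *.
  have h5 : (U n + d) * lam <= U 2 * lam + m%:R * U 2.
    have : (U n + d) * lam <= (U 2 + m%:R * U m / lam) * lam by rewrite ler_pM2r//; lra.
    have e : m%:R * U m / lam * lam = m%:R * U m by rewrite divfK ?gt_eqF.
    rewrite (mulrDl (U 2)) e.
    have : m%:R * U m <= m%:R * U 2 by rewrite ler_pM2l.
    lra.
  have h6 : (U n + d) * lam * (lam - m%:R) <= (U 2 * lam + m%:R * U 2) * (lam - m%:R).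
    by rewrite ler_pM2r.
  have h7 : (U 2 * lam + m%:R * U 2) * (lam - m%:R) = U 2 * lam * lam - m%:R * m%:R * U 2.
    by ring.
  have h8 : U 2 * lam * lam <= A * lam by rewrite ler_pM2r.
  have : 0 <= m%:R * m%:R * U 2 by rewrite mulr_ge0// mulr_ge0.
  move=> h9; rewrite (mulrA _ lam); apply: (le_trans h6); rewrite h7.
  by apply: ler_wpDl => //; apply: le_trans (_ : _ <= A * lam) _; rewrite ?(mulrC A)// lerBlDr (le_trans h8)// (mulrC A) lerDl.
Qed.

End supersolutions.

(** * The semigroup of the chain of counts *)

Section primitive.
Context {R : realType}.
Local Notation mu := (@lebesgue_measure R).
Implicit Types h : R -> R.

Lemma continuous_itv_integrable h a b : continuous h ->
  mu.-integrable `[a, b] (EFin \o h).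
Proof.
move=> ch; apply: continuous_compact_integrable; first exact: segment_compact.
exact: continuous_subspaceT.
Qed.

(** The integral of h from 0 to t for t >= 0, and 0 for t <= 0, so that all functions
of time stay continuous on the whole line.  The lower end -1 makes 0 an interior
point, where the fundamental theorem of calculus gives continuity. *)
Definition prim h (t : R) : R :=
  (\int[mu]_(x in `[-1, Num.max t 0]) h x - \int[mu]_(x in `[-1, 0%R]) h x)%R.

Lemma prim0 h : prim h 0 = 0.
Proof. by rewrite /prim maxxx subrr. Qed.

Lemma prim_aux h (t : R) : continuous h -> -1 < t ->
  derivable (fun x : R => \int[mu]_(y in `[-1, x]) h y)%R t 1 /\
  (fun x : R => \int[mu]_(y in `[-1, x]) h y)%R^`()%classic t = h t.
Proof.
move=> ch t1; apply: (@continuous_FTC1_closed _ h (-1) t (t + 1)) => //.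
- by rewrite ltrDl.
- exact: continuous_itv_integrable.
- exact: ch.
Qed.

Lemma continuous_prim h : continuous h -> continuous (prim h).
Proof.
move=> ch t; apply: cvgB; last exact: cvg_cst.
have ct : {for Num.max t 0, continuous (fun x : R => \int[mu]_(y in `[-1, x]) h y)%R}.
  apply: differentiable_continuous; apply/derivable1_diffP.
  by apply: (prim_aux ch _).1; rewrite lt_max ltrN10 orbT.
apply: (@continuous_comp _ _ _ (fun t : R => Num.max t 0)
  (fun x : R => \int[mu]_(y in `[-1, x]) h y)%R) => //.
apply: continuous_max; [exact: cvg_id|exact: cvg_cst].
Qed.

Lemma is_derive_prim h (t : R) : continuous h -> 0 < t ->
  is_derive t 1 (prim h) (h t).
Proof.
move=> ch t0.
have t1 : -1 < t by rewrite (lt_trans _ t0)// ltrN10.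
have [dF FE] := prim_aux ch t1.
pose F := fun x : R => (\int[mu]_(y in `[-1, x]) h y - \int[mu]_(x in `[-1, 0%R]) h x)%R.
have dF' : is_derive t 1 F (h t).
  have ? : is_derive t 1 (fun x : R => \int[mu]_(y in `[-1, x]) h y)%R (h t).
    have FE' : 'D_1 (fun x : R => \int[mu]_(y in `[-1, x]) h y)%R t = h t.
      by rewrite -derive1E.
    exact: DeriveDef dF FE'.
  by rewrite /F; apply: is_derive_eq; rewrite subr0.
apply: (near_eq_is_derive _ dF').
near=> x; rewrite /prim /F.
have x0 : 0 < x by near: x; exact: lt_nbhsr.
by rewrite (max_idPl (ltW x0)).
Unshelve. all: by end_near.
Qed.

Lemma prim_integral h (t : R) : continuous h -> 0 <= t ->
  (\int[mu]_(x in `[0%R, t]) (h x)%:E = (prim h t)%:E)%E.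
Proof.
move=> ch; rewrite le_eqVlt => /predU1P[<-|t0].
  by rewrite set_itv1 integral_set1 prim0.
rewrite (@continuous_FTC2 _ h (prim h) 0 t) ?prim0 ?sube0//.
- exact: continuous_subspaceT.
- split.
  + move=> x; rewrite in_itv/= => /andP[x0 _].
    by have := is_derive_prim ch x0 => -[].
  + by apply: cvg_at_right_filter; exact: continuous_prim.
  + by apply: cvg_at_left_filter; exact: continuous_prim.
- move=> x; rewrite in_itv/= => /andP[x0 _].
  by have := is_derive_prim ch x0 => ?; rewrite derive1E derive_val.
Qed.

Lemma prim_le (h h' : R -> R) (t : R) : continuous h -> continuous h' ->
  (forall v, 0 < v -> h v <= h' v) -> prim h t <= prim h' t.
Proof.
move=> ch ch' hh'; have [t0|t0] := leP t 0.
  by rewrite /prim (max_idPr t0) !subrr.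
rewrite -subr_ge0.
have := @le_of_derive_ge0 _ (fun v => prim h' v - prim h v) (fun v => h' v - h v) 0 t.
rewrite !prim0 subrr; apply => //.
- exact: ltW.
- by move=> v; apply: cvgB; exact: continuous_prim.
- move=> v v0; have ? := is_derive_prim ch v0; have ? := is_derive_prim ch' v0.
  exact: is_deriveB.
- by move=> v v0 _; rewrite subr_ge0 hh'.
Qed.

Lemma prim_ge0 (h : R -> R) (t : R) : continuous h ->
  (forall v, 0 < v -> 0 <= h v) -> 0 <= prim h t.
Proof.
move=> ch h0; have [t0|t0] := leP t 0.
  by rewrite /prim (max_idPr t0) subrr.
rewrite -(prim0 h); apply: (@le_of_derive_ge0 _ (prim h) h 0 t).
- exact: ltW.
- exact: continuous_prim.
- by move=> v; exact: is_derive_prim.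
- by move=> v v0 _; exact: h0.
Qed.

Lemma prim_exp (r t : R) : 0 <= t ->
  prim (fun v : R => r * expR (r * v)) t = expR (r * t) - 1.
Proof.
move=> t0; have ce : continuous (fun v : R => r * expR (r * v)).
  by move=> v; apply: cvgM; [exact: cvg_cst | exact: continuous_expM].
pose D v := prim (fun v : R => r * expR (r * v)) v - (expR (r * v) - 1).
have cD : continuous D.
  move=> v; apply: cvgB; first exact: continuous_prim.
  by apply: cvgB; [exact: continuous_expM | exact: cvg_cst].
have dD (v : R) : 0 < v -> is_derive v 1 D 0.
  move=> v0; have ? := is_derive_prim ce v0.
  by rewrite /D; apply: is_derive_eq; rewrite /GRing.scale/=; ring.
have D0 : D 0 = 0 by rewrite /D prim0 mulr0 expR0 subrr subr0.
have h1 : 0 <= D t.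
  by rewrite -D0; apply: (@le_of_derive_ge0 _ D (fun=> 0) 0 t).
have h2 : 0 <= - D t.
  rewrite -[0]oppr0 -D0; apply: (@le_of_derive_ge0 _ (fun v => - D v) (fun=> 0) 0 t) => //.
  - by move=> v; apply: cvgN; exact: cD.
  - by move=> v v0; have ? := dD _ v0; apply: is_derive_eq; rewrite oppr0.
by apply/eqP; rewrite -subr_eq0 eq_le h1 andbT -oppr_ge0.
Qed.

End primitive.

Section picard.
Context {R : realType} {I : finType}.
Variables (l : I -> R) (m : nat).
Hypothesis l_ge0 : forall i, 0 <= l i.
Hypothesis total_gt0 : 0 < total l.
Variable f : {ffun I -> nat} -> R.
Hypothesis f01 : forall c, 0 <= f c <= 1.
Implicit Types (c : {ffun I -> nat}) (i j : I) (g : {ffun I -> nat} -> R).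
Local Notation rate := (rate l m).
Local Notation jumps := (jumps l m).
Local Notation mu := (@lebesgue_measure R).

Lemma rate_gt0 c : 0 < rate c.
Proof. by rewrite ltr_wpDl// /death; case: ifP. Qed.

Lemma jumps1 c : jumps (fun=> 1) c = rate c.
Proof.
rewrite /jumps /rate /death /total addrC; congr (_ + _).
  case: ifP => // _; rewrite -sum_tot.
  by apply: eq_bigr => i _; rewrite mulr1.
by apply: eq_bigr => i _; rewrite mulr1.
Qed.

Lemma le_jumps g g' c : (forall c, g c <= g' c) -> jumps g c <= jumps g' c.
Proof.
move=> gg'; apply: lerD; first by apply: ler_sum => i _; rewrite ler_wpM2l.
by case: ifP => // _; apply: ler_sum => i _; rewrite ler_wpM2l.
Qed.

Lemma jumps_ge0 g c : (forall c, 0 <= g c) -> 0 <= jumps g c.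
Proof.
move=> g0; apply: addr_ge0; first by apply: sumr_ge0 => i _; rewrite mulr_ge0.
by case: ifP => // _; apply: sumr_ge0 => i _; rewrite mulr_ge0.
Qed.

Lemma jumps_le_rate g c : (forall c, g c <= 1) -> jumps g c <= rate c.
Proof. by move=> g1; rewrite -jumps1; exact: le_jumps. Qed.

Lemma continuous_jumps (u : R -> {ffun I -> nat} -> R) c :
  (forall c, continuous (u ^~ c)) -> continuous (fun t => jumps (u t) c).
Proof.
move=> cu t; apply: cvgD.
  by apply: cvg_rsum => i; apply: cvgMr; exact: cu.
case: ifP => _; last exact: cvg_cst.
by apply: cvg_rsum => i; apply: cvgMr; exact: cu.
Qed.

Definition damped_jumps (u : R -> {ffun I -> nat} -> R) c (v : R) : R :=
  expR (rate c * v) * jumps (u v) c.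

(** The mild form of the backward equation: the chain started at c holds there up to
its first jump, which happens at rate [rate c]. *)
Definition picard_step (u : R -> {ffun I -> nat} -> R) (t : R) c : R :=
  expR (- (rate c * Num.max t 0)) * (f c + prim (damped_jumps u c) t).

(** The rates are unbounded, so that no contraction is available.  The iteration
starts at 0 in order to be nondecreasing; it stays below 1 because f does. *)
Fixpoint picard (k : nat) : R -> {ffun I -> nat} -> R :=
  if k is k'.+1 then picard_step (picard k') else fun _ _ => 0.

Lemma continuous_damped u c : (forall c, continuous (u ^~ c)) ->
  continuous (damped_jumps u c).
Proof.
move=> cu t; apply: cvgM; last exact: continuous_jumps.
apply: continuous_comp; last exact: continuous_expR.
by apply: cvgM; [exact: cvg_cst | exact: cvg_id].
Qed.

Lemma continuous_picard_step u : (forall c, continuous (u ^~ c)) ->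
  forall c, continuous (picard_step u ^~ c).
Proof.
move=> cu c t; apply: cvgM.
  apply: continuous_comp; last exact: continuous_expR.
  apply: cvgN; apply: cvgM; first exact: cvg_cst.
  by apply: continuous_max; [exact: cvg_id|exact: cvg_cst].
by apply: cvgD; [exact: cvg_cst | apply: continuous_prim; exact: continuous_damped].
Qed.

Lemma is_derive_picard_step u c (t : R) : (forall c, continuous (u ^~ c)) -> 0 < t ->
  is_derive t 1 (picard_step u ^~ c)
    (jumps (u t) c - rate c * picard_step u t c).
Proof.
move=> cu t0.
pose F := fun t : R => expR (- (rate c * t)) * (f c + prim (damped_jumps u c) t).
have dF : is_derive t 1 F (jumps (u t) c - rate c * F t).
  have ? := is_derive_prim (continuous_damped (c := c) cu) t0.
  rewrite /F; apply: is_derive_eq.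
  rewrite /GRing.scale/= /damped_jumps.
  have : expR (- (rate c * t)) * expR (rate c * t) = 1 by rewrite -expRD addNr expR0.
  set a := expR _; set b := expR _ => ab.
  move: (jumps (u t) c) => J; 
  rewrite [J in RHS](_ : J = a * b * J); first by ring.
  by rewrite ab mul1r.
have FE : \forall x \near t, F x = picard_step u x c.
  near=> x; rewrite /picard_step /F.
  have x0 : 0 < x by near: x; exact: lt_nbhsr.
  by rewrite (max_idPl (ltW x0)).
have -> : picard_step u t c = F t by rewrite /picard_step /F (max_idPl (ltW t0)).
by apply: (near_eq_is_derive _ dF).
Unshelve. all: by end_near.
Qed.

Lemma picard_step0 u c : picard_step u 0 c = f c.
Proof. by rewrite /picard_step maxxx mulr0 oppr0 expR0 prim0 addr0 mul1r. Qed.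

Lemma picard_step_neg u c (t : R) : t <= 0 -> picard_step u t c = f c.
Proof.
by move=> t0; rewrite -(picard_step0 u c) /picard_step /prim (max_idPr t0) maxxx.
Qed.

Lemma continuous_picard k c : continuous (picard k ^~ c).
Proof.
elim: k c => [|k ih] c; first by move=> t; exact: cvg_cst.
exact: continuous_picard_step.
Qed.

Arguments continuous_picard : clear implicits.

Lemma picard_neg k c (t : R) : t <= 0 -> picard k t c = picard k 0 c.
Proof. by case: k => [//|k] t0; rewrite /= picard_step_neg// picard_step0. Qed.

Lemma picard_max k c (t : R) : picard k t c = picard k (Num.max t 0) c.
Proof. by have [t0|//] := leP t 0; rewrite picard_neg. Qed.

Lemma picard_step_mono u u' : (forall c, continuous (u ^~ c)) ->
  (forall c, continuous (u' ^~ c)) -> (forall t c, u t c <= u' t c) ->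
  forall t c, picard_step u t c <= picard_step u' t c.
Proof.
move=> cu cu' uu' t c; rewrite ler_wpM2l ?expR_ge0// lerD2l.
apply: prim_le; [exact: continuous_damped|exact: continuous_damped|].
by move=> v _; rewrite ler_wpM2l ?expR_ge0//; exact: le_jumps.
Qed.

Lemma picard_ge0 k t c : 0 <= picard k t c.
Proof.
elim: k t c => [//|k ih] t c.
rewrite /= mulr_ge0 ?expR_ge0// addr_ge0//; first by case/andP: (f01 c).
apply: prim_ge0; first by apply: continuous_damped; exact: continuous_picard.
by move=> v _; rewrite mulr_ge0 ?expR_ge0// jumps_ge0.
Qed.

Lemma picard_le_S k t c : picard k t c <= picard k.+1 t c.
Proof.
elim: k t c => [|k ih] t c; first exact: (picard_ge0 1).
apply: (@picard_step_mono (picard k) (picard k.+1)) => //.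
  exact: continuous_picard.
exact: (continuous_picard k.+1).
Qed.

Lemma picard_le1 k t c : picard k t c <= 1.
Proof.
elim: k t c => [//|k ih] t c.
rewrite picard_max; set t' := Num.max t 0.
have t'0 : 0 <= t' by rewrite /t' le_max lexx orbT.
rewrite /= /picard_step (max_idPl t'0).
have h : prim (damped_jumps (picard k) c) t' <= expR (rate c * t') - 1.
  rewrite -prim_exp//; apply: prim_le.
  - by apply: continuous_damped; exact: continuous_picard.
  - by move=> v; apply: cvgM; [exact: cvg_cst | exact: continuous_expM].
  - by move=> v _; rewrite /damped_jumps mulrC ler_wpM2r ?expR_ge0// jumps_le_rate.
have /andP[_ f1] := f01 c.
have -> : 1 = expR (- (rate c * t')) * expR (rate c * t') :> R.
  by rewrite -expRD addNr expR0.
by rewrite ler_wpM2l ?expR_ge0//; lra.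
Qed.

(** A Lipschitz constant independent of the iteration, which makes the limit
continuous in time. *)
Lemma picard_lipschitz k c (s t : R) : s <= t ->
  `|picard k.+1 t c - picard k.+1 s c| <= rate c * (t - s).
Proof.
move=> st; rewrite (picard_max _ _ t) (picard_max _ _ s).
set t' := Num.max t 0; set s' := Num.max s 0.
have s'0 : 0 <= s' by rewrite /s' le_max lexx orbT.
have st' : s' <= t' by rewrite /s' /t' ge_max !le_max st lexx !orbT.
apply: (@le_trans _ _ (rate c * (t' - s'))); last first.
  rewrite ler_wpM2l ?(ltW (rate_gt0 c))//.
  rewrite /t' /s'; have [|] := leP t 0; have [|] := leP s 0; lra.
have cP := continuous_picard k.+1 c.
have dP (v : R) : s' < v -> is_derive v 1 (picard k.+1 ^~ c)
    (jumps (picard k v) c - rate c * picard k.+1 v c).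
  move=> sv; apply: is_derive_picard_step; first exact: continuous_picard.
  exact: le_lt_trans sv.
have cL : continuous (fun v : R => rate c * v).
  by move=> v; apply: cvgM; [exact: cvg_cst | exact: cvg_id].
have b1 v : 0 <= jumps (picard k v) c <= rate c.
  rewrite jumps_ge0 ?jumps_le_rate//; first by move=> ?; exact: picard_le1.
  by move=> ?; exact: picard_ge0.
have b2 v : 0 <= rate c * picard k.+1 v c <= rate c.
  have r0 := rate_gt0 c; apply/andP; split.
    by apply: mulr_ge0; [exact: ltW | exact: picard_ge0].
  by apply: ler_piMr; [exact: ltW | exact: picard_le1].
rewrite ler_norml; apply/andP; split.
- have : rate c * s' + picard k.+1 s' c <= rate c * t' + picard k.+1 t' c.
    apply: (@le_of_derive_ge0 _ (fun v => rate c * v + picard k.+1 v c)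
      (fun v => rate c + (jumps (picard k v) c - rate c * picard k.+1 v c)) s' t' st').
    + by move=> v; apply: cvgD; [exact: cL | exact: cP].
    + move=> v sv; have ? := dP _ sv; apply: is_derive_eq.
      by rewrite /GRing.scale/=; ring.
    + by move=> v _ _; have := b1 v; have := b2 v; lra.
  lra.
- have : rate c * s' - picard k.+1 s' c <= rate c * t' - picard k.+1 t' c.
    apply: (@le_of_derive_ge0 _ (fun v => rate c * v - picard k.+1 v c)
      (fun v => rate c - (jumps (picard k v) c - rate c * picard k.+1 v c)) s' t' st').
    + by move=> v; apply: cvgB; [exact: cL | exact: cP].
    + move=> v sv; have ? := dP _ sv; apply: is_derive_eq.
      by rewrite /GRing.scale/=; ring.
    + by move=> v _ _; have := b1 v; have := b2 v; lra.
  lra.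
Qed.

Definition semigroup (t : R) c : R := limn (fun k => picard k t c).

Lemma picard_cvg t c : picard k t c @[k --> \oo] --> semigroup t c.
Proof.
apply: nondecreasing_is_cvgn.
  by apply/nondecreasing_seqP => k; exact: picard_le_S.
by exists 1 => _ [k _ <-]; exact: picard_le1.
Qed.

Arguments picard_cvg : clear implicits.

Lemma semigroup01 t c : 0 <= semigroup t c <= 1.
Proof.
apply/andP; split.
  apply: limr_ge; first by apply/cvg_ex; exists (semigroup t c); exact: picard_cvg.
  by apply: nearW => k; exact: picard_ge0.
apply: limr_le; first by apply/cvg_ex; exists (semigroup t c); exact: picard_cvg.
by apply: nearW => k; exact: picard_le1.
Qed.

Lemma continuous_semigroup c : continuous (semigroup ^~ c).
Proof.
have lip (s t : R) : s <= t ->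
    `|semigroup t c - semigroup s c| <= rate c * (t - s).
  move=> st.
  have : `|picard k.+1 t c - picard k.+1 s c| @[k --> \oo] -->
      `|semigroup t c - semigroup s c|.
    apply: cvg_norm; apply: cvgB.
      by have := picard_cvg t c; rewrite -(cvg_shiftn 1); under eq_fun do rewrite addn1.
    by have := picard_cvg s c; rewrite -(cvg_shiftn 1); under eq_fun do rewrite addn1.
  move=> h; rewrite -(cvg_lim _ h)//; apply: limr_le; first by apply/cvg_ex; eexists; exact: h.
  by apply: nearW => k; exact: picard_lipschitz.
move=> t; apply/cvgrPdist_le => e e0.
have r0 := rate_gt0 c.
near=> s.
have : `|t - s| <= e / rate c by near: s; apply: cvgr_dist_le; [exact: cvg_id|exact: divr_gt0].
rewrite ler_pdivlMr//; move=> h; apply: le_trans h; rewrite mulrC.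
have [st|ts] := leP s t.
  by rewrite (ger0_norm (_ : 0 <= t - s)) ?subr_ge0// lip.
rewrite distrC (distrC t) (ger0_norm (_ : 0 <= s - t)) ?subr_ge0 ?(ltW ts)//.
exact/lip/ltW.
Unshelve. all: by end_near.
Qed.

Arguments continuous_semigroup : clear implicits.

Lemma semigroupE (t : R) c : semigroup t c = picard_step semigroup t c.
Proof.
have h1 : picard k.+1 t c @[k --> \oo] --> semigroup t c.
  by have := picard_cvg t c; rewrite -(cvg_shiftn 1); under eq_fun do rewrite addn1.
suff h2 : picard k.+1 t c @[k --> \oo] --> picard_step semigroup t c.
  by rewrite -(cvg_lim _ h1)// -(cvg_lim _ h2).
have -> : (fun k => picard k.+1 t c) = (fun k => expR (- (rate c * Num.max t 0)) *
  (f c + prim (damped_jumps (picard k) c) t)) by [].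
apply: cvgMr; apply: cvgD; first exact: cvg_cst.
have [t0|t0] := leP t 0.
  have e h : prim h t = 0 by rewrite /prim (max_idPr t0) subrr.
  by rewrite e; under eq_fun do rewrite e; exact: cvg_cst.
have cd k : continuous (damped_jumps (picard k) c).
  by apply: continuous_damped; exact: continuous_picard.
have cds : continuous (damped_jumps semigroup c).
  by apply: continuous_damped; exact: continuous_semigroup.
suff : (prim (damped_jumps (picard k) c) t)%:E @[k --> \oo] -->
  (prim (damped_jumps semigroup c) t)%:E by move=> /fine_cvg.
have t0' := ltW t0.
rewrite -prim_integral//; under eq_fun do rewrite -prim_integral//.
have mD : measurable (`[0%R, t] : set R) by exact: measurable_itv.
apply: (@cvg_integral_dominated _ _ _ mu `[0%R, t]%classic _ _
  (fun=> expR (rate c * t) * rate c)) => //.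
- by move=> k; apply: measurable_funTS; exact: continuous_measurable_fun.
- by apply: measurable_funTS; exact: continuous_measurable_fun.
- move=> v _; apply: cvgMr; apply: cvgD.
    by apply: cvg_rsum => i; apply: cvgMr; exact: picard_cvg.
  case: (m < tot c)%N; last exact: cvg_cst.
  by apply: cvg_rsum => i; apply: cvgMr; exact: picard_cvg.
- by apply: continuous_itv_integrable => v; exact: cvg_cst.
- move=> k v; rewrite /= in_itv/= => /andP[v0 vt].
  rewrite /damped_jumps.
  have j0 : 0 <= jumps (picard k v) c by apply: jumps_ge0 => ?; exact: picard_ge0.
  rewrite ger0_norm ?mulr_ge0 ?expR_ge0//.
  apply: ler_pM; rewrite ?expR_ge0//.
    by rewrite ler_expR ler_wpM2l// ltW// rate_gt0.
  by apply: jumps_le_rate => ?; exact: picard_le1.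
Qed.

Lemma semigroup0 c : semigroup 0 c = f c.
Proof. by rewrite semigroupE picard_step0. Qed.

Lemma semigroup_evolves : evolves l m (fun=> 0) semigroup.
Proof.
split; first exact: continuous_semigroup.
move=> c t t0; rewrite add0r.
have -> : (semigroup ^~ c) = (picard_step semigroup ^~ c).
  by apply/funext => v; exact: semigroupE.
rewrite semigroupE; apply: is_derive_picard_step => //.
exact: continuous_semigroup.
Qed.

(** The expected time integral of f along the chain up to time t. *)
Definition occupation (t : R) c : R := prim (semigroup ^~ c) t.

(** The time integral of the backward equation.  The function D has derivative 0. *)
Lemma semigroup_integrated (t : R) c : 0 <= t ->
  semigroup t c = f c + jumps (occupation t) c - rate c * occupation t c.
Proof.
move=> t0.
have cs := continuous_semigroup; have co c' : continuous (occupation ^~ c').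
  exact: continuous_prim.
pose D v := semigroup v c - (jumps (occupation v) c - rate c * occupation v c).
have cD : continuous D.
  move=> v; apply: cvgB; first exact: cs.
  apply: cvgB; first exact: continuous_jumps.
  by apply: cvgMr; exact: co.
have dD (v : R) : 0 < v -> is_derive v 1 D 0.
  move=> v0; have ? := semigroup_evolves.2 c v v0.
  have dO c' : is_derive v 1 (occupation ^~ c') (semigroup v c').
    exact: (is_derive_prim (cs c') v0).
  have dJ : is_derive v 1 (fun v => jumps (occupation v) c) (jumps (semigroup v) c).
    rewrite /jumps; case: (m < tot c)%N; last first.
      under eq_fun do rewrite addr0; rewrite addr0.
      by apply: is_derive_rsum => i; exact: is_deriveZ.
    by apply: is_deriveD; apply: is_derive_rsum => i; exact: is_deriveZ.
  have ? := dO c.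
  rewrite /D; apply: is_derive_eq; rewrite /GRing.scale/=; ring.
have D0 : D 0 = f c.
  rewrite /D semigroup0 /occupation prim0 mulr0.
  have -> : jumps (fun c => prim (semigroup ^~ c) 0) c = 0.
    rewrite /jumps big1 => [|i _]; last by rewrite prim0 mulr0.
    by case: ifP => // _; rewrite ?big1 ?addr0// => i _; rewrite prim0 mulr0.
  by rewrite !subr0.
have h1 : D 0 <= D t by apply: (@le_of_derive_ge0 _ D (fun=> 0) 0 t).
have h2 : - D 0 <= - D t.
  apply: (@le_of_derive_ge0 _ (fun v => - D v) (fun=> 0) 0 t) => //.
  - by move=> v; apply: cvgN; exact: cD.
  - by move=> v v0; have ? := dD _ v0; apply: is_derive_eq; rewrite oppr0.
have : D t = f c by apply/eqP; rewrite -D0 eq_le h1 andbT -lerN2.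
rewrite /D; lra.
Qed.

Lemma occupation_evolves : evolves l m f occupation.
Proof.
split=> [c|c t t0].
  by apply: continuous_prim; exact: continuous_semigroup.
rewrite -semigroup_integrated ?ltW//.
exact: (is_derive_prim (continuous_semigroup c)).
Qed.

Lemma occupation01 (t : R) c : 0 <= t -> 0 <= occupation t c <= t.
Proof.
move=> t0; apply/andP; split.
  by apply: prim_ge0 => [|v _]; [exact: continuous_semigroup|case/andP: (semigroup01 v c)].
rewrite -[leRHS]subr0.
suff : prim (semigroup ^~ c) 0 - 0 <= t - prim (semigroup ^~ c) t.
  by rewrite prim0 /occupation; lra.
apply: le_trans (_ : _ <= 0 - prim (semigroup ^~ c) 0) _; first by rewrite prim0 !subr0.
apply: (@le_of_derive_ge0 _ (fun v => v - prim (semigroup ^~ c) v)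
  (fun v => 1 - semigroup v c) 0 t) => //.
- move=> v; apply: cvgB; first exact: cvg_id.
  by apply: continuous_prim; exact: continuous_semigroup.
- move=> v v0; have ? := is_derive_prim (continuous_semigroup c) v0.
  exact: is_deriveB.
- by move=> v _ _; rewrite subr_ge0; case/andP: (semigroup01 v c).
Qed.

End picard.

(** * Reversibility and convergence to the stationary mean *)

(** Integration along the fibers of a random variable with values in a countable
type. *)
Section counting.
Context {d} {Om : measurableType d} {R : realType} {X : countType}.
Variables (P : {measure set Om -> \bar R}) (N : Om -> X).
Hypothesis mN : forall c, measurable (N @^-1` [set c]).

Let fib (n : nat) : set Om := if pickle_inv n is Some c then N @^-1` [set c] else set0.

Let fibP n w : fib n w <-> pickle (N w) = n.
Proof.
rewrite /fib; split.
  have := @pickle_invK X n.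
  by case: (pickle_inv n) => [c /= <- ->|//].
by move=> <-; rewrite pickleK_inv.
Qed.

Let measurable_fib n : measurable (fib n).
Proof. by rewrite /fib; case: (pickle_inv n). Qed.

Lemma measurable_preimage_count (S : set X) : measurable (N @^-1` S).
Proof.
have -> : N @^-1` S = \bigcup_n (if pickle_inv n is Some c then
    if `[<S c>] then N @^-1` [set c] else set0 else set0).
  apply/seteqP; split=> [w Sw|w [n _]].
    by exists (pickle (N w)) => //; rewrite pickleK_inv asboolT.
  by case: (pickle_inv n) => // c; case: asboolP => // Sc /= ->.
apply: bigcupT_measurable => n.
by case: (pickle_inv n) => // c; case: asboolP.
Qed.

Lemma measurable_count {d'} {T' : measurableType d'} (g : X -> T') :
  measurable_fun setT (g \o N).
Proof.
by move=> _ Y mY; rewrite setTI comp_preimage; exact: measurable_preimage_count.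
Qed.

Lemma ge0_integral_count_esum (h : Om -> \bar R) :
  measurable_fun setT h -> (forall w, 0 <= h w)%E ->
  (\int[P]_w h w = \esum_(c in [set: X]) \int[P]_(w in N @^-1` [set c]) h w)%E.
Proof.
move=> mh h0.
have fibT : \bigcup_n fib n = setT.
  by apply/seteqP; split=> // w _; exists (pickle (N w)) => //; exact/fibP.
rewrite -fibT (@ge0_integral_bigcup _ _ _ P fib)//; last 2 first.
- by rewrite fibT.
- by apply/trivIsetP => i j _ _ ij; rewrite -subset0 => w [/fibP iw /fibP jw];
    move: ij; rewrite -iw -jw eqxx.
rewrite nneseries_esumT; last by move=> n; exact: integral_ge0.
pose a n := (\int[P]_(w in fib n) h w)%E.
have a0 n : (0 <= a n)%E by exact: integral_ge0.
rewrite (esumID (range (@pickle X))); last by move=> n _; exact: a0.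
rewrite [X in (_ + X)%E]esum1 ?adde0; last first.
  move=> n [_ nP]; rewrite /a /fib; case E : (pickle_inv n) => [c|].
    by exfalso; apply: nP; exists c => //; have := @pickle_invK X n; rewrite E.
  by rewrite integral_set0.
rewrite setTI (@esum_image _ _ _ setT (@pickle X)); last first.
  by move=> x y _ _ /(pcan_inj pickleK).
by apply: eq_esum => c _; rewrite /a /fib pickleK_inv.
Qed.

Lemma ge0_integral_count_eq (h1 h2 : Om -> \bar R) :
  measurable_fun setT h1 -> (forall w, 0 <= h1 w)%E ->
  measurable_fun setT h2 -> (forall w, 0 <= h2 w)%E ->
  (forall c, \int[P]_(w in N @^-1` [set c]) h1 w =
             \int[P]_(w in N @^-1` [set c]) h2 w)%E ->
  (\int[P]_w h1 w = \int[P]_w h2 w)%E.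
Proof.
by move=> *; rewrite !ge0_integral_count_esum//; apply: eq_esum.
Qed.

Lemma ge0_integral_count_fun (g : X -> R) : (forall c, 0 <= g c) ->
  (\int[P]_w (g (N w))%:E =
   \esum_(c in [set: X]) ((g c)%:E * P (N @^-1` [set c])))%E.
Proof.
move=> g0; rewrite ge0_integral_count_esum//; last 2 first.
- exact: (measurable_count (EFin \o g)).
- by move=> w; rewrite lee_fin.
apply: eq_esum => c _; rewrite -integral_cst//; apply: eq_integral => w.
by rewrite inE /= => ->.
Qed.

End counting.

(** The hypothesis [reversible] is the balance equation satisfied by independent
Poisson counts of intensities l. *)
Section stationarity.
Context {R : realType} {I : finType}.
Variables (l : I -> R) (m : nat).
Hypothesis l_ge0 : forall i, 0 <= l i.
Hypothesis total_gt0 : 0 < total l.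
Context {d} {Om : measurableType d}.
Variables (P : probability Om R) (N : Om -> {ffun I -> nat}).
Hypothesis mN : forall c, measurable (N @^-1` [set c]).
Hypothesis reversible : forall c i,
  ((l i)%:E * P (N @^-1` [set c]) =
   (c i).+1%:R%:E * P (N @^-1` [set (up c i)]))%E.
Implicit Types (g h : {ffun I -> nat} -> R).

Definition mean (g : {ffun I -> nat} -> R) : \bar R := (\int[P]_w (g (N w))%:E)%E.
(** The conditioning on at least m points is carried by this factor and by a final
division by the probability [prob_above]. *)
Definition above (c : {ffun I -> nat}) : R := (m <= tot c)%N%:R.
Definition strictly_above (c : {ffun I -> nat}) : R := (m < tot c)%N%:R.
Local Notation E := mean.

Let above0 c : 0 <= above c. Proof. by rewrite /above. Qed.
Let strictly_above0 c : 0 <= strictly_above c. Proof. by rewrite /strictly_above. Qed.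

(** The balance equation summed over the states; the states with no point in cell i
do not contribute to the right-hand side. *)
Lemma mecke i (g : {ffun I -> nat} -> R) : (forall c, 0 <= g c) ->
  (E (fun c => (above c * (l i * g (up c i)))%R) =
   E (fun c => (strictly_above c * ((c i)%:R * g c))%R))%E.
Proof.
move=> g0; rewrite /mean.
rewrite (@ge0_integral_count_fun _ _ _ _ _ _ mN
  (fun c => above c * (l i * g (up c i)))); last first.
  by move=> c; rewrite !mulr_ge0.
rewrite (@ge0_integral_count_fun _ _ _ _ _ _ mN
  (fun c => strictly_above c * ((c i)%:R * g c))); last first.
  by move=> c; rewrite !mulr_ge0.
pose F c := ((strictly_above c * ((c i)%:R * g c))%:E * P (N @^-1` [set c]))%E.
have F0 c : (0 <= F c)%E by rewrite /F mule_ge0// lee_fin !mulr_ge0.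
rewrite [RHS](esumID (range (up ^~ i))); last by move=> c _; exact: F0.
rewrite [X in (_ + X)%E]esum1 ?adde0; last first.
  move=> c [_ cP]; rewrite /F; have [c0|ci] := posnP (c i).
    by rewrite c0 mul0r mulr0 mul0e.
  by exfalso; apply: cP; exists (dn c i) => //; exact: dnK.
rewrite setTI (@esum_image _ _ _ setT (up ^~ i)); last first.
  by move=> x y _ _ /(@up_inj I i).
apply: eq_esum => c _; rewrite /F /strictly_above /above tot_up ltnS.
have -> : (up c i) i = (c i).+1 by rewrite ffunE eqxx addn1.
rewrite !EFinM -!muleA; congr (_ * _)%E.
by rewrite [LHS]muleCA reversible muleCA muleA (muleC (g _)%:E) -muleA.
Qed.

Let mE (g : {ffun I -> nat} -> R) : measurable_fun setT (fun w => (g (N w))%:E).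
Proof. exact: (measurable_count mN (EFin \o g)). Qed.

Let E_add (g h : {ffun I -> nat} -> R) : (forall c, 0 <= g c) -> (forall c, 0 <= h c) ->
  (E (fun c => (g c + h c)%R) = E g + E h)%E.
Proof.
move=> g0 h0; rewrite /mean; under eq_integral do rewrite EFinD.
by rewrite ge0_integralD// => w _; rewrite lee_fin.
Qed.

Let E_sum (g : I -> {ffun I -> nat} -> R) : (forall i c, 0 <= g i c) ->
  (E (fun c => (\sum_i g i c)%R) = \sum_i E (g i))%E.
Proof.
move=> g0; rewrite /mean; under eq_integral do rewrite -sumEFin.
by rewrite ge0_integral_sum// => i w _; rewrite lee_fin.
Qed.

Let E_le (g h : {ffun I -> nat} -> R) : (forall c, 0 <= g c <= h c) -> (E g <= E h)%E.
Proof.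
move=> gh; apply: ge0_le_integral => //.
- by move=> w _; rewrite lee_fin; case/andP: (gh (N w)).
- by move=> w _; rewrite lee_fin; case/andP: (gh (N w)).
Qed.

Let E_eq (g h : {ffun I -> nat} -> R) : g =1 h -> (E g = E h)%E.
Proof. by move=> gh; apply: eq_integral => w _; rewrite gh. Qed.

Let E_ge0 (g : {ffun I -> nat} -> R) : (forall c, 0 <= g c) -> (0 <= E g)%E.
Proof. by move=> g0; apply: integral_ge0 => w _; rewrite lee_fin. Qed.

Let E_scale (a : R) (g : {ffun I -> nat} -> R) : 0 <= a -> (forall c, 0 <= g c) ->
  (E (fun c => (a * g c)%R) = a%:E * E g)%E.
Proof.
move=> a0 g0; rewrite /mean; under eq_integral do rewrite EFinM.
by rewrite ge0_integralZl// => w _; rewrite lee_fin.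
Qed.

Definition prob_above : R := fine (E above).

Lemma E_above : (E above = prob_above%:E)%E.
Proof.
rewrite /prob_above fineK// ge0_fin_numE; last exact: E_ge0.
apply: (@le_lt_trans _ _ (E (fun=> 1%R))).
  by apply: E_le => c; rewrite /above ler0n lern1 leq_b1.
rewrite /mean integral_cst// mul1e.
exact: le_lt_trans (probability_le1 P measurableT) (ltry _).
Qed.

Let E_strict_g (g : {ffun I -> nat} -> R) : (forall c, 0 <= g c) ->
  (E (fun c => (strictly_above c * ((tot c)%:R * g c))%R) =
   E (fun c => (above c * \sum_i l i * g (up c i))%R))%E.
Proof.
move=> g0.
rewrite (E_eq (h := fun c => \sum_i strictly_above c * ((c i)%:R * g c))); last first.
  by move=> c; rewrite -mulr_sumr -mulr_suml sum_tot.
rewrite E_sum; last by move=> i c; rewrite !mulr_ge0.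
rewrite [RHS](E_eq (h := fun c => \sum_i above c * (l i * g (up c i)))); last first.
  by move=> c; rewrite -mulr_sumr.
rewrite E_sum; last by move=> i c; rewrite !mulr_ge0.
by apply: eq_bigr => i _; rewrite -mecke.
Qed.

Lemma E_strict_tot :
  (E (fun c => (strictly_above c * (tot c)%:R)%R) = (total l * prob_above)%:E)%E.
Proof.
rewrite (E_eq (h := fun c => strictly_above c * ((tot c)%:R * 1))); last first.
  by move=> c; rewrite mulr1.
rewrite E_strict_g//.
rewrite (E_eq (h := fun c => total l * above c)); last first.
  by move=> c; rewrite mulrC; congr (_ * _); apply: eq_bigr => i _; rewrite mulr1.
by rewrite E_scale ?ltW// E_above.
Qed.

(** Reversibility: births and deaths exchange their contributions.  The factor
[above] is compatible with it since deaths are blocked at level m. *)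
Lemma E_jumps (g : {ffun I -> nat} -> R) : (forall c, 0 <= g c) ->
  (E (fun c => (above c * jumps l m g c)%R) = E (fun c => (above c * (rate l m c * g c))%R))%E.
Proof.
move=> g0.
have strictE (c : {ffun I -> nat}) (x : R) : above c * (if (m < tot c)%N then x else 0) = strictly_above c * x.
  rewrite /above /strictly_above; have [mc|mc] := ltnP m (tot c); last by rewrite mulr0 mul0r.
  by rewrite (ltnW mc) !mul1r.
rewrite (E_eq (h := fun c => above c * (\sum_i l i * g (up c i)) +
  \sum_i strictly_above c * ((c i)%:R * g (dn c i)))); last first.
  by move=> c; rewrite /jumps mulrDr strictE; congr (_ + _); rewrite mulr_sumr.
rewrite E_add; last 2 first.
- by move=> c; rewrite mulr_ge0// sumr_ge0// => i _; rewrite mulr_ge0.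
- by move=> c; rewrite sumr_ge0// => i _; rewrite !mulr_ge0.
rewrite [RHS](E_eq (h := fun c => strictly_above c * ((tot c)%:R * g c) +
  \sum_i above c * (l i * g c))); last first.
  move=> c; rewrite /above /strictly_above /rate /death mulrDl mulrDr; congr (_ + _).
    have [mc|mc] := ltnP m (tot c); last by rewrite mul0r mulr0 mul0r.
    by rewrite (ltnW mc).
  by rewrite -mulr_sumr -mulr_suml.
rewrite [RHS]E_add; last 2 first.
- by move=> c; rewrite !mulr_ge0.
- by move=> c; rewrite sumr_ge0// => i _; rewrite !mulr_ge0.
rewrite E_strict_g//; congr (_ + _)%E.
rewrite !E_sum; last 2 first.
- by move=> i c; rewrite !mulr_ge0.
- by move=> i c; rewrite !mulr_ge0.
apply: eq_bigr => i _; rewrite -(mecke i (g := fun c => g (dn c i)))//.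
by apply: E_eq => c; rewrite upK.
Qed.

Variable f : {ffun I -> nat} -> R.
Hypothesis f01 : forall c, 0 <= f c <= 1.
Local Notation G := (semigroup l m f).

Let G0 t c : 0 <= G t c.
Proof. by have /andP[] := @semigroup01 _ _ l m l_ge0 f f01 t c. Qed.

(** Stationarity.  Average the integrated backward equation: the contributions of
jumps O and of rate * O cancel by [E_jumps].  They are finite as O is bounded by t
and the mean number of points is finite. *)
Lemma E_semigroup (t : R) : 0 <= t ->
  (E (fun c => (above c * G t c)%R) = E (fun c => (above c * f c)%R))%E.
Proof.
move=> t0; pose O c := occupation l m f t c.
have O01 c : 0 <= O c <= t by exact: occupation01.
have O0 c : 0 <= O c by case/andP: (O01 c).
have f0 c : 0 <= f c by case/andP: (f01 c).
have r0 c : 0 <= rate l m c by exact/ltW/rate_gt0.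
have j0 c : 0 <= jumps l m O c by exact: jumps_ge0.
have h : (E (fun c => (above c * G t c)%R) + E (fun c => (above c * (rate l m c * O c))%R) =
  E (fun c => (above c * f c)%R) + E (fun c => (above c * jumps l m O c)%R))%E.
  rewrite -!E_add; try (by move=> c; rewrite mulr_ge0);
    try (by move=> c; rewrite mulr_ge0// mulr_ge0).
  by apply: E_eq => c; rewrite semigroup_integrated// -/(O _) -!mulrDr subrK.
move: h; rewrite E_jumps//.
have fin : (E (fun c => (above c * (rate l m c * O c))%R) \is a fin_num)%E.
  rewrite ge0_fin_numE; last by apply: E_ge0 => c; rewrite !mulr_ge0.
  apply: (@le_lt_trans _ _ (E (fun c =>
      (t * (strictly_above c * (tot c)%:R) + t * (total l * above c))%R))).
    apply: E_le => c; rewrite !mulr_ge0//=.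
    rewrite -mulrDr mulrC -mulrA (mulrC t) mulrA.
    have -> : strictly_above c * (tot c)%:R + total l * above c = rate l m c * above c.
      rewrite /above /strictly_above /rate /death mulrDl; congr (_ + _).
      have [mc|mc] := ltnP m (tot c); last by rewrite !mul0r.
      by rewrite (ltnW mc) mul1r mulr1.
    rewrite -mulrA (mulrC (O c)) mulrA ler_wpM2l ?mulr_ge0//.
    by case/andP: (O01 c).
  rewrite E_add; last 2 first.
  - by move=> c; rewrite !mulr_ge0.
  - by move=> c; rewrite !mulr_ge0// ltW.
  rewrite !E_scale//; last 3 first.
  - by rewrite ltW.
  - by move=> c; rewrite mulr_ge0// ltW.
  - by move=> c; rewrite mulr_ge0.
  by rewrite E_strict_tot E_above -!EFinM -EFinD ltry.
by move=> /(congr1 (fun x => x - E (fun c => (above c * (rate l m c * O c))%R))%E);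
  rewrite !addeK.
Qed.

Lemma E_above_f01 : (0 <= E (fun c => (above c * f c)%R) <= prob_above%:E)%E.
Proof.
have f0 c : 0 <= f c by case/andP: (f01 c).
rewrite E_ge0 => [|c]; last by rewrite mulr_ge0.
rewrite -E_above; apply: E_le => c; rewrite mulr_ge0//=.
by rewrite ler_piMr//; case/andP: (f01 c).
Qed.

(** By stationarity the mean of f is that of G t, whose distance to G t c is averaged
by means of the hypothesis; the mean number of points above m is at most m plus
total, in the normalization by [prob_above]. *)
Lemma semigroup_near_mean (t D : R) c : 0 <= t -> 0 <= D ->
  (forall c', (m <= tot c')%N -> `|G t c - G t c'| <= ((tot c)%:R + (tot c')%:R) * D) ->
  `|G t c * prob_above - fine (E (fun c => (above c * f c)%R))| <=
    ((tot c)%:R + m%:R + total l) * D * prob_above.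
Proof.
move=> t0 D0 GD.
have fin : (E (fun c => (above c * f c)%R) \is a fin_num)%E.
  have /andP[h1 h2] := E_above_f01.
  by rewrite ge0_fin_numE// (le_lt_trans h2)// ltry.
(* on the event tot c' = m the factor strictly_above vanishes: tot c' is replaced by m *)
pose Q (c' : {ffun I -> nat}) := above c' * (((tot c)%:R + m%:R) * D) + D * (strictly_above c' * (tot c')%:R).
have Q0 c' : 0 <= Q c' by rewrite addr_ge0 ?mulr_ge0// addr_ge0.
have EQ : (E Q = (((tot c)%:R + m%:R + total l) * D * prob_above)%:E)%E.
  rewrite E_add => [|c'|c']; last 2 first.
  - by rewrite !mulr_ge0// addr_ge0.
  - by rewrite !mulr_ge0.
  rewrite (E_eq (h := fun c' => (((tot c)%:R + m%:R) * D) * above c')); last first.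
    by move=> c'; rewrite mulrC.
  rewrite !E_scale//; last 2 first.
  - by move=> c'; rewrite mulr_ge0.
  - by rewrite mulr_ge0// addr_ge0.
  rewrite E_above E_strict_tot -!EFinM -EFinD; congr (_%:E); ring.
have key (c' : {ffun I -> nat}) : above c' * `|G t c - G t c'| <= Q c'.
  rewrite /Q /above /strictly_above; have [mc'|mc'] := leqP m (tot c'); last first.
    by rewrite !mul0r ltnNge (ltnW mc') mul0r mulr0 addr0.
  rewrite !mul1r (le_trans (GD _ mc'))// mulrDl mulrDl -addrA lerD2l.
  have [mc|mc] := ltnP m (tot c').
    by rewrite mul1r (mulrC D) lerDr mulr_ge0.
  by rewrite mul0r mulr0 addr0 ler_wpM2r// ler_nat.
rewrite ler_norml.
have EG : (E (fun c' => (above c' * G t c)%R) = (G t c * prob_above)%:E)%E.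
  rewrite (E_eq (h := fun c' => G t c * above c')); last by move=> c'; rewrite mulrC.
  by rewrite E_scale// E_above.
apply/andP; split.
- rewrite lerNl opprB lerBlDr -lee_fin EFinD fineK// -EQ -EG -(E_semigroup t0) -E_add//; last first.
    by move=> c'; rewrite mulr_ge0.
  apply: E_le => c'; rewrite mulr_ge0//=.
  have := key c'; have := ler_norm (G t c' - G t c); rewrite distrC.
  move=> /(ler_wpM2l (above0 c')); lra.
- rewrite lerBlDr -lee_fin EFinD fineK// -EQ -EG -(E_semigroup t0) -E_add//; last first.
    by move=> c'; rewrite mulr_ge0.
  apply: E_le => c'; rewrite mulr_ge0//=.
  have := key c'; have := ler_norm (G t c - G t c').
  move=> /(ler_wpM2l (above0 c')); lra.
Qed.

End stationarity.

Section chain_bounds.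
Context {R : realType} {I : finType}.
Variables (l : I -> R) (m : nat).
Hypothesis l_ge0 : forall i, 0 <= l i.
Hypothesis total_gt0 : 0 < total l.
Hypothesis m_gt0 : (0 < m)%N.
Variable f : {ffun I -> nat} -> R.
Hypothesis f01 : forall c, 0 <= f c <= 1.
Hypothesis f_up : forall c i, `|f (up c i) - f c| <= (tot c).+1%:R^-1.
Hypothesis f_swap : forall c i j, `|f (up c i) - f (up c j)| <= (tot c).+1%:R^-1.
Implicit Types (c : {ffun I -> nat}).
Local Notation G := (semigroup l m f).
Local Notation O := (occupation l m f).

Lemma occupation_contrast (phi : nat -> R) (t : R) c i : barrier (total l) m phi ->
  0 <= t -> (m <= tot c)%N -> `|O t (up c i) - O t c| <= phi (tot c).+1.
Proof.
move=> [phi0 phiL] t0 mc.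
have O0 c' : O 0 c' = 0 by exact: prim0.
suff [h _] : contrast_le m O t (fun=> phi) by apply: h => //; rewrite t0 lexx.
apply: (@max_principle R I l m l_ge0 total_gt0 O f (fun n => n%:R^-1) t t
  (fun=> phi) (fun _ _ => 0)) => //.
- exact: occupation_evolves.
- by move=> c' i' _; rewrite !O0 subrr normr0.
- by move=> c' i' j' _; rewrite !O0 subrr normr0.
- by move=> n v; exact: cvg_cst.
- by move=> n v _; exact: is_derive_cst.
- by move=> n v mn _; rewrite add0r; exact: phiL.
- move=> c1 c2 v /andP[v0 vt]; rewrite ler_norml.
  have /andP[? ?] := occupation01 m l_ge0 total_gt0 f01 c1 v0.
  have /andP[? ?] := occupation01 m l_ge0 total_gt0 f01 c2 v0; lra.
Qed.

(** The drift of [height] is at least min (total) 1 and height is at most m + 2, so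
that exp (- relaxation t) height n is a barrier without source. *)
Definition relaxation : R := Num.min (total l) 1 / m.+2%:R.

Let height (n : nat) : R := (if n == m then m.+2 else m.+1)%:R.

Let level_drift_height n : (m <= n)%N ->
  Num.min (total l) 1 <= level_drift (total l) m height n.
Proof.
rewrite leq_eqVlt => /predU1P[<-|mn].
  rewrite /level_drift /height eqxx ltnn gtn_eqF// -[m.+2%:R]natr1 addr0.
  by rewrite ge_min; apply/orP; left; lra.
rewrite ge_min; apply/orP; right.
case: n mn => // n; rewrite ltnS => mn.
have e1 : (n.+1 == m) = false by rewrite gtn_eqF.
have e2 : (n.+2 == m) = false by rewrite gtn_eqF// ltnS leqW.
rewrite /level_drift /height ltnS mn [n.+1.-1]/= e1 e2.
have m0 : 0 <= m%:R :> R by [].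
have [->|_] := eqVneq n m; rewrite subrr mulr0 add0r -?[m.+2%:R]natr1 -natr1; lra.
Qed.

Lemma semigroup_contrast (t : R) c i : 0 <= t -> (m <= tot c)%N ->
  `|G t (up c i) - G t c| <= m.+2%:R * expR (- relaxation * t).
Proof.
move=> t0 mc.
pose b (t : R) n := expR (- relaxation * t) * height n.
have h1 n : 1 <= height n by rewrite /height ler1n; case: ifP.
have hm n : height n <= m.+2%:R by rewrite /height ler_nat; case: ifP.
have G01 t' c' := semigroup01 m l_ge0 f01 t' c'.
have G0E c' : G 0 c' = f c' by exact: semigroup0.
suff [h _] : contrast_le m G t b.
  apply: le_trans (h c i t _ mc) _; first by rewrite t0 lexx.
  by rewrite /b mulrC ler_wpM2r ?expR_ge0.
apply: (@max_principle R I l m l_ge0 total_gt0 G (fun=> 0) (fun=> 0) t 1 b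
  (fun t n => - relaxation * b t n)) => //.
- exact: semigroup_evolves.
- by move=> c' i' _; rewrite subrr normr0.
- by move=> c' i' j' _; rewrite subrr normr0.
- move=> c' i' _; rewrite !G0E /b mulr0 expR0 mul1r.
  by apply: le_trans (h1 _); apply: le_trans (f_up _ _) _; rewrite invf_le1// ler1n.
- move=> c' i' j' _; rewrite !G0E /b mulr0 expR0 mul1r.
  by apply: le_trans (h1 _); apply: le_trans (f_swap _ _ _) _; rewrite invf_le1// ler1n.
- move=> n v; apply: cvgMl; exact: continuous_expM.
- move=> n v v0; rewrite /b; apply: is_derive_eq.
  by rewrite /GRing.scale/=; ring.
- move=> n v mn v0.
  have -> : level_drift (total l) m (b v) n =
      expR (- relaxation * v) * level_drift (total l) m height n.
    by rewrite /level_drift /b; case: ifP => _; ring.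
  rewrite /b mulrCA -mulrDr mulr_ge0 ?expR_ge0// mulNr addrC subr_ge0.
  apply: le_trans (level_drift_height mn).
  rewrite /relaxation mulrAC ler_pdivrMr// ler_wpM2l//.
  by rewrite le_min ltW/=.
- by move=> n v _ _; rewrite /b mulr_ge0 ?expR_ge0// (le_trans _ (h1 n)).
- move=> c1 c2 v _; rewrite ler_norml.
  have /andP[? ?] := G01 v c1; have /andP[? ?] := G01 v c2; lra.
Qed.

Let add (c c' : {ffun I -> nat}) : {ffun I -> nat} := [ffun i => (c i + c' i)%N].

Lemma semigroup_add (t : R) c c' : 0 <= t -> (m <= tot c)%N ->
  `|G t (add c c') - G t c| <= (tot c')%:R * (m.+2%:R * expR (- relaxation * t)).
Proof.
move=> t0 mc; move E : (tot c') => n; elim: n c' E => [|n ih] c' E.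
  have -> : add c c' = c.
    apply/ffunP => i; rewrite ffunE.
    have : (c' i <= tot c')%N by rewrite /tot (bigD1 i)//= leq_addr.
    by rewrite E leqn0 => /eqP ->; rewrite addn0.
  by rewrite subrr normr0 mul0r.
have [i ci] : exists i, (0 < c' i)%N.
  apply/existsP; apply: contraT; rewrite negb_exists => /forallP h.
  have : tot c' = 0%N by rewrite /tot big1// => i _; apply/eqP; rewrite -leqn0 leqNgt h.
  by rewrite E.
have E' : tot (dn c' i) = n by apply/eqP; rewrite -eqSS tot_dn// E.
have -> : add c c' = up (add c (dn c' i)) i.
  apply/ffunP => j; rewrite !ffunE -addnA; congr addn.
  by case: eqP => [->|_]; rewrite ?subn0 ?addn0// subnK.
have ma : (m <= tot (add c (dn c' i)))%N.
  apply: (leq_trans mc); rewrite /tot; apply: leq_sum => j _; rewrite ffunE leq_addr//.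
have := ler_normD (G t (up (add c (dn c' i)) i) - G t (add c (dn c' i)))
  (G t (add c (dn c' i)) - G t c).
rewrite addrA subrK => /le_trans; apply; rewrite -natr1 mulrDl addrC mul1r.
by apply: lerD; [exact: ih | exact: semigroup_contrast].
Qed.

(** Pass from c to c' through the sum of the two configurations, adding the points one
by one. *)
Lemma semigroup_close (t : R) c c' : 0 <= t -> (m <= tot c)%N -> (m <= tot c')%N ->
  `|G t c - G t c'| <= ((tot c)%:R + (tot c')%:R) * (m.+2%:R * expR (- relaxation * t)).
Proof.
move=> t0 mc mc'.
have h1 := semigroup_add c' t0 mc; have h2 := semigroup_add c t0 mc'.
have eqa : add c' c = add c c' by apply/ffunP => i; rewrite !ffunE addnC.
rewrite eqa in h2.
have := ler_normD (G t c - G t (add c c')) (G t (add c c') - G t c').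
rewrite addrA subrK => /le_trans; apply; rewrite mulrDl addrC lerD//.
by rewrite distrC.
Qed.

Context {d} {Om : measurableType d}.
Variables (P : probability Om R) (N : Om -> {ffun I -> nat}).
Hypothesis mN : forall c, measurable (N @^-1` [set c]).
Hypothesis reversible : forall c i,
  ((l i)%:E * P (N @^-1` [set c]) =
   (c i).+1%:R%:E * P (N @^-1` [set (up c i)]))%E.
Local Notation p := (prob_above m P N).
Hypothesis p_gt0 : 0 < p.

Lemma semigroup_cvg_mean (t : R) c : 0 <= t -> (m <= tot c)%N ->
  `|G t c - p^-1 * fine (mean P N (fun c => above m c * f c))| <=
    ((tot c)%:R + m%:R + total l) * (m.+2%:R * expR (- relaxation * t)).
Proof.
move=> t0 mc.
have := @semigroup_near_mean R I l m l_ge0 total_gt0 _ _ P N mN reversible f f01 t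
  (m.+2%:R * expR (- relaxation * t)) c t0 _ _.
rewrite mulr_ge0 ?expR_ge0// => /(_ isT) h.
rewrite -(ler_pM2r p_gt0); apply: le_trans (h _); last first.
  by move=> c' mc'; exact: semigroup_close.
rewrite -{2}(gtr0_norm p_gt0) -normrM mulrBl mulrAC mulVf ?gt_eqF// mul1r.
exact: lexx.
Qed.

End chain_bounds.

(** * Null sets, densities and joint laws *)

Section null_sets.
Context {d} {T : measurableType d} {R : realType} (mu : {measure set T -> \bar R}).

Lemma ge0_le_integral_nonmeasurable (f g : T -> \bar R) :
  (forall x, 0 <= f x)%E -> (forall x, f x <= g x)%E ->
  (\int[mu]_x f x <= \int[mu]_x g x)%E.
Proof.
move=> f0 fg; have g0 x : (0 <= g x)%E by exact: le_trans (fg x).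
rewrite !ge0_integralTE//; apply: ereal_sup_le => y [h hf <-].
by exists h => // x; exact: le_trans (hf x) (fg x).
Qed.

(** The integral of a nonnegative function is defined as a lower integral, also for
nonmeasurable functions, and is monotone.  Here f lies between two
measurable functions that differ from g only on the null set N. *)
Lemma ge0_integral_off_null (f : T -> R) (g : T -> R) (D N : set T) :
  (forall x, 0 <= f x <= 1) -> (forall x, 0 <= g x <= 1) ->
  measurable_fun setT g -> measurable D -> measurable N -> mu N = 0%E ->
  (forall x, ~ N x -> f x = g x) ->
  (\int[mu]_(x in D) (f x)%:E = \int[mu]_(x in D) (g x)%:E)%E.
Proof.
move=> f01 g01 mg mD mN N0 fg.
have f0 x : 0 <= f x by case/andP: (f01 x).
have g0 x : 0 <= g x by case/andP: (g01 x).
pose v x := g x * \1_(~` N) x; pose u x := v x + \1_N x.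
have mv : measurable_fun setT v.
  by apply: measurable_funM => //; apply: measurable_indic; exact: measurableC.
have mu' : measurable_fun setT u by apply: measurable_funD => //; exact: measurable_indic.
have v0 x : 0 <= v x by rewrite mulr_ge0// indicE.
have u0 x : 0 <= u x by rewrite addr_ge0// indicE.
have off (h : T -> R) : measurable_fun setT h -> (forall x, 0 <= h x) ->
    (forall x, ~ N x -> h x = g x) ->
    (\int[mu]_(x in D) (h x)%:E = \int[mu]_(x in D) (g x)%:E)%E.
  move=> mh h0 hg.
  have mE (k : T -> R) : measurable_fun setT k -> measurable_fun D (EFin \o k).
    by move=> mk; apply: measurable_funTS; exact/measurable_EFinP.
  rewrite (ge0_negligible_integral mN mD (mE _ mh)) //.
  rewrite [RHS](ge0_negligible_integral mN mD (mE _ mg)) //.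
  - by apply: eq_integral => x; rewrite inE => -[_ /hg /= ->].
  - by move=> x _; rewrite lee_fin.
  - by move=> x _; rewrite lee_fin.
have le_D (h k : T -> R) : (forall x, 0 <= h x) -> (forall x, h x <= k x) ->
    (\int[mu]_(x in D) (h x)%:E <= \int[mu]_(x in D) (k x)%:E)%E.
  move=> h0 hk; rewrite integral_mkcond [leRHS]integral_mkcond.
  apply: ge0_le_integral_nonmeasurable => x; rewrite !patchE; case: ifP => //.
  - by rewrite lee_fin.
  - by rewrite lee_fin => _; exact: hk.
have inN x : N x -> (x \in N = true) * (x \in ~` N = false).
  by move=> Nx; rewrite mem_set// memNset//; apply.
have ninN x : ~ N x -> (x \in N = false) * (x \in ~` N = true).
  by move=> Nx; rewrite memNset// mem_set.
apply/eqP; rewrite eq_le; apply/andP; split.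
  rewrite -(off u)//; last first.
    by move=> x /ninN xN; rewrite /u /v !indicE !xN addr0 mulr1.
  apply: le_D => // x; rewrite /u /v !indicE.
  have [Nx|Nx] := pselect (N x); first by rewrite !(inN x Nx) mulr0 add0r; case/andP: (f01 x).
  by rewrite !ninN// addr0 mulr1 fg.
rewrite -(off v)//; last first.
  by move=> x /ninN xN; rewrite /v !indicE !xN mulr1.
apply: le_D => // x; rewrite /v !indicE.
have [Nx|Nx] := pselect (N x); first by rewrite !(inN x Nx) mulr0.
by rewrite !ninN// mulr1 fg.
Qed.
End null_sets.

Section almost_sure.
Context {d} {Om : measurableType d} {R : realType} (P : probability Om R).
Implicit Types E F : set Om.

Lemma null_setC F : measurable F -> P F = 1%E -> P (~` F) = 0%E.
Proof. by move=> mF F1; rewrite probability_setC// F1 subee. Qed.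

Lemma setI_almost_sure E F : measurable E -> measurable F -> P F = 1%E ->
  P (E `&` F) = P E.
Proof.
move=> mE mF F1; rewrite [RHS](measureDI P mE mF).
rewrite [X in (X + _)%E](_ : _ = 0%E) ?add0e//.
apply: (@subset_measure0 _ _ _ _ _ (~` F)); [exact: measurableD|exact: measurableC| |exact: null_setC].
by move=> w [].
Qed.

Lemma almost_sure_bigcap (F : nat -> set Om) E : (forall n, measurable (F n)) ->
  (forall n, P (F n) = 1%E) -> measurable E -> \bigcap_n F n `<=` E -> P E = 1%E.
Proof.
move=> mF F1 mE FE.
have null : P (~` E) = 0%E.
  apply/negligibleP; first exact: measurableC.
  apply: (@negligibleS _ _ _ _ (\bigcup_n ~` F n)).
    by rewrite -setC_bigcap; exact: subsetC.
  apply: negligible_bigcup => n; apply/negligibleP; first exact: measurableC.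
  exact: null_setC.
by rewrite -[E]setCK probability_setC ?null ?sube0//; exact: measurableC.
Qed.

End almost_sure.

Section density.
Context {d} {T : measurableType d} {R : realType}.
Variables (mu : {sigma_finite_measure set T -> \bar R}) (nu : {finite_measure set T -> \bar R}).
Variable g : T -> R.
Hypothesis g0 : forall x, 0 <= g x.
Hypothesis mg : measurable_fun setT g.
Hypothesis nuE : forall A, measurable A -> nu A = (\int[mu]_(x in A) (g x)%:E)%E.
Local Open Scope ereal_scope.

(** By the uniqueness of densities, g is the Radon-Nikodym derivative of nu. *)
Lemma ge0_integral_density (f : T -> \bar R) : measurable_fun setT f ->
  (forall x, 0 <= f x) -> \int[nu]_x f x = \int[mu]_x (f x * (g x)%:E).
Proof.
move=> mf f0; have mEg : measurable_fun setT (EFin \o g) by exact/measurable_EFinP.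
have dom : nu `<< mu.
  apply/null_content_dominatesP => A mA A0; rewrite nuE//.
  by apply: null_set_integral => //; exact: measurable_funTS.
have ig : mu.-integrable setT (EFin \o g).
  apply/integrableP; split=> //=.
  under eq_integral do rewrite ger0_norm//.
  by rewrite -nuE// -ge0_fin_numE// fin_num_measure.
have mr := measurable_int _ (Radon_Nikodym_SigmaFinite.f_integrable dom).
have ae : ae_eq mu setT (Radon_Nikodym_SigmaFinite.f nu mu) (EFin \o g).
  apply: integral_ae_eq => //; first exact: Radon_Nikodym_SigmaFinite.f_integrable.
  by move=> A _ mA; rewrite -Radon_Nikodym_SigmaFinite.f_integral// nuE.
rewrite -(Radon_Nikodym_SigmaFinite.change_of_variables dom)//.
apply: ge0_ae_eq_integral => //.
- exact: emeasurable_funM.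
- exact: emeasurable_funM.
- by move=> x _; rewrite mule_ge0// Radon_Nikodym_SigmaFinite.f_ge0.
- by move=> x _; rewrite mule_ge0// lee_fin.
- exact: (ae_eqe_mul2l f ae).
Qed.

End density.

(** The measure A |-> j P(D, X in A), as a finite measure to which products and
the Fubini theorem apply. *)
Section restricted_law.
Context {d d'} {Om : measurableType d} {T : measurableType d'} {R : realType}.
Variables (P : probability Om R) (j : {nonneg R}) (D : set Om) (mD : measurable D)
  (X : Om -> T) (mX : measurable_fun setT X).

Definition restricted_law of measurable D & measurable_fun setT X : set T -> \bar R :=
  fun A => (j%:num%:E * P (D `&` X @^-1` A))%E.
Local Notation law := (restricted_law mD mX).

Let mXA (A : set T) : measurable A -> measurable (X @^-1` A).
Proof. by move=> mA; rewrite -[X in measurable X]setTI; exact: mX. Qed.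

Let law0 : law set0 = 0%E.
Proof. by rewrite /restricted_law preimage_set0 setI0 measure0 mule0. Qed.

Let law_ge0 A : (0 <= law A)%E.
Proof. by rewrite /restricted_law mule_ge0// lee_fin. Qed.

Let law_sigma_additive : semi_sigma_additive law.
Proof.
move=> F mF tF mUF; rewrite /restricted_law preimage_bigcup setI_bigcupr.
have -> : (fun n => \sum_(0 <= i < n) j%:num%:E * P (D `&` X @^-1` F i))%E =
  (fun n => j%:num%:E * (\sum_(0 <= i < n) P (D `&` X @^-1` F i)))%E.
  by apply/funext => n; rewrite ge0_sume_distrr.
apply: cvgeZl => //; apply: measure_semi_sigma_additive.
- by move=> n; apply: measurableI => //; exact: mXA.
- apply/trivIsetP => i k _ _ ik; rewrite setIACA setIid -preimage_setI.
  by move/trivIsetP : tF => /(_ _ _ _ _ ik) ->//; rewrite preimage_set0 setI0.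
- by rewrite -setI_bigcupr -preimage_bigcup; apply: measurableI => //; exact: mXA.
Qed.

HB.instance Definition _ := isMeasure.Build _ _ _ law law0 law_ge0 law_sigma_additive.

Let law_fin : fin_num_fun law.
Proof.
move=> A mA; rewrite /restricted_law fin_numM// fin_num_measure//.
by apply: measurableI => //; exact: mXA.
Qed.

HB.instance Definition _ := Measure_isFinite.Build _ _ _ law law_fin.

Lemma ge0_integral_restricted_law (f : T -> \bar R) : measurable_fun setT f ->
  (forall x, 0 <= f x)%E ->
  (\int[law]_x f x = j%:num%:E * \int[P]_(w in D) f (X w))%E.
Proof.
move=> mf f0.
have mfX : measurable_fun setT (f \o X) by exact: measurableT_comp.
have PD : (P D < +oo)%E by rewrite -ge0_fin_numE// fin_num_measure.
transitivity (\int[pushforward (mscale j (mfrestr mD PD)) X]_x f x)%E.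
  apply: eq_measure_integral => A mA _.
  by rewrite /= /restricted_law /pushforward /mscale /= /mfrestr /mrestr setIC.
rewrite ge0_integral_pushforward// preimage_setT.
rewrite (ge0_integral_mscale (mfrestr mD PD) measurableT j mfX); last first.
  by move=> w _; exact: f0.
congr (_ * _)%E.
rewrite (@ge0_integral_density _ _ _ P (mfrestr mD PD) \1_D)//.
- by rewrite [RHS]integral_mkcond; apply: eq_integral => w _; rewrite epatch_indic.
- by move=> A mA; rewrite /= /mfrestr /mrestr setIC integral_indic.
- by move=> w; exact: f0.
Qed.

End restricted_law.

Section joint_law.
Context {d d1 d2} {Om : measurableType d} {T1 : measurableType d1} {T2 : measurableType d2}
  {R : realType}.
Variables (P : probability Om R) (j : {nonneg R}) (D E : set Om)
  (mD : measurable D) (mE : measurable E)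
  (X : Om -> T1) (Y : Om -> T2) (nu : probability T2 R)
  (mX : measurable_fun setT X) (mY : measurable_fun setT Y).
Hypothesis split : forall A B, measurable A -> measurable B ->
  (P (E `&` X @^-1` A `&` Y @^-1` B) = j%:num%:E * P (D `&` X @^-1` A) * nu B)%E.

(** The hypothesis identifies the law of (X, Y) on E with a product measure on
rectangles, hence everywhere. *)
Lemma ge0_integral_joint (F : T1 * T2 -> \bar R) : measurable_fun setT F ->
  (forall z, 0 <= F z)%E ->
  (\int[P]_(w in E) F (X w, Y w) =
   j%:num%:E * \int[P]_(w in D) \int[nu]_y F (X w, y))%E.
Proof.
move=> mF F0.
have mXY : measurable_fun setT (fun w => (X w, Y w)) by exact: measurable_fun_pair.
rewrite -[LHS]mul1e -(ge0_integral_restricted_law P 1%:nng mE mXY)//.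
transitivity (\int[restricted_law P j mD mX \x nu]_z F z)%E.
  apply: eq_measure_integral => A mA _; apply/esym.
  apply: product_measure_unique => // A1 A2 mA1 mA2.
  rewrite /= /restricted_law /= mul1e -split//.
  by rewrite -setIA; congr (P (_ `&` _)).
rewrite fubini_tonelli1// ge0_integral_restricted_law//.
  exact: measurable_fun_fubini_tonelli_F.
by move=> x; apply: integral_ge0.
Qed.

End joint_law.

(** * From the law of one jump to the law at a fixed time *)

Section moves.
Context {R : realType} {I : finType}.
Variables (l : I -> R) (m : nat).
Hypothesis l_ge0 : forall i, 0 <= l i.
Hypothesis total_gt0 : 0 < total l.
Implicit Types (c : {ffun I -> nat}).

(** A move is a birth or a death in a given cell.  Different moves may have the same
target, hence [jump_prob]. *)
Definition target c (k : I + I) : {ffun I -> nat} :=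
  match k with inl i => up c i | inr i => dn c i end.
Definition move_prob c (k : I + I) : R :=
  match k with
  | inl i => l i / rate l m c
  | inr i => if (m < tot c)%N then (c i)%:R / rate l m c else 0
  end.
Definition jump_prob c c' : R := \sum_k move_prob c k * (c' == target c k)%:R.

Lemma move_prob_ge0 c k : 0 <= move_prob c k.
Proof.
have r0 := rate_gt0 m total_gt0 c.
by case: k => i /=; [|case: ifP => // _]; apply: divr_ge0 => //; exact: ltW.
Qed.

Lemma jump_prob_ge0 c c' : 0 <= jump_prob c c'.
Proof. by apply: sumr_ge0 => k _; rewrite mulr_ge0 ?move_prob_ge0. Qed.

Lemma sum_moves (g : {ffun I -> nat} -> R) c :
  \sum_k move_prob c k * g (target c k) = jumps l m g c / rate l m c.
Proof.
rewrite big_sumType/= /jumps mulrDl mulr_suml; congr (_ + _).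
  by apply: eq_bigr => i _; rewrite mulrAC.
case: ifP => _; first by rewrite mulr_suml; apply: eq_bigr => i _; rewrite mulrAC.
by rewrite mul0r big1// => i _; rewrite mul0r.
Qed.

Lemma sum_move_prob c : \sum_k move_prob c k = 1.
Proof.
have := sum_moves (fun=> 1) c; rewrite jumps1 divff ?gt_eqF ?rate_gt0// => <-.
by apply: eq_bigr => k _; rewrite mulr1.
Qed.

Lemma esum_jump_prob c (A : {ffun I -> nat} -> \bar R) : (forall c', 0 <= A c')%E ->
  (\esum_(c' in [set: {ffun I -> nat}]) ((jump_prob c c')%:E * A c') =
   \sum_k (move_prob c k)%:E * A (target c k))%E.
Proof.
move=> A0.
transitivity (\esum_(c' in [set: {ffun I -> nat}])
    (\sum_k ((move_prob c k * (c' == target c k)%:R)%:E * A c')))%E.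
  apply: eq_esum => c' _; rewrite /jump_prob -sumEFin ge0_sume_distrl// => k _.
  by rewrite lee_fin mulr_ge0 ?move_prob_ge0.
rewrite esum_sum; last first.
  by move=> c' k _ _; rewrite mule_ge0// lee_fin mulr_ge0 ?move_prob_ge0.
apply: eq_bigr => k _.
rewrite (esumID [set target c k]); last first.
  by move=> c' _; rewrite mule_ge0// lee_fin mulr_ge0 ?move_prob_ge0.
rewrite setTI esum_set1; last by rewrite mule_ge0// lee_fin mulr_ge0 ?move_prob_ge0.
rewrite eqxx mulr1 esum1 ?adde0// => c' [_ /= /eqP/negPf ->].
by rewrite mulr0 mul0e.
Qed.

End moves.

Section exponential_clock.
Context {R : realType}.
Variable (q : R).
Hypothesis q_gt0 : 0 < q.
Local Notation mu := (@lebesgue_measure R).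
Local Notation pdf := (exponential_pdf q).

(** The exponential law as a probability on the measurable type of the reals that
carries Lebesgue measure. *)
Definition clock : probability (measurableTypeR R) R.
Proof. by refine (exponential_prob q : probability _ R). Defined.

Lemma clockE (A : set R) : clock A = exponential_prob q A.
Proof. by []. Qed.

Let pdf0 x : 0 <= pdf x.
Proof. by rewrite exponential_pdf_ge0// ltW. Qed.

Lemma ge0_integral_clock (F : R -> \bar R) : measurable_fun setT F ->
  (forall x, 0 <= F x)%E -> (\int[clock]_x F x = \int[mu]_x (F x * (pdf x)%:E))%E.
Proof.
move=> mF F0; apply: ge0_integral_density => //.
exact: measurable_exponential_pdf.
Qed.

Lemma clock_gt (v : R) : 0 <= v -> clock `]v, +oo[%classic = (expR (- q * v))%:E.
Proof.
move=> v0.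
have h0 : clock `]-oo, 0[%classic = 0%E.
  rewrite clockE /exponential_prob integral0_eq// => x /=; rewrite in_itv/= => x0.
  by rewrite lt0_exponential_pdf.
have h1 : clock `[0, v]%classic = (1 - expR (- q * v))%:E.
  move: v0; rewrite le_eqVlt => /predU1P[<-|v0].
    rewrite mulr0 expR0 subrr set_itv1 clockE /exponential_prob.
    by rewrite integral_set1.
  by rewrite clockE exponential_prob_itv0c.
have : clock setT = (clock `]-oo, 0%R[%classic + clock `[0%R, v]%classic + clock `]v, +oo[%classic)%E.
  rewrite -measureU//; last 1 first.
  - by rewrite -subset0 => x []; rewrite /= !in_itv/= => x0 /andP[]; rewrite leNgt x0.
  rewrite -measureU//; last 2 first.
  - by apply: measurableU.
  - rewrite -subset0 => x [] [] /=; rewrite !in_itv/= andbT.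
      by move=> x0 vx; have := lt_trans x0 (le_lt_trans v0 vx); rewrite ltxx.
    by move=> /andP[_ xv]; rewrite ltNge xv.
  congr (clock _); apply/seteqP; split=> // x _ /=; rewrite !in_itv/= andbT.
  have [x0|x0] := ltP x 0; first by left; left.
  by have [xv|vx] := leP x v; [left; right | right].
rewrite probability_setT h0 h1 add0e.
have : clock `]v, +oo[%classic \is a fin_num by exact: fin_num_measure.
case: (clock _) => // r _ [rE]; congr (_%:E); lra.
Qed.

End exponential_clock.

Section exponential_holding.
Context {R : realType} {I : finType}.
Variables (l : I -> R) (m : nat).
Hypothesis l_ge0 : forall i, 0 <= l i.
Hypothesis total_gt0 : 0 < total l.
Variable f : {ffun I -> nat} -> R.
Hypothesis f01 : forall c, 0 <= f c <= 1.
Implicit Types (c : {ffun I -> nat}).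
Local Notation G := (semigroup l m f).
Local Notation mu := (@lebesgue_measure R).
Local Notation q c := (rate_gt0 m total_gt0 c).

Let cG c : continuous (G ^~ c). Proof. exact: continuous_semigroup. Qed.
Let G0 t c : 0 <= G t c. Proof. by case/andP: (semigroup01 m l_ge0 f01 t c). Qed.

Let cJ c (v : R) : continuous (fun w : R => jumps l m (G (v - w)) c).
Proof.
move=> w; apply: (@continuous_comp _ _ _ (fun w => v - w) (fun t => jumps l m (G t) c)).
  by apply: cvgB; [exact: cvg_cst | exact: cvg_id].
exact: continuous_jumps.
Qed.

(** The first-jump decomposition of the semigroup.  With q = rate c, the density
exp (- q w) jumps (G (v - w)) c on [0, v] is the derivative of
- exp (- q w) G (v - w) c by the backward equation, and the event w > v
contributes f c exp (- q v). *)
Lemma holding_integral (v : R) c : 0 <= v ->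
  (\int[clock (q c)]_w (if (v < w)%R then f c else jumps l m (G (v - w)) c / rate l m c)%:E
   = (G v c)%:E)%E.
Proof.
move=> v0; have qc := q c.
pose h w := if v < w then f c else jumps l m (G (v - w)) c / rate l m c.
have mh : measurable_fun setT (fun w => (h w)%:E).
  apply/measurable_EFinP; apply: measurable_fun_ifT.
  - exact: measurable_fun_ltr.
  - exact: measurable_cst.
  - apply: continuous_measurable_fun => w; apply: cvgMl; exact: cJ.
have h0 w : 0 <= h w.
  rewrite /h; case: ifP => _; first by case/andP: (f01 c).
  by rewrite divr_ge0 ?(ltW qc)// jumps_ge0.
rewrite -(setUv `]v, +oo[%classic) ge0_integral_setU//; last 4 first.
- exact: measurableC.
- by rewrite setUv.
- by move=> x _; rewrite lee_fin; exact: h0.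
- exact/disj_setPCl.
rewrite (eq_integral (fun=> (f c)%:E)); last first.
  by move=> x; rewrite inE /= in_itv/= andbT => ->.
rewrite -[X in (_ + X)%E]/(\int[clock (q c)]_(w in ~` `]v, +oo[%classic) (h w)%:E)%E.
have -> : (\int[clock (q c)]_(_ in `]v, +oo[%classic) (f c)%:E =
    (f c * expR (- rate l m c * v))%:E)%E.
  rewrite integral_cst// EFinM; congr (_ * _)%E; exact: clock_gt.
have -> : (\int[clock (q c)]_(w in ~` `]v, +oo[%classic) (h w)%:E =
   \int[mu]_(w in `[0%R, v]) (expR (- rate l m c * w) * jumps l m (G (v - w)) c)%:E)%E.
  rewrite integral_mkcond ge0_integral_clock; last 2 first.
  - by apply/(measurable_restrictT _ _).1; [exact: measurableC | exact: measurable_funTS].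
  - by move=> x; rewrite patchE; case: ifP => // _; rewrite lee_fin.
  rewrite [RHS]integral_mkcond; apply: eq_integral => x _.
  rewrite !patchE; case: ifPn; rewrite ?inE ?notin_setE /= !in_itv/= ?andbT => hx.
    have xv : x <= v by rewrite leNgt; exact/negP.
    have [x0|x0] := leP 0 x; last first.
      by rewrite lt0_exponential_pdf// mule0 ifF// memNset//= in_itv/= leNgt x0.
    rewrite mem_set/=; last by rewrite in_itv/= x0.
    rewrite exponential_pdfE// -EFinM; congr (_%:E).
    rewrite /h ltNge xv/=; field; exact: lt0r_neq0.
  rewrite mul0e ifF// memNset//= in_itv/= => /andP[_ xv]; apply: hx.
  by apply/negP; rewrite -leNgt.
move: v0; rewrite le_eqVlt => /predU1P[<-|v0].
  by rewrite set_itv1 integral_set1 adde0 mulr0 expR0 mulr1 semigroup0.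
pose F w := - (expR (- rate l m c * w) * G (v - w) c).
have cF : continuous F.
  move=> w; apply: cvgN; apply: cvgM; first exact: continuous_expM.
  apply: (@continuous_comp _ _ _ (fun w => v - w) (G ^~ c)).
    by apply: cvgB; [exact: cvg_cst | exact: cvg_id].
  exact: cG.
have dGB x : 0 < v - x -> is_derive x 1 (fun w => G (v - w) c)
    (- (0 + jumps l m (G (v - x)) c - rate l m c * G (v - x) c)).
  move=> vx; have dG := (semigroup_evolves m l_ge0 total_gt0 f01).2 c (v - x) vx.
  have dB : is_derive x 1 (fun w : R => v - w) (0 - 1) by exact: is_deriveB.
  have := @is_derive1_comp _ (G ^~ c) (fun w => v - w) x _ _ dG dB.
  by rewrite sub0r mulrN1.
rewrite (@continuous_FTC2 _ _ F 0 v)//.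
- rewrite -EFinB -EFinD /F subrr subr0 mulr0 expR0 mul1r semigroup0//.
  by congr (_%:E); ring.
- apply: continuous_subspaceT => w; apply: cvgM; first exact: continuous_expM.
  exact: cJ.
- split.
  + move=> x; rewrite in_itv/= => /andP[x0 xv].
    have vx : 0 < v - x by rewrite subr_gt0.
    have ? := dGB x vx.
    by apply: ex_derive; rewrite /F; apply: is_derive_eq.
  + by apply: cvg_at_right_filter; exact: cF.
  + by apply: cvg_at_left_filter; exact: cF.
- move=> x; rewrite in_itv/= => /andP[x0 xv].
  have vx : 0 < v - x by rewrite subr_gt0.
  have ? := dGB x vx.
  rewrite derive1E; apply: derive_val; rewrite /F; apply: is_derive_eq.
  by rewrite /GRing.scale/=; ring.
Qed.

End exponential_holding.

(** A chain N with holding times W, of which only the joint law of the next state and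
of the current holding time given the current state and jump time is known. *)
Section paths.
Context {R : realType} {I : finType}.
Variables (l : I -> R) (m : nat).
Hypothesis l_ge0 : forall i, 0 <= l i.
Hypothesis total_gt0 : 0 < total l.
Variable f : {ffun I -> nat} -> R.
Hypothesis f01 : forall c, 0 <= f c <= 1.
Implicit Types (c : {ffun I -> nat}).
Local Notation G := (semigroup l m f).
Local Notation q c := (rate_gt0 m total_gt0 c).

Context {d} {Om : measurableType d}.
Variables (P : probability Om R) (N : nat -> Om -> {ffun I -> nat}) (W : nat -> Om -> R).
Hypothesis mN : forall n c, measurable (N n @^-1` [set c]).
Hypothesis mW : forall n, measurable_fun setT (W n).
Hypothesis W0 : forall n w, 0 < W n w.

Definition jump_time (n : nat) (w : Om) : R := \sum_(i < n) W i w.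
Local Notation S := jump_time.

Hypothesis step : forall n c c' (A B : set R), measurable A -> measurable B ->
  (P ((N n @^-1` [set c] `&` N n.+1 @^-1` [set c']) `&` S n @^-1` A `&` W n @^-1` B) =
   (jump_prob l m c c')%:E * P (N n @^-1` [set c] `&` S n @^-1` A) * clock (q c) B)%E.

Let mS n : measurable_fun setT (S n).
Proof. by apply: measurable_sum => i; exact: mW. Qed.

Let S_S n w : S n.+1 w = S n w + W n w.
Proof. by rewrite /S big_ord_recr. Qed.

Let G0 t c : 0 <= G t c. Proof. by case/andP: (semigroup01 m l_ge0 f01 t c). Qed.
Let G1 t c : G t c <= 1. Proof. by case/andP: (semigroup01 m l_ge0 f01 t c). Qed.
Let f0 c : 0 <= f c. Proof. by case/andP: (f01 c). Qed.
Let cG c : continuous (G ^~ c). Proof. exact: continuous_semigroup. Qed.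

Variable t : R.
Hypothesis t0 : 0 <= t.

(* the expectation of f at time t given that the chain is in c, reached at time
   z.1, stays there during z.2 and then jumps to c'; it is 0 when t < z.1 *)
Let H c (z : R * R) c' : R :=
  if t < z.1 + z.2 then (if z.1 <= t then f c else 0) else G (t - z.1 - z.2) c'.

Let H0 c z c' : 0 <= H c z c'.
Proof. by rewrite /H; case: ifP => // _; case: ifP. Qed.

Let mH c c' : measurable_fun setT (fun z => H c z c').
Proof.
apply: measurable_fun_ifT.
- apply: measurable_fun_ltr; first exact: measurable_cst.
  by apply: measurable_funD; [exact: measurable_fst | exact: measurable_snd].
- apply: measurable_fun_ifT => //.
  by apply: measurable_fun_ler; [exact: measurable_fst|exact: measurable_cst].
- apply: (measurableT_comp (f := G ^~ c') (g := fun z : R * R => t - z.1 - z.2)).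
    exact: continuous_measurable_fun.
  apply: measurable_funB; last exact: measurable_snd.
  by apply: measurable_funB; [exact: measurable_cst|exact: measurable_fst].
Qed.

Let started n w : R := if S n w <= t then G (t - S n w) (N n w) else 0.

Let mNf {d'} {T' : measurableType d'} n (g : {ffun I -> nat} -> T') :
  measurable_fun setT (fun w => g (N n w)).
Proof. exact: measurable_count. Qed.

(** Countable unions over the fibers of the discrete variable replace a measurable
structure on its type. *)
Lemma measurable_count2 (n : nat) (g : R -> {ffun I -> nat} -> R) (X : Om -> R) :
  (forall c, measurable_fun setT (g ^~ c)) -> measurable_fun setT X ->
  measurable_fun setT (fun w => g (X w) (N n w)).
Proof.
move=> mg mX _ Y mY; rewrite setTI.
have -> : (fun w => g (X w) (N n w)) @^-1` Y =
  \bigcup_k (if pickle_inv (k : nat) is Some c then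
     N n @^-1` [set c] `&` (fun w => g (X w) c) @^-1` Y else set0).
  apply/seteqP; split=> [w Yw|w [k _]].
    by exists (pickle (N n w)) => //; rewrite pickleK_inv.
  by case: (pickle_inv k) => // c [/= ->].
apply: bigcupT_measurable => k; case: (pickle_inv k) => // c.
apply: measurableI => //; rewrite -[X in measurable X]setTI.
exact: (measurableT_comp (mg c) mX).
Qed.

Let m_started n : measurable_fun setT (started n).
Proof.
apply: measurable_fun_ifT => //; first exact: measurable_fun_ler.
apply: (@measurable_count2 n (fun s c => G (t - s) c)) => // c.
apply: continuous_measurable_fun => s.
apply: (@continuous_comp _ _ _ (fun s => t - s) (G ^~ c)); last exact: cG.
by apply: cvgB; [exact: cvg_cst | exact: cvg_id].
Qed.

Let next n w : R := H (N n w) (S n w, W n w) (N n.+1 w).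

Let m_next n : measurable_fun setT (next n).
Proof.
rewrite /next /H /=; apply: measurable_fun_ifT.
- by apply: measurable_fun_ltr => //; exact: measurable_funD.
- apply: measurable_fun_ifT => //; first exact: measurable_fun_ler.
- apply: (@measurable_count2 n.+1 (fun s c => G s c) (fun w => t - S n w - W n w)).
    by move=> c; exact: continuous_measurable_fun.
  by apply: measurable_funB => //; exact: measurable_funB.
Qed.

Let next0 n w : 0 <= next n w. Proof. exact: H0. Qed.
Let started0 n w : 0 <= started n w. Proof. by rewrite /started; case: ifP. Qed.

Let sum_H c u y : \sum_k move_prob l m c k * H c (u, y) (target c k) =
  if t < u + y then (if u <= t then f c else 0)
  else jumps l m (G (t - u - y)) c / rate l m c.
Proof.
under eq_bigr do rewrite /H /=.
have [tu|tu] := ltP t (u + y); last first.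
  exact: (sum_moves l m (G (t - u - y)) c).
by rewrite -mulr_suml sum_move_prob ?mul1r.
Qed.

Let inner c u : (\int[clock (q c)]_y
   (\sum_k move_prob l m c k * H c (u, y) (target c k))%:E =
   (if u <= t then G (t - u) c else 0)%:E)%E.
Proof.
under eq_integral do rewrite sum_H.
case: ifPn => ut.
  rewrite -(@holding_integral _ _ l m l_ge0 total_gt0 f f01 (t - u) c) ?subr_ge0//.
  by apply: eq_integral => y _; rewrite ltrBlDl.
rewrite -ltNge in ut.
rewrite ge0_integral_clock; last 2 first.
- apply/measurable_EFinP; apply: (eq_measurable_fun (fun y =>
    \sum_k move_prob l m c k * H c (u, y) (target c k))).
    by move=> y _; rewrite sum_H leNgt ut.
  apply: measurable_sum => k; apply: measurable_funM => //.
  apply: (measurableT_comp (mH c (target c k))).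
  exact: pair1_measurable.
- move=> y; have := sum_H c u y; rewrite leNgt ut/= => <-.
  by rewrite lee_fin sumr_ge0// => k _; rewrite mulr_ge0 ?move_prob_ge0.
rewrite integral0_eq// => y _.
have [y0|y0] := leP 0 y; last by rewrite lt0_exponential_pdf// mule0.
by rewrite ltr_wpDr// mul0e.
Qed.

(** On a fiber of the current state the hypothesis [step] makes the next state and
the holding time independent, and [holding_integral] integrates the latter out. *)
Lemma fiber_step n c :
  (\int[P]_(w in N n @^-1` [set c]) (next n w)%:E =
   \int[P]_(w in N n @^-1` [set c]) (started n w)%:E)%E.
Proof.
pose D := N n @^-1` [set c]; have mD : measurable D by exact: mN.
pose h z c' := (H c z c')%:E.
have mh c' : measurable_fun setT (fun z => h z c') by exact/measurable_EFinP.
have h0 z c' : (0 <= h z c')%E by rewrite lee_fin.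
rewrite [LHS]integral_mkcond (@ge0_integral_count_esum _ _ _ _ P (N n.+1))//; last 2 first.
- apply/(measurable_restrictT _ _).1 => //; apply: measurable_funTS.
  by apply/measurable_EFinP.
- by move=> w; rewrite patchE; case: ifP => // _; rewrite lee_fin.
pose A c' := (\int[P]_(w in D) \int[clock (q c)]_y h (S n w, y) c')%E.
have A0 c' : (0 <= A c')%E by apply: integral_ge0 => w _; exact: integral_ge0.
transitivity (\esum_(c' in [set: {ffun I -> nat}]) ((jump_prob l m c c')%:E * A c'))%E.
  apply: eq_esum => c' _; rewrite -integral_mkcondr.
  have mE : measurable (D `&` N n.+1 @^-1` [set c']) by exact: measurableI.
  have jp : 0 <= jump_prob l m c c' by exact: jump_prob_ge0.
  rewrite (_ : (jump_prob l m c c')%:E = (NngNum jp)%:num%:E)//.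
  rewrite -(@ge0_integral_joint _ _ _ Om _ (measurableTypeR R) R P (NngNum jp) D _ mD mE (S n) (W n)
    (clock (q c)) (mS n) (mW n) _ (fun z => h z c'))//; last 2 first.
    - by move=> A1 A2 mA1 mA2; rewrite -step.
  - exact: (mh c').
  rewrite setIC; apply: eq_integral => w; rewrite inE => -[/= Nc Nc'].
  by rewrite /next Nc Nc'.
rewrite esum_jump_prob//.
rewrite [RHS](eq_integral (fun w => \int[clock (q c)]_y
   (\sum_k (move_prob l m c k)%:E * h (S n w, y) (target c k))%E))%E; last first.
  move=> w; rewrite inE => /= Nc; rewrite /started Nc -inner.
  by apply: eq_integral => y _; rewrite /h -sumEFin.
have mhS k u : measurable_fun setT (fun y => h (u, y) (target c k)).
  exact: (measurableT_comp (mh (target c k)) (@pair1_measurable _ _ _ _ u)).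
have mint k : measurable_fun setT (fun u => \int[clock (q c)]_y h (u, y) (target c k))%E.
  apply: (@measurable_fun_fubini_tonelli_F _ _ _ (measurableTypeR R) R (clock (q c)) (fun z => h z (target c k))) => //.
  exact: (mh (target c k)).
have mp0 k : (0 <= (move_prob l m c k)%:E)%E by rewrite lee_fin move_prob_ge0.
under [RHS]eq_integral => w _.
  rewrite ge0_integral_sum//; last 2 first.
  - by move=> k; apply: emeasurable_funM => //; exact: (mhS k (S n w)).
  - by move=> k y _; rewrite mule_ge0.
  under eq_bigr => k _.
    rewrite (@ge0_integralZl _ (measurableTypeR R) R (clock (q c)) _ _ (fun y => h (S n w, y) (target c k)))//; last exact: (mhS k (S n w)).
    over.
  over.
rewrite ge0_integral_sum//; last 2 first.
- move=> k; apply: emeasurable_funM => //; apply: measurable_funTS.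
  exact: (measurableT_comp (mint k) (mS n)).
- by move=> k w _; rewrite mule_ge0//; exact: integral_ge0.
apply: eq_bigr => k _; rewrite ge0_integralZl//.
- apply: measurable_funTS; exact: (measurableT_comp (mint k) (mS n)).
- by move=> w _; exact: integral_ge0.
Qed.

Lemma one_step n : (\int[P]_w (next n w)%:E = \int[P]_w (started n w)%:E)%E.
Proof.
apply: (@ge0_integral_count_eq _ _ _ _ P (N n)) => //.
- exact/measurable_EFinP.
- by move=> w; rewrite lee_fin.
- exact/measurable_EFinP.
- by move=> w; rewrite lee_fin.
- by move=> c; exact: fiber_step.
Qed.

Variables (c0 : {ffun I -> nat}) (Nt : Om -> {ffun I -> nat}).
Hypothesis N_init : forall w, N 0 w = c0.
Hypothesis mNt : forall c, measurable (Nt @^-1` [set c]).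
Hypothesis Nt_path : forall w, exists2 n : nat, S n w <= t < S n.+1 w & Nt w = N n w.

Let S_le n k w : (n <= k)%N -> S n w <= S k w.
Proof.
elim: k => [|k ih]; first by rewrite leqn0 => /eqP ->.
rewrite leq_eqVlt => /predU1P[->//|nk].
by apply: (le_trans (ih nk)); rewrite S_S lerDl ltW.
Qed.

Let stopped n w : R := if t < S n w then f (Nt w) else G (t - S n w) (N n w).

Let mstopped n : measurable_fun setT (stopped n).
Proof.
apply: measurable_fun_ifT => //.
- exact: measurable_fun_ltr.
- exact: (measurable_count mNt f).
- apply: (@measurable_count2 n (fun s c => G (t - s) c)) => // c.
  apply: continuous_measurable_fun => s.
  apply: (@continuous_comp _ _ _ (fun s => t - s) (G ^~ c)); last exact: cG.
  by apply: cvgB; [exact: cvg_cst | exact: cvg_id].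
Qed.

Let stopped01 n w : 0 <= stopped n w <= 1.
Proof. by rewrite /stopped; case: ifP => _; [exact: f01 | rewrite G0 G1]. Qed.

Let stopped_const n : (\int[P]_w (stopped n w)%:E = (G t c0)%:E)%E.
Proof.
elim: n => [|n ih].
  rewrite (eq_integral (fun=> (G t c0)%:E)); last first.
    by move=> w _; rewrite /stopped /S big_ord0 ltNge t0/= subr0 N_init.
  by rewrite integral_cst//= probability_setT mule1.
rewrite -ih.
(* stopped n and stopped n.+1 share the contribution of the paths that have passed t *)
pose past w := if t < S n w then f (Nt w) else 0.
have past0 w : 0 <= past w by rewrite /past; case: ifP.
have mpast : measurable_fun setT past.
  apply: measurable_fun_ifT => //; first exact: measurable_fun_ltr.
  exact: (measurable_count mNt f).
have -> : (\int[P]_w (stopped n w)%:E = \int[P]_w ((past w)%:E + (started n w)%:E))%E.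
  apply: eq_integral => w _; rewrite -EFinD /stopped /past /started.
  by have [tS|St] := ltP t (S n w); rewrite ?addr0 ?add0r.
have -> : (\int[P]_w (stopped n.+1 w)%:E = \int[P]_w ((past w)%:E + (next n w)%:E))%E.
  apply: eq_integral => w _; rewrite -EFinD /stopped /past /next /H /=; congr (_%:E).
  rewrite -S_S; have [tS|St] := ltP t (S n w).
    by rewrite (lt_le_trans tS) ?S_le// addr0.
  rewrite add0r; have [tS'|S't] := ltP t (S n.+1 w).
    congr (f _); have [k /andP[Sk tk] ->] := Nt_path w.
    congr (N _ w); apply/eqP; rewrite eqn_leq; apply/andP; split.
      by rewrite leqNgt; apply/negP => nk; have := lt_le_trans tS' (S_le w nk); rewrite ltNge Sk.
    by rewrite leqNgt; apply/negP => nk; have := lt_le_trans tk (S_le w nk); rewrite ltNge St.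
  by rewrite S_S opprD addrA.
have E1 (g : Om -> R) : measurable_fun setT g -> measurable_fun setT (EFin \o g).
  by move=> ?; exact/measurable_EFinP.
rewrite !ge0_integralD//; try (by move=> w _; rewrite lee_fin); try exact: E1.
by rewrite one_step.
Qed.

(** [stopped n] is the conditional expectation of f at time t given the first n jumps.
Its mean does not depend on n, by [one_step]; it is G t c0 for n = 0, and
[stopped n] is f at time t as soon as the n-th jump time exceeds t. *)
Lemma path_expectation : (\int[P]_w (f (Nt w))%:E = (G t c0)%:E)%E.
Proof.
have h : (\int[P]_w (stopped n w)%:E @[n --> \oo] --> \int[P]_w (f (Nt w))%:E)%E.
  apply: (@cvg_integral_dominated _ _ _ P setT _ _ (fun=> 1)) => //.
  - exact: (measurable_count mNt f).
  - move=> w _; have [k /andP[_ tk] _] := Nt_path w.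
    apply: cvg_near_cst; exists k.+1 => // n /= kn.
    by rewrite /stopped (lt_le_trans tk)// S_le.
  - exact: finite_measure_integrable_cst.
  - by move=> n w _; case/andP: (stopped01 n w) => ? ?; rewrite ger0_norm.
rewrite -(cvg_lim _ h)//; under eq_fun do rewrite stopped_const.
exact: lim_cst.
Qed.

End paths.

(** * Finite configurations and test functions *)

Section finite_configurations.
Context {R : realType} {T : completeMetricType R}.
Implicit Types (xi eta : config T) (s : seq T) (a : T).

Lemma config_eq xi eta : (forall A : set T, xi A = eta A) -> xi = eta.
Proof.
case: xi eta => [m1 p1 l1] [m2 p2 l2] /= E.
have {}E : m1 = m2 by apply: eq_measure; apply/funext => A; exact: E.
by subst m2; congr Config; exact: Prop_irrelevance.
Qed.

Definition conf_of s : config T := foldr (fun a xi => add_point xi a) (@config0 R T) s.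

Lemma add_pointE xi a (A : set T) :
  add_point xi a A = (xi A + \d_(a : borel T) A)%E.
Proof. exact: measure_addE. Qed.

Definition count_in (A : set T) s : nat := count (fun a => a \in A) s.

Lemma conf_ofE s (A : set T) : conf_of s A = (count_in A s)%:R%:E.
Proof.
elim: s => [//|a s ih]; rewrite /= add_pointE ih diracE -EFinD.
by congr (_%:E); rewrite natrD addrC.
Qed.

Lemma npoints_conf_of s : npoints (conf_of s) = (size s)%:R%:E.
Proof.
rewrite /npoints conf_ofE /count_in; congr (_%:R%:E); apply/eqP.
by rewrite -all_count; apply/allP => a _; rewrite in_setT.
Qed.

Lemma finite_config_seq xi : (npoints xi < +oo)%E -> exists s, xi = conf_of s.
Proof.
have [D [x xE]] := config_point xi; rewrite /npoints xE => fin.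
have finD : finite_set D.
  apply: contrapT => infD; move: fin.
  rewrite (eq_esum (b := fun=> 1%E)); last by move=> i _; rewrite diracT.
  have := infinite_card_dirac (T := nat) R infD.
  rewrite (eq_esum (b := fun=> 1%E)); first by move=> ->.
  by move=> i Di; rewrite diracE mem_set.
exists [seq x i | i <- finmap.enum_fset (fset_set D)]; apply: config_eq => A.
rewrite xE conf_ofE esum_fset// fsbig_finite//=.
rewrite /count_in count_map -sum1_count natr_sum -sumEFin [RHS]big_mkcond/=.
by apply: eq_bigr => i _; rewrite diracE; case: (_ \in _).
Qed.

(** Subtracting a unit mass is possible although measures may be infinite. *)
Lemma add_point_inj a : injective (fun xi => add_point xi a).
Proof.
move=> xi eta E; apply: config_eq => A.
have := congr1 (fun zeta : config T => zeta A) E; rewrite !add_pointE.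
by move/(congr1 (fun z => z - \d_(a : borel T) A))%E; rewrite !addeK.
Qed.

Lemma perm_conf_of s t : perm_eq s t -> conf_of s = conf_of t.
Proof.
by move=> /seq.permP st; apply: config_eq => A; rewrite !conf_ofE /count_in st.
Qed.

Lemma enumerates_conf_of s :
  enumerates (fun i : 'I_(size s) => nth point s i) (conf_of s).
Proof.
move=> A; rewrite conf_ofE /count_in -sum1_count natr_sum -sumEFin big_mkcond/=.
rewrite (big_nth point) big_mkord; apply: eq_bigr => i _; rewrite diracE.
by case: (_ \in _).
Qed.
End finite_configurations.

Section test_functions.
Context {R : realType} {T : completeMetricType R}.
Variable f : config T -> R.
Hypothesis Ff : Fdbar f.
Hypothesis d_le1 : forall x y : T, mdist x y <= 1.
Implicit Types (s t : seq T) (a b : T).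

Lemma Fdbar01 xi : 0 <= f xi <= 1. Proof. exact: Ff.1. Qed.

Let dbar1_le n k (le_kn : (k <= n)%N) (x : 'I_n -> T) (y : 'I_k -> T) :
  dbar1 le_kn x y <= n%:R^-1 *
    (\sum_(i < k) mdist (x (widen_ord le_kn i)) (y i) + (n - k)%:R).
Proof.
rewrite /dbar1 ler_wpM2l ?invr_ge0//; rewrite lerD2r.
rewrite (le_trans (bigmin_le_cond _ _ (j := 1%g) _))//.
by rewrite le_eqVlt; apply/orP; left; apply/eqP; apply: eq_bigr => i _; rewrite perm1.
Qed.

(** In the definition of the metric the identity matching has cost 0 once the new point
is listed last. *)
Lemma Fdbar_add_point s a :
  `|f (conf_of (a :: s)) - f (conf_of s)| <= (size s).+1%:R^-1.
Proof.
rewrite (@perm_conf_of _ _ (a :: s) (rcons s a)); last first.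
  by rewrite perm_sym perm_rcons.
have le_s : (size s <= size (rcons s a))%N by rewrite size_rcons.
apply: le_trans (Ff.2 _ _ le_s _ _ _ _
  (enumerates_conf_of (rcons s a)) (enumerates_conf_of s)) _.
apply: le_trans (dbar1_le _ _ _) _.
rewrite big1 ?add0r; last first.
  by move=> i _; rewrite /= nth_rcons ltn_ord mdistxx.
by rewrite size_rcons subSnn mulr1.
Qed.

Lemma Fdbar_map (I : Type) (r : seq I) (u v : I -> T) :
  `|f (conf_of (map u r)) - f (conf_of (map v r))| <=
  (size r)%:R^-1 * \sum_(i <- r) mdist (u i) (v i).
Proof.
have le_s : (size (map v r) <= size (map u r))%N by rewrite !size_map.
apply: le_trans (Ff.2 _ _ le_s _ _ _ _
  (enumerates_conf_of (map u r)) (enumerates_conf_of (map v r))) _.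
apply: le_trans (dbar1_le _ _ _) _.
have -> : \sum_(i < size (map v r))
    mdist (nth point (map u r) i) (nth point (map v r) i) =
    \sum_(i <- r) mdist (u i) (v i).
  rewrite -(big_mkord xpredT
    (fun j => mdist (nth point (map u r) j) (nth point (map v r) j))) size_map.
  case: r {le_s} => [|i0 r]; first by rewrite /= big_geq// big_nil.
  rewrite (big_nth i0); apply: eq_big_nat => j /andP[_ jr].
  by rewrite !(nth_map i0).
by rewrite !size_map subnn addr0.
Qed.

End test_functions.

(** * Cells around a dense sequence *)

Section nearest_points.
Context {R : realType} {T : completeMetricType R}.
Implicit Types (a : T) (x : nat -> T).

Lemma dense_sequence : separable T ->
  exists x : nat -> T, forall a (e : R), 0 < e -> exists j, mdist a (x j) < e.
Proof.
case=> S /countable_injP[g ginj] dS.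
exists (fun n => get [set a | S a /\ g a = n]) => a e e0.
have [b [ab Sb]] : (ball a e)^° `&` S !=set0.
  apply: dS; last exact: open_interior.
  by exists a; exact: (nbhsx_ballx a e e0).
exists (g b); rewrite (_ : get _ = b).
  by have := interior_subset ab; rewrite ballEmdist.
have [S' E] : [set a | S a /\ g a = g b] (get [set a | S a /\ g a = g b]).
  by apply: getPex; exists b.
by apply: ginj => //; exact/mem_set.
Qed.

Variable x : nat -> T.

(** The index of the first nearest point among x 0, ..., x K; the recursion makes its
level sets visibly Borel. *)
Fixpoint nearest (K : nat) a : nat :=
  if K is k.+1 then
    if mdist a (x k.+1) < mdist a (x (nearest k a)) then k.+1 else nearest k a
  else 0.

Lemma nearest_le K a : (nearest K a <= K)%N.
Proof. by elim: K => //= K ih; case: ifP => // _; exact: leqW. Qed.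

Lemma nearest_min K a j : (j <= K)%N ->
  mdist a (x (nearest K a)) <= mdist a (x j).
Proof.
elim: K => [|K ih]; first by rewrite leqn0 => /eqP ->.
rewrite leq_eqVlt ltnS /=; case: ltP => [lt|le] /predU1P[->|/ih]//.
by move=> h; exact: le_trans (ltW lt) h.
Qed.

Lemma open_closer b c : open [set a : T | mdist a b < mdist a c].
Proof.
rewrite openE => a /= abc; apply/nbhs_ballP.
exists ((mdist a c - mdist a b) / 2) => /=; first by rewrite divr_gt0// subr_gt0.
rewrite ballEmdist => y /= ay.
have h1 := metric_triangle y a b; have h2 := metric_triangle a y c.
rewrite (metric_sym y a) in h1; lra.
Qed.

Lemma measurable_nearest K j : measurable (nearest K @^-1` [set j] : set (borel T)).
Proof.
elim: K j => [|K ih] j.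
  have [->|j0] := eqVneq j 0%N.
    by rewrite (_ : _ @^-1` _ = setT); [exact: measurableT | apply/seteqP].
  rewrite (_ : _ @^-1` _ = set0); first exact: measurable0.
  by rewrite -subset0 => a /= E; rewrite E eqxx in j0.
pose D := \bigcup_k (nearest K @^-1` [set k] `&`
  [set a : T | mdist a (x K.+1) < mdist a (x k)]) : set (borel T).
have DE : D = [set a | mdist a (x K.+1) < mdist a (x (nearest K a))].
  apply/seteqP; split=> [a [k _ [/= ->]]//|a lt].
  by exists (nearest K a).
have mD : measurable D.
  apply: bigcupT_measurable => k; apply: measurableI => //.
  by apply: sub_sigma_algebra; exact: open_closer.
rewrite (_ : _ @^-1` _ = (D `&` (if j == K.+1 then setT else set0)) `|` (~` D `&` nearest K @^-1` [set j])).
  apply: measurableU.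
  - by apply: measurableI => //; case: ifP.
  - by apply: measurableI => //; exact: measurableC.
rewrite DE; apply/seteqP; split=> a /=.
  by case: ifPn => [lt <-|nlt ->]; [left; rewrite eqxx|right; split => //; exact/negP].
by case=> [[-> ]|[/negP/negbTE -> ->]//]; case: eqP => [->|].
Qed.

End nearest_points.

Section cells.
Context {R : realType} {T : completeMetricType R} {I : finType}.
Variable rho : T -> I.
Hypothesis mrho : forall i, measurable (rho @^-1` [set i] : set (borel T)).
Implicit Types (xi : config T) (s : seq T) (c : {ffun I -> nat}).

Definition cell i : set (borel T) := rho @^-1` [set i].

(** On a cell of infinite mass the value is the meaningless 0; such configurations have
probability 0. *)
Definition cell_counts xi : {ffun I -> nat} := [ffun i => Num.truncn (fine (xi (cell i)))].

Lemma cell_counts_conf_of s : cell_counts (conf_of s) = [ffun i => count (fun a => rho a == i) s].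
Proof.
apply/ffunP => i; rewrite !ffunE conf_ofE /= natrK /count_in; apply: eq_count => a.
by apply/idP/eqP; rewrite in_setE.
Qed.

Lemma tot_cell_counts s : tot (cell_counts (conf_of s)) = size s.
Proof.
rewrite /tot cell_counts_conf_of; under eq_bigr do rewrite ffunE -sum1_count.
by rewrite -[RHS]sum1_size (partition_big rho xpredT).
Qed.

Lemma cell_counts_cons a s : cell_counts (conf_of (a :: s)) = up (cell_counts (conf_of s)) (rho a).
Proof.
by apply/ffunP => i; rewrite !cell_counts_conf_of !ffunE/= addnC eq_sym.
Qed.

Lemma measurable_evaluation (B : set (borel T)) : measurable B ->
  measurable_fun setT (fun xi => xi B).
Proof.
move=> mB _ S mS; rewrite setTI; apply: sub_sigma_algebra.
by exists B => //; exists S.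
Qed.

Lemma measurable_truncn (n : nat) : measurable [set r : R | Num.truncn r = n].
Proof.
have -> : [set r : R | Num.truncn r = n] =
    ~` `[n.+1%:R, +oo[%classic `&` (if n is 0 then setT else `[n%:R, +oo[%classic).
  apply/seteqP; split=> r /=; rewrite in_itv/= andbT -truncn_gt_nat.
    move=> <-; rewrite ltnn; split=> //.
    by case E: (Num.truncn r) => [|k]//=; rewrite in_itv/= -truncn_gt_nat E leqnn.
  move=> [/negP]; rewrite -leqNgt; case: n => [|n]; first by rewrite leqn0 => /eqP.
  by move=> rn /=; rewrite in_itv/= andbT -truncn_gt_nat => nr; apply/eqP; rewrite eqn_leq rn.
by apply: measurableI; [exact: measurableC | case: n].
Qed.

Lemma measurable_cell_counts c : measurable (cell_counts @^-1` [set c]).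
Proof.
have -> : cell_counts @^-1` [set c] =
  \bigcap_(i in [set: I]) ((fun xi => fine (xi (cell i))) @^-1` [set r : R | Num.truncn r = c i]).
  apply/seteqP; split=> xi /=; first by move=> <- i _ /=; rewrite ffunE.
  by move=> h; apply/ffunP => i; rewrite ffunE; exact: h.
apply: fin_bigcap_measurable; first exact: finite_finset.
move=> i _; rewrite -[X in measurable X]setTI.
apply: (measurableT_comp (f := fine)) => //; last exact: measurable_truncn.
by apply: measurable_evaluation; exact: mrho.
Qed.

End cells.

Section cell_laws.
Context {R : realType} {T : completeMetricType R} {I : finType}.
Variable rho : T -> I.
Hypothesis mrho : forall i, measurable (rho @^-1` [set i] : set (borel T)).
Variable lam : {finite_measure set (borel T) -> \bar R}.
Hypothesis lam_gt0 : 0 < mass lam.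
Variable m : nat.
Implicit Types (xi : config T) (s : seq T) (c : {ffun I -> nat}).

Definition intensity i : R := fine (lam (cell rho i)).
Local Notation l := intensity.

Lemma intensity_ge0 i : 0 <= l i. Proof. exact: fine_ge0. Qed.

Lemma intensityE i : (l i)%:E = lam (cell rho i).
Proof. by rewrite fineK// fin_num_measure//; exact: mrho. Qed.

Lemma measure_cells (J : pred I) :
  lam (rho @^-1` [set i | J i]) = (\sum_(i | J i) l i)%:E.
Proof.
pose r := [seq i <- index_enum I | J i].
have -> : rho @^-1` [set i | J i] = \bigcup_(i in [set` r]) cell rho i.
  apply/seteqP; split=> [a /= Ja|a [i /=]].
    by exists (rho a) => //=; rewrite mem_filter Ja mem_index_enum.
  by rewrite mem_filter => /andP[Ji _] ->.
rewrite measure_fin_bigcup//; last 2 first.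
- by apply/trivIsetP => i j _ _ ij; rewrite -subset0 => a [ai aj]; move: ij;
  rewrite -(ai : rho a = i) -(aj : rho a = j) eqxx.
- by move=> i _; exact: mrho.
rewrite -fsbig_seq ?filter_uniq ?index_enum_uniq// big_filter -sumEFin.
by apply: eq_bigr => i _; rewrite intensityE.
Qed.

Lemma total_intensity : total l = mass lam.
Proof.
rewrite /mass (_ : setT = rho @^-1` [set i | xpredT i]) ?measure_cells//.
by apply/seteqP.
Qed.

Let total_gt0 : 0 < total l. Proof. by rewrite total_intensity. Qed.

Let sum_count (s : seq T) (J : pred I) :
  (count (fun a => J (rho a)) s)%:R = \sum_i (cell_counts rho (conf_of s) i)%:R * (J i)%:R :> R.
Proof.
rewrite cell_counts_conf_of; elim: s => [|a s ih] /=.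
  by rewrite big1// => i _; rewrite ffunE mul0r.
rewrite natrD ih; under [RHS]eq_bigr do rewrite ffunE/= natrD mulrDl.
rewrite big_split/=; congr (_ + _).
  rewrite (bigD1 (rho a))//= eqxx mul1r big1 ?addr0// => i /negPf.
  by rewrite eq_sym => ->; rewrite mul0r.
by apply: eq_bigr => i _; rewrite ffunE.
Qed.

Lemma death_rate_conf_of s : death_rate m (conf_of s) = death m (tot (cell_counts rho (conf_of s))) :> R.
Proof. by rewrite /death_rate npoints_conf_of lte_fin ltr_nat tot_cell_counts. Qed.

Lemma jump_rate_conf_of s : jump_rate lam m (conf_of s) = rate l m (cell_counts rho (conf_of s)).
Proof. by rewrite /jump_rate death_rate_conf_of /rate total_intensity. Qed.

(** The jump law of a configuration sees the configuration only through its counts.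
For a birth in cell i the mass of the possible locations is l i; for a death the
number of the points whose removal leads to c' is counted cell by cell. *)
Lemma jump_law_conf_of s c' :
  jump_law lam m (conf_of s) (cell_counts rho @^-1` [set c']) =
  (jump_prob l m (cell_counts rho (conf_of s)) c')%:E.
Proof.
set c := cell_counts rho (conf_of s).
have q0 : 0 < rate l m c by exact: rate_gt0.
rewrite /jump_law jump_rate_conf_of -/c death_rate_conf_of -/c npoints_conf_of /=.
have -> : [set a | (cell_counts rho @^-1` [set c']) (add_point (conf_of s) a)] =
    rho @^-1` [set i | c' == up c i].
  by apply/seteqP; split=> a /=; rewrite -(cell_counts_cons rho a s); [move=> <- | move/eqP => ->].
rewrite measure_cells conf_ofE.
have -> : count_in [set a | exists2 zeta, (cell_counts rho @^-1` [set c']) zeta &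
    add_point zeta a = conf_of s] s = count (fun a => c' == dn c (rho a)) s.
  apply: eq_in_count => a sa; apply/idP/idP; rewrite in_setE.
    case=> zeta /= zc' E.
    have rE : conf_of s = conf_of (a :: rem a s) by apply: perm_conf_of; exact: perm_to_rem.
    have zE : zeta = conf_of (rem a s) by apply: (@add_point_inj _ _ a); rewrite E rE.
    by rewrite /c rE cell_counts_cons upK -zE zc'.
  move=> /eqP c'E; exists (conf_of (rem a s)) => /=; last first.
    by apply/esym; exact: (perm_conf_of (perm_to_rem sa)).
  by rewrite c'E /c (perm_conf_of (perm_to_rem sa)) cell_counts_cons upK.
rewrite (sum_count s (fun i => c' == dn c i)) -/c -!EFinM -EFinD; congr (_%:E).
rewrite /jump_prob big_sumType/=; congr (_ + _).
  rewrite mulrA [X in X * _]mulrAC divff ?gt_eqF// mul1r mulr_sumr big_mkcond/=.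
  by apply: eq_bigr => i _; case: ifP => _; rewrite ?mulr1 ?mulr0// mulrC.
rewrite tot_cell_counts /death; case: ifPn => [ms|_]; last first.
  by rewrite !mul0r big1// => i _; rewrite mul0r.
have s0 : (size s)%:R != 0 :> R by rewrite pnatr_eq0 -lt0n (leq_trans _ ms).
rewrite mulrA [X in X * _]mulrAC divff// mul1r mulr_sumr.
by apply: eq_bigr => i _; rewrite mulrA; congr (_ * _); rewrite mulrC.
Qed.

Definition finite_configs : set (config T) := [set xi | npoints xi < +oo]%E.

Lemma finite_conf_of s : finite_configs (conf_of s).
Proof. by rewrite /finite_configs /mkset npoints_conf_of ltry. Qed.

Lemma measurable_finite_configs : measurable finite_configs.
Proof.
have h : measurable_fun setT (fun xi : config T => xi setT).
  by apply: measurable_evaluation; exact: measurableT.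
have := emeasurable_fun_infty_o measurableT h +oo%E.
by rewrite setTI.
Qed.

Lemma jump_law_finite s : jump_law lam m (conf_of s) finite_configs = 1%E.
Proof.
rewrite /jump_law jump_rate_conf_of death_rate_conf_of npoints_conf_of /=.
set c := cell_counts rho (conf_of s).
have q0 : 0 < rate l m c by exact: rate_gt0.
have -> : [set a | finite_configs (add_point (conf_of s) a)] = setT.
  apply/seteqP; split=> // a _; exact: (finite_conf_of (a :: s)).
rewrite conf_ofE.
have -> : count_in [set a | exists2 zeta, finite_configs zeta &
    add_point zeta a = conf_of s] s = size s.
  apply/eqP; rewrite -all_count; apply/allP => a sa; rewrite in_setE.
  exists (conf_of (rem a s)); first exact: finite_conf_of.
  by apply/esym; exact: (perm_conf_of (perm_to_rem sa)).
rewrite -(@fineK _ (lam setT)) ?fin_num_measure// -/(mass lam) -!EFinM -EFinD; congr (_%:E).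
rewrite mulVf ?gt_eqF// mulr1 tot_cell_counts /death.
rewrite (_ : _ * (_ * _) = death m (tot c) / rate l m c); last first.
  rewrite tot_cell_counts /death; case: ifPn => [ms|_]; last by rewrite !mul0r.
  by rewrite mulVf ?mulr1// pnatr_eq0 -lt0n (leq_trans _ ms).
rewrite -mulrDl addrC -total_intensity -/(rate l m c) divff// gt_eqF//.
Qed.

End cell_laws.

(** * Cell counts of a realization *)

Section realization.
Context {R : realType} {T : completeMetricType R}.
Variable lam : {finite_measure set (borel T) -> \bar R}.
Hypothesis lam_gt0 : 0 < mass lam.
Variables (m : nat) (s0 : seq T).
Variable Z : immigration_death lam m (conf_of s0).
Local Notation P := (Z_prob Z).
Local Notation Y := (@Z_state _ _ _ _ _ Z).
Local Notation W := (@Z_wait _ _ _ _ _ Z).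
Local Notation X := (@Z_at _ _ _ _ _ Z).
Local Notation fin := (@finite_configs R T).

Lemma jump_rate_gt0 (eta : config T) : 0 < jump_rate lam m eta.
Proof.
rewrite /jump_rate ltr_wpDl// /death_rate; case: ifP => // _; exact: fine_ge0.
Qed.

Let mY n (B : set (config T)) : measurable B -> measurable (Y n @^-1` B).
Proof. by move=> mB; rewrite -[X in measurable X]setTI; exact: Z_state_measurable. Qed.

Lemma history_state n i (B : set (config T)) : (i <= n)%N -> measurable B ->
  history Y W n (Y i @^-1` B).
Proof.
by move=> lein mB; apply: sub_sigma_algebra; left; exists i => //; exists B.
Qed.

Lemma measurable_history n (A : set (Z_space Z)) : history Y W n A -> measurable A.
Proof.
apply: smallest_sub; first exact: sigma_algebra_measurable.
move=> C [[i _ [B mB ->]]|[i _ [S mS ->]]]; first exact: mY.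
by rewrite -[X in measurable X]setTI; exact: Z_wait_measurable.
Qed.

Lemma history_jump_time n (A : set R) : measurable A ->
  history Y W n (jump_time W n @^-1` A).
Proof.
move=> mA.
pose gen := [set C | (exists2 i, (i <= n)%N &
                 exists2 B : set (config T), measurable B & C = Y i @^-1` B) \/
               (exists2 i, (i < n)%N &
                 exists2 S : set R, measurable S & C = W i @^-1` S)].
pose Om := g_sigma_algebraType gen.
have mW i : (i < n)%N -> measurable_fun setT (W i : Om -> R).
  move=> lin _ S mS; rewrite setTI; apply: sub_sigma_algebra; right.
  by exists i => //; exists S.
have : measurable_fun setT (jump_time W n : Om -> R).
  by apply: measurable_sum => i; exact: mW.
by move/(_ measurableT A mA); rewrite setTI.
Qed.

Lemma history_setI n (A B : set (Z_space Z)) :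
  history Y W n A -> history Y W n B -> history Y W n (A `&` B).
Proof. exact: (@measurableI _ (g_sigma_algebraType _)). Qed.

(** A finite configuration jumps to finite configurations only. *)
Lemma Y_finite n : P (Y n @^-1` fin) = 1%E.
Proof.
have mF := @measurable_finite_configs R T.
elim: n => [|n ih].
  rewrite (_ : _ @^-1` _ = setT) ?probability_setT//.
  by apply/seteqP; split=> // w _ /=; rewrite Z_init; exact: finite_conf_of.
apply/eqP; rewrite eq_le probability_le1/=; last exact: mY.
have := Z_jump (history_state (leqnn n) mF) (@measurableT _ (R : measurableType _)) mF.
rewrite preimage_setT setIT (eq_integral (fun=> 1%E)); last first.
  move=> w; rewrite inE => /= /finite_config_seq[s ->].
  rewrite (@jump_law_finite _ _ unit (fun=> tt))//.
    by rewrite -(clockE (jump_rate_gt0 _)) probability_setT mule1.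
  by move=> i; rewrite (_ : _ @^-1` _ = setT)//; apply/seteqP; split => // x _; case: i.
rewrite integral_cst ?mul1e; last exact: mY.
move=> E; rewrite -(etrans E ih); apply: le_measure; rewrite ?inE; [|exact: mY|exact: subIsetr].
by apply: measurableI; exact: mY.
Qed.

Lemma Z_at_finite t : 0 <= t -> P (X t @^-1` fin) = 1%E.
Proof.
move=> t0; have mF := @measurable_finite_configs R T.
apply: (almost_sure_bigcap (F := fun n => Y n @^-1` fin)).
- by move=> n; exact: mY.
- exact: Y_finite.
- by rewrite -[S in measurable S]setTI; exact: Z_at_measurable.
- by move=> w Yw; have [n _ E] := Z_path w t0; rewrite /= E; exact: Yw.
Qed.

Section cells.
Context {I : finType} (rho : T -> I).
Hypothesis mrho : forall i, measurable (rho @^-1` [set i] : set (borel T)).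
Local Notation l := (intensity rho lam).

Let N n w := cell_counts rho (Y n w).
Let mN n (c : {ffun I -> nat}) : measurable (N n @^-1` [set c]).
Proof. by apply: (@mY n (cell_counts rho @^-1` [set c])); exact: measurable_cell_counts. Qed.

Let total_gt0 : 0 < total l. Proof. by rewrite total_intensity. Qed.

Let step n c c' (A B : set R) : measurable A -> measurable B ->
  (P ((N n @^-1` [set c] `&` N n.+1 @^-1` [set c']) `&` jump_time W n @^-1` A `&` W n @^-1` B) =
   (jump_prob l m c c')%:E * P (N n @^-1` [set c] `&` jump_time W n @^-1` A) *
   clock (rate_gt0 m total_gt0 c) B)%E.
Proof.
move=> mA mB; have mF := @measurable_finite_configs R T.
have mC c0 : measurable (cell_counts rho @^-1` [set c0]) by exact: measurable_cell_counts.
have mS : measurable (jump_time W n @^-1` A).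
  exact: (measurable_history (@history_jump_time n A mA)).
have mW : measurable (W n @^-1` B).
  by rewrite -[X in measurable X]setTI; exact: Z_wait_measurable.
pose H := Y n @^-1` (cell_counts rho @^-1` [set c]) `&` jump_time W n @^-1` A `&` Y n @^-1` fin.
have hH : history Y W n H.
  apply: history_setI; last exact: history_state.
  by apply: history_setI; [exact: history_state | exact: history_jump_time].
have mH := measurable_history hH.
rewrite -(setI_almost_sure _ (mY n mF) (Y_finite n)); last first.
  by apply: measurableI => //; apply: measurableI => //; apply: measurableI; exact: mN.
rewrite -(setI_almost_sure (measurableI _ _ (mN n c) mS) (mY n mF) (Y_finite n)).
have -> : N n @^-1` [set c] `&` N n.+1 @^-1` [set c'] `&` jump_time W n @^-1` A `&`
    W n @^-1` B `&` Y n @^-1` fin =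
    H `&` W n @^-1` B `&` Y n.+1 @^-1` (cell_counts rho @^-1` [set c']).
  by apply/seteqP; split => w; rewrite /H /N /=; tauto.
rewrite Z_jump// (eq_integral (fun=> ((jump_prob l m c c')%:E * clock (rate_gt0 m total_gt0 c) B)%E)); last first.
  move=> w; rewrite inE => -[[/= <- _] /finite_config_seq[s ->]].
  rewrite (jump_law_conf_of mrho)// (jump_rate_conf_of mrho)// muleC.
  by [].
rewrite integral_cst// -/N -/H muleAC; congr (_ * _)%E.
Qed.

(** The cell counts of the embedded chain satisfy the hypotheses of
[path_expectation]: the history contains the current counts and jump time, and the
jump law depends on the current configuration through its counts. *)
Lemma expectation_cells (g : {ffun I -> nat} -> R) t : (forall c, 0 <= g c <= 1) -> 0 <= t ->
  (\int[P]_w (g (cell_counts rho (X t w)))%:E =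
   (semigroup l m g t (cell_counts rho (conf_of s0)))%:E)%E.
Proof.
move=> g01 t0.
have mNt c : measurable ((fun w => cell_counts rho (X t w)) @^-1` [set c]).
  have mC : measurable (cell_counts rho @^-1` [set c]) by exact: measurable_cell_counts.
  by have := @Z_at_measurable _ _ _ _ _ Z t measurableT _ mC; rewrite setTI.
apply: (@path_expectation R I l m (@intensity_ge0 _ _ _ rho lam) total_gt0 g g01 _ _ P N W
  mN (@Z_wait_measurable _ _ _ _ _ Z) (@Z_wait_gt0 _ _ _ _ _ Z) step t t0 _
  (fun w => cell_counts rho (X t w)) _ mNt) => w.
- by rewrite /N Z_init.
- by have [n nt E] := Z_path w t0; exists n => //; rewrite /N E.
Qed.

End cells.
End realization.

(** * Discretized test functions *)

Section almost_sure_limits.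
Context {d} {Om : measurableType d} {R : realType} (P : probability Om R).

(** Dominated convergence for a limit u that is measurable only after multiplication by
the indicator of F. *)
Lemma cvg_expectation (F : set Om) (u_ : nat -> Om -> R) (u : Om -> R) :
  measurable F -> P F = 1%E -> (forall n, measurable_fun setT (u_ n)) ->
  (forall n w, 0 <= u_ n w <= 1) -> (forall w, 0 <= u w <= 1) ->
  (forall w, F w -> u_ n w @[n --> \oo] --> u w) ->
  (\int[P]_w (u_ n w)%:E @[n --> \oo] --> \int[P]_w (u w)%:E)%E.
Proof.
move=> mF F1 mu_ u_01 u01 cvu.
have P0 := null_setC mF F1.
have m1F : measurable_fun setT (\1_F : Om -> R) by exact: measurable_indic.
have cut01 (g : Om -> R) w : 0 <= g w <= 1 -> 0 <= g w * \1_F w <= 1.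
  by rewrite indicE; case: (w \in F); rewrite ?mulr1 ?mulr0 ?lexx ?ler01.
have cvcut w : (u_ n w * \1_F w) @[n --> \oo] --> u w * \1_F w.
  rewrite indicE; have [Fw|Fw] := pselect (F w).
    by apply: cvgMl; exact: cvu.
  by rewrite memNset// mulr0; under eq_fun do rewrite mulr0; exact: cvg_cst.
have mcut n : measurable_fun setT (fun w => u_ n w * \1_F w).
  exact: measurable_funM.
have mcutu : measurable_fun setT (fun w => u w * \1_F w).
  by apply: (measurable_fun_cvg mcut) => w _; exact: cvcut.
have cutE (g : Om -> R) : (forall w, 0 <= g w <= 1) -> measurable_fun setT (fun w => g w * \1_F w) ->
    (\int[P]_w (g w)%:E = \int[P]_w (g w * \1_F w)%:E)%E.
  move=> g01 mg; apply: (ge0_integral_off_null (mu := P) (N := ~` F)) => //.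
  - by move=> w; exact: cut01.
  - exact: measurableC.
  - by move=> w /contrapT Fw; rewrite indicE mem_set// mulr1.
rewrite cutE//; under eq_fun do rewrite cutE//.
apply: (@cvg_integral_dominated _ _ _ P setT _ _ (fun=> 1)) => //.
- exact: finite_measure_integrable_cst.
- by move=> n w _; case/andP: (cut01 _ w (u_01 n w)) => ? ?; rewrite ger0_norm.
Qed.

End almost_sure_limits.

Section discretized_functions.
Context {R : realType} {T : completeMetricType R} {I : finType} (z : I -> T).
Variable f : config T -> R.
Hypothesis Ff : Fdbar f.
Hypothesis d_le1 : forall x y : T, mdist x y <= 1.
Implicit Types (c : {ffun I -> nat}) (s : seq T).

Definition points c : seq T := flatten [seq nseq (c i) (z i) | i <- enum I].

Lemma count_points (p : pred T) c : count p (points c) = (\sum_i c i * p (z i))%N.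
Proof.
rewrite /points count_flatten -map_comp sumnE big_map big_enum/=.
by apply: eq_bigr => i _; rewrite count_nseq mulnC.
Qed.

Lemma size_points c : size (points c) = tot c.
Proof.
by rewrite -count_predT count_points; apply: eq_bigr => i _; rewrite muln1.
Qed.

Lemma points_up c i : perm_eq (points (up c i)) (z i :: points c).
Proof.
apply/seq.permP => p; rewrite /= !count_points (bigD1 i)//= [in RHS](bigD1 i)//=.
rewrite ffunE eqxx mulnDl mul1n addnA [(c i * _ + _)%N]addnC; congr addn.
by apply: eq_bigr => j /negPf ji; rewrite ffunE ji addn0.
Qed.

Lemma points_cell_counts (rho : T -> I) s :
  perm_eq (points (cell_counts rho (conf_of s))) [seq z (rho a) | a <- s].
Proof.
elim: s => [|a s ih].
  apply/seq.permP => p; rewrite count_points cell_counts_conf_of big1// => i _.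
  by rewrite ffunE.
rewrite cell_counts_cons (permPl (points_up _ _))/= perm_cons; exact: ih.
Qed.

(** The test function at the configuration with all the points moved to the centres z of
their cells. *)
Definition discretize c : R := f (conf_of (points c)).

Lemma discretize01 c : 0 <= discretize c <= 1. Proof. exact: Fdbar01. Qed.

Lemma discretize_up c i : `|discretize (up c i) - discretize c| <= (tot c).+1%:R^-1.
Proof.
rewrite /discretize (perm_conf_of (points_up c i)) -size_points.
exact: Fdbar_add_point.
Qed.

(** The shared points are matched with themselves, so that the distance is at most 1
divided by the number of points. *)
Lemma discretize_swap c i j :
  `|discretize (up c i) - discretize (up c j)| <= (tot c).+1%:R^-1.
Proof.
rewrite /discretize !(perm_conf_of (points_up _ _)) -size_points.
pose r := None :: map Some (points c).
have E k : z k :: points c = map (odflt (z k)) r.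
  by rewrite /r /= -map_comp map_id_in.
rewrite !E; apply: (le_trans (Fdbar_map Ff r _ _)).
rewrite /= size_map ler_piMr// ?invr_ge0// big_cons big_map big1 ?addr0//.
by move=> a _; rewrite mdistxx.
Qed.

End discretized_functions.

Section discretization_limit.
Context {R : realType} {T : completeMetricType R}.
Variable f : config T -> R.
Hypothesis Ff : Fdbar f.
Variable x : nat -> T.
Hypothesis x_dense : forall a (e : R), 0 < e -> exists j, mdist a (x j) < e.
Implicit Types (s : seq T) (a : T).

Definition nearest_cell (K : nat) a : 'I_K.+1 := inord (nearest x K a).

Lemma nearest_cellE K a : nearest_cell K a = nearest x K a :> nat.
Proof. by rewrite inordK// ltnS nearest_le. Qed.

Lemma measurable_nearest_cell K i : measurable (nearest_cell K @^-1` [set i] : set (borel T)).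
Proof.
rewrite (_ : _ @^-1` _ = nearest x K @^-1` [set val i]); first exact: measurable_nearest.
apply/seteqP; split=> a /=; rewrite -nearest_cellE; first by move=> ->.
by move/val_inj.
Qed.

Definition discretization (K : nat) (xi : config T) : R :=
  discretize (fun i : 'I_K.+1 => x i) f (cell_counts (nearest_cell K) xi).

Lemma cvg_discretize s : discretization K (conf_of s) @[K --> \oo] --> f (conf_of s).
Proof.
have near a : mdist (x (nearest x K a)) a @[K --> \oo] --> (0 : R).
  apply/cvgrPdist_lt => e e0; have [j aj] := x_dense a e0.
  exists j => // K /= jK; rewrite sub0r normrN ger0_norm ?mdist_ge0// metric_sym.
  exact: (le_lt_trans (nearest_min _ _ jK)).
pose err K := (size s)%:R^-1 * \sum_(a <- s) mdist (x (nearest x K a)) a.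
have err0 : err K @[K --> \oo] --> (0 : R).
  rewrite -[X in _ --> X](mulr0 ((size s)%:R^-1)); apply: cvgMr.
  have : \sum_(a <- s) mdist (x (nearest x K a)) a @[K --> \oo] --> \sum_(a <- s) (0 : R).
    by apply: cvg_rsum => a; exact: near.
  by rewrite big1.
apply/cvgrPdist_lt => e e0.
move/cvgrPdist_lt : err0 => /(_ e e0) [K0 _ h].
exists K0 => // K /= K0K; have {h} := h K K0K; rewrite sub0r normrN => h.
apply: (le_lt_trans _ h); rewrite distrC.
rewrite /discretization /discretize (perm_conf_of (points_cell_counts _ _ _)).
rewrite -[in X in _ - X](map_id s); apply: (le_trans (Fdbar_map Ff s _ _)).
apply: le_trans (ler_norm _); rewrite /err le_eqVlt; apply/orP; left; apply/eqP.
by congr (_ * _); apply: eq_bigr => a _; rewrite nearest_cellE.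
Qed.

End discretization_limit.

(** * The Poisson law of the cell counts *)

Section poisson.
Context {R : realType} {T : completeMetricType R}.
Variable lam : {finite_measure set (borel T) -> \bar R}.
Hypothesis lam_gt0 : 0 < mass lam.
Variable Pi : probability (config T) R.
Hypothesis Pi_poisson : poisson_process lam Pi.
Local Notation fin := (@finite_configs R T).

Lemma poisson_weightS (r : R) k :
  k.+1%:R * poisson_weight r k.+1 = r * poisson_weight r k.
Proof.
rewrite /poisson_weight factS natrM exprS; field.
by rewrite nat1r !pnatr_eq0 -lt0n fact_gt0.
Qed.

Lemma sum_poisson_weight (r : R) : 0 <= r ->
  (\sum_(0 <= k <oo) (poisson_weight r k)%:E = 1)%E.
Proof.
move=> r0.
have h : (\sum_(0 <= k < n) poisson_weight r k) @[n --> \oo] --> (1 : R).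
  have -> : (fun n => \sum_(0 <= k < n) poisson_weight r k) =
      (fun n => series (exp_coeff r) n * expR (- r)).
    by apply/funext => n; rewrite /series/= mulr_suml.
  rewrite -(expRxMexpNx_1 r); apply: cvgMl.
  exact: is_cvg_series_exp_coeff.
apply: cvg_lim => //.
have -> : (fun n => \sum_(0 <= k < n) (poisson_weight r k)%:E)%E =
    (fun n => (\sum_(0 <= k < n) poisson_weight r k)%:E).
  by apply/funext => n; rewrite sumEFin.
by apply: cvg_EFin => //; exact: nearW.
Qed.

Let with_points k : set (config T) := [set xi | npoints xi = k%:R%:E].

Let measurable_with_points k : measurable (with_points k).
Proof.
have h : measurable_fun setT (fun xi : config T => xi setT).
  by apply: measurable_evaluation; exact: measurableT.
by have := h measurableT [set k%:R%:E] (emeasurable_set1 _); rewrite setTI.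
Qed.

Lemma Pi_with_points k : Pi (with_points k) = (poisson_weight (mass lam) k)%:E.
Proof.
have := @Pi_poisson 1%N (fun=> setT) (fun=> k) (fun=> measurableT).
rewrite big_ord1 -/(mass lam) => <-; last first.
  by apply/trivIsetP => i j _ _; rewrite !ord1 eqxx.
congr (Pi _); apply/seteqP; split=> xi /=; first by move=> h i.
exact: (fun h => h ord0).
Qed.

(** The Poisson weights of the total number of points sum to 1. *)
Lemma Pi_finite : Pi fin = 1%E.
Proof.
apply/eqP; rewrite eq_le probability_le1/=; last exact: measurable_finite_configs.
rewrite -(sum_poisson_weight (ltW lam_gt0)).
rewrite (eq_eseriesr (g := fun k => Pi (with_points k))); last by move=> k _; rewrite Pi_with_points.
have := measure_bigcup Pi setT with_points (fun k _ => measurable_with_points k) _.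
rewrite -/(Pi _).
have tI : trivIset setT with_points.
  apply/trivIsetP => i j _ _ ij; rewrite -subset0 => xi [wi wj]; move: ij.
  have := (wi : npoints xi = _); rewrite (wj : npoints xi = _) => -[/eqP].
  by rewrite eqr_nat eq_sym => ->.
move=> /(_ tI); under eq_eseriesl do rewrite in_setT.
move=> <-; apply: le_measure; rewrite ?inE.
- exact: bigcupT_measurable.
- exact: measurable_finite_configs.
- by move=> xi [k _]; rewrite /with_points /finite_configs /= => ->; rewrite ltry.
Qed.

Section cells.
Context {n : nat} (rho : T -> 'I_n).
Hypothesis mrho : forall i, measurable (rho @^-1` [set i] : set (borel T)).
Local Notation l := (intensity rho lam).
Implicit Types (c : {ffun 'I_n -> nat}).

(** The definition of a Poisson process is applied to the cells.  The event in it and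
the level set of the counts agree on finite configurations. *)
Lemma Pi_cell_counts c : Pi (cell_counts rho @^-1` [set c]) = (\prod_(i < n) poisson_weight (l i) (c i))%:E.
Proof.
have mE : measurable [set xi : config T | forall i, xi (cell rho i) = (c i)%:R%:E].
  have -> : [set xi : config T | forall i, xi (cell rho i) = (c i)%:R%:E] =
    \bigcap_(i in [set: 'I_n]) ((fun xi : config T => xi (cell rho i)) @^-1` [set (c i)%:R%:E]).
    apply/seteqP; split=> xi /= h i; first by move=> _; exact: h.
    exact: (h i).
  apply: fin_bigcap_measurable; first exact: finite_finset.
  move=> i _; have h := measurable_evaluation (mrho i).
  by have := h measurableT [set (c i)%:R%:E] (emeasurable_set1 _); rewrite setTI.
rewrite -(Pi_poisson (B := cell rho)); last 2 first.
- by move=> i; exact: mrho.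
- apply/trivIsetP => i j _ _ ij; rewrite -subset0 => a [ai aj]; move: ij.
  by rewrite -(ai : rho a = i) -(aj : rho a = j) eqxx.
have mF := @measurable_finite_configs R T.
rewrite -(setI_almost_sure _ mF Pi_finite); last exact: measurable_cell_counts.
rewrite -(setI_almost_sure mE mF Pi_finite).
congr (Pi _); apply/seteqP; split=> xi [/= h /finite_config_seq[s E]]; split; rewrite ?E; try exact: finite_conf_of.
  move=> i; rewrite -h E conf_ofE cell_counts_conf_of ffunE /count_in; congr (_%:R%:E).
  by apply: eq_count => a; apply/idP/eqP; rewrite in_setE.
by apply/ffunP => i; rewrite ffunE -E h /= natrK.
Qed.

Lemma Pi_reversible c i :
  ((l i)%:E * Pi (cell_counts rho @^-1` [set c]) =
   (c i).+1%:R%:E * Pi (cell_counts rho @^-1` [set (up c i)]))%E.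
Proof.
rewrite !Pi_cell_counts -!EFinM; congr (_%:E).
have upE : up c i i = (c i).+1 by rewrite ffunE eqxx addn1.
rewrite (bigD1 i)//= [in RHS](bigD1 i)//= [LHS]mulrA [RHS]mulrA upE poisson_weightS.
by congr (_ * _); apply: eq_bigr => j /negPf ji; rewrite ffunE ji addn0.
Qed.

End cells.

Variable m : nat.
Definition at_least : set (config T) := [set xi | (m%:R%:E <= npoints xi)%E].

Lemma measurable_at_least : measurable at_least.
Proof.
have h : measurable_fun setT (fun xi : config T => xi setT).
  by apply: measurable_evaluation; exact: measurableT.
by have := emeasurable_fun_c_infty measurableT h m%:R%:E; rewrite setTI.
Qed.

Lemma Pi_at_least_gt0 : 0 < fine (Pi at_least).
Proof.
apply: (@lt_le_trans _ _ (fine (Pi (with_points m)))).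
  by rewrite Pi_with_points /= mulr_gt0 ?expR_gt0// divr_gt0 ?exprn_gt0// ltr0n fact_gt0.
apply: fine_le; [exact: fin_num_measure | apply: fin_num_measure; exact: measurable_at_least |].
apply: le_measure; rewrite ?inE => //; first exact: measurable_at_least.
by move=> xi; rewrite /with_points /at_least /= => ->.
Qed.

Lemma prob_above_cells {n} (rho : T -> 'I_n) :
  (forall i, measurable (rho @^-1` [set i] : set (borel T))) ->
  prob_above m Pi (cell_counts rho) = fine (Pi at_least).
Proof.
move=> mrho; rewrite /prob_above /mean; congr fine.
rewrite (ge0_integral_off_null (mu := Pi) (g := \1_at_least) (N := ~` fin))//.
- by rewrite integral_indic ?setIT//; exact: measurable_at_least.
- by move=> xi; rewrite /above; case: (m <= _)%N; rewrite ?lexx ?ler01.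
- by move=> xi; rewrite indicE; case: (_ \in _); rewrite ?lexx ?ler01.
- by apply: measurable_indic; exact: measurable_at_least.
- by apply: measurableC; exact: measurable_finite_configs.
- by apply: null_setC; [exact: measurable_finite_configs | exact: Pi_finite].
- move=> xi /contrapT /finite_config_seq[s ->]; rewrite /above tot_cell_counts indicE; congr (nat_of_bool _)%:R.
  by apply/idP/idP; rewrite in_setE /at_least /= npoints_conf_of lee_fin ler_nat.
Qed.

Lemma cvg_conditional_mean (f : config T -> R) (x : nat -> T) : Fdbar f ->
  (forall a (e : R), 0 < e -> exists j, mdist a (x j) < e) ->
  (fine (Pi at_least))^-1 *
    fine (mean Pi (cell_counts (nearest_cell x K))
      (fun c => above m c * discretize (fun i : 'I_K.+1 => x i) f c)) @[K --> \oo]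
  --> fine (conditional_mean Pi m f) /\
  conditional_mean Pi m f \is a fin_num.
Proof.
move=> Ff xd; have f01 xi : 0 <= f xi <= 1 by exact: Fdbar01.
have [mF mA] := (@measurable_finite_configs R T, measurable_at_least).
pose u xi := \1_at_least xi * f xi.
pose u_ K xi := above m (cell_counts (nearest_cell x K) xi) * discretization f x K xi.
have mul01 (b : bool) (y : R) : 0 <= y <= 1 -> 0 <= b%:R * y <= 1.
  by case: b; rewrite ?mul1r ?mul0r ?lexx ?ler01.
have u01 xi : 0 <= u xi <= 1 by rewrite /u indicE; exact: mul01.
have u_01 K xi : 0 <= u_ K xi <= 1.
  by rewrite /u_ /above; apply: mul01; exact: discretize01.
have mu_ K : measurable_fun setT (u_ K).
  have mN c : measurable (cell_counts (nearest_cell x K) @^-1` [set c]).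
    by apply: measurable_cell_counts; exact: measurable_nearest_cell.
  exact: (measurable_count mN (fun c => above m c * discretize (fun i : 'I_K.+1 => x i) f c)).
have cvu : (\int[Pi]_xi (u_ K xi)%:E @[K --> \oo] --> \int[Pi]_xi (u xi)%:E)%E.
  apply: (cvg_expectation mF Pi_finite) => // xi /finite_config_seq[s ->].
  rewrite /u_ /u indicE; under eq_fun do rewrite /above tot_cell_counts.
  rewrite (_ : (conf_of s \in at_least) = (m <= size s)%N).
    by apply: cvgMr; exact: cvg_discretize.
  by apply/idP/idP; rewrite in_setE /at_least /= npoints_conf_of lee_fin ler_nat.
have Eu : conditional_mean Pi m f = ((fine (Pi at_least))^-1%:E * \int[Pi]_xi (u xi)%:E)%E.
  rewrite /conditional_mean -/at_least; congr (_ * _)%E.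
  rewrite integral_mkcond; apply: eq_integral => xi _.
  by rewrite patchE /u indicE; case: (xi \in at_least); rewrite ?mul1r ?mul0r.
have fin_int (g : config T -> R) : (forall xi, 0 <= g xi <= 1) -> (\int[Pi]_xi (g xi)%:E)%E \is a fin_num.
  move=> g01; rewrite ge0_fin_numE; last first.
    by apply: integral_ge0 => xi _; rewrite lee_fin; case/andP: (g01 xi).
  apply: (@le_lt_trans _ _ (\int[Pi]_xi (cst 1%E xi))%E).
    apply: ge0_le_integral_nonmeasurable => xi; rewrite lee_fin; by case/andP: (g01 xi).
  by rewrite integral_cst//= mul1e probability_setT ltry.
split; last by rewrite Eu fin_numM//; exact: fin_int.
rewrite Eu fineM ?fin_int//=; apply: cvgMr.
by apply: fine_cvg; rewrite fineK ?fin_int.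
Qed.
End poisson.

(** * Differences of the Stein solution *)

Section half_line.
Context {R : realType}.
Local Notation mu := (@lebesgue_measure R).
Local Notation half := (`[0%R, +oo[%classic : set R).

Lemma integrable_exp_decay (C k : R) : 0 < k ->
  mu.-integrable half (EFin \o (fun t => C * expR (- k * t))).
Proof.
move=> k0; have h := integrable_exponential_pdf k0.
have {}h : mu.-integrable half (EFin \o exponential_pdf k).
  by apply: (integrableS measurableT) h.
have hZ := fun mH => integrableZl mH (C / k) h.
have := hZ (measurable_itv _).
apply: eq_integrable => // t; rewrite inE/= in_itv/= andbT => t0.
rewrite exponential_pdfE// -EFinM; congr (_%:E); field; exact: lt0r_neq0.
Qed.

(** Bounds on the integrals over bounded intervals suffice, by dominated
convergence. *)
Lemma integral_half_line_bound (h : R -> R) (B : R) :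
  mu.-integrable half (EFin \o h) ->
  (forall n : nat, `|\int[mu]_(t in `[0%R, n%:R]) (h t)%:E| <= B%:E)%E ->
  (`|\int[mu]_(t in half) (h t)%:E| <= B%:E)%E.
Proof.
move=> ih hB; have mh : measurable_fun half h.
  by apply/measurable_EFinP; exact: measurable_int ih.
have sub n : (`[0%R, n%:R]%classic : set R) `<=` half.
  by move=> t /=; rewrite !in_itv/= andbT => /andP[].
have cv : (\int[mu]_(t in half) (h t * \1_`[0%R, n%:R] t)%:E @[n --> \oo] -->
    \int[mu]_(t in half) (h t)%:E)%E.
  apply: (@cvg_integral_dominated _ _ _ mu half _ _ (fun t => `|h t|)) => //.
  - by move=> n; apply: measurable_funM => //; exact: measurable_indic.
  - move=> t /=; rewrite in_itv/= andbT => t0; apply: cvg_near_cst.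
    exists (Num.truncn t).+1 => // n /= tn; rewrite indicE mem_set ?mulr1//=.
    by rewrite in_itv/= t0 (le_trans (ltW (truncnS_gt t)))// ler_nat.
  - exact: (integrable_abse ih).
  - by move=> n t _; rewrite normrM ler_piMr// indicE; case: (_ \in _); rewrite ?normr1 ?normr0.
apply: (cvge_le _ (cvg_abse cv)); apply: nearW => n.
apply: le_trans (hB n); rewrite le_eqVlt; apply/orP; left; apply/eqP; congr (`|_|)%E.
rewrite -[in RHS](setIidr (sub n)) [RHS]integral_mkcondr.
apply: eq_integral => t _; rewrite patchE indicE.
by case: (_ \in _); rewrite ?mulr1 ?mulr0.
Qed.

End half_line.

Section stein.
Context {R : realType} {T : completeMetricType R}.
Hypothesis d_le1 : forall x y : T, mdist x y <= 1.
Variable lam : {finite_measure set (borel T) -> \bar R}.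
Hypothesis lam_gt0 : 0 < mass lam.
Variable Pi : probability (config T) R.
Hypothesis Pi_poisson : poisson_process lam Pi.
Variables (m : nat) (m_gt0 : (0 < m)%N).
Variable f : config T -> R.
Hypothesis Ff : Fdbar f.
Variable x : nat -> T.
Hypothesis x_dense : forall a (e : R), 0 < e -> exists j, mdist a (x j) < e.
Local Notation mu := (@lebesgue_measure R).
Local Notation half := (`[0%R, +oo[%classic : set R).
Implicit Types (s : seq T).

Let l (K : nat) : 'I_K.+1 -> R := intensity (nearest_cell x K) lam.
Let F (K : nat) : {ffun 'I_K.+1 -> nat} -> R := discretize (fun i : 'I_K.+1 => x i) f.
Let count (K : nat) s : {ffun 'I_K.+1 -> nat} := cell_counts (nearest_cell x K) (conf_of s).
Arguments l : clear implicits.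
Arguments F : clear implicits.
Arguments count : clear implicits.
Let G K s (t : R) := semigroup (l K) m (F K) t (count K s).

Let l_ge0 K i : 0 <= l K i. Proof. exact: intensity_ge0. Qed.
Let totalE K : total (l K) = mass lam.
Proof. by apply: total_intensity; exact: measurable_nearest_cell. Qed.
Let total_gt0 K : 0 < total (l K). Proof. by rewrite totalE. Qed.
Let F01 K c : 0 <= F K c <= 1. Proof. exact: discretize01. Qed.
Let F_up K := discretize_up (fun i : 'I_K.+1 => x i) Ff.
Let F_swap K := discretize_swap (fun i : 'I_K.+1 => x i) Ff d_le1.
Let G01 K s t : 0 <= G K s t <= 1. Proof. exact: semigroup01. Qed.
Let cG K s : continuous (G K s).
Proof. exact: continuous_semigroup. Qed.

Local Notation X Z := (@Z_at _ _ _ _ _ Z).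

Let A s (Z : immigration_death lam m (conf_of s)) (t : R) : R :=
  fine (\int[Z_prob Z]_w (f (X Z t w))%:E)%E.

Let integral01 {d} {Om : measurableType d} (P : probability Om R) (g : Om -> R) :
  (forall w, 0 <= g w <= 1) -> (0 <= \int[P]_w (g w)%:E <= 1)%E.
Proof.
move=> g01; apply/andP; split.
  by apply: integral_ge0 => w _; rewrite lee_fin; case/andP: (g01 w).
apply: (@le_trans _ _ (\int[P]_w (cst 1%E w))%E).
  by apply: ge0_le_integral_nonmeasurable => w; rewrite lee_fin; case/andP: (g01 w).
by rewrite integral_cst//= mul1e probability_setT.
Qed.

Let AE s (Z : immigration_death lam m (conf_of s)) t :
  (\int[Z_prob Z]_w (f (X Z t w))%:E = (A Z t)%:E)%E.
Proof.
have /andP[h0 h1] := integral01 (Z_prob Z) (fun w => Fdbar01 Ff (X Z t w)).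
by rewrite fineK// ge0_fin_numE// (le_lt_trans h1)// ltry.
Qed.

Let cvgG s (Z : immigration_death lam m (conf_of s)) t : 0 <= t ->
  G K s t @[K --> \oo] --> A Z t.
Proof.
move=> t0; have mF := @measurable_finite_configs R T.
have mX : measurable (X Z t @^-1` @finite_configs R T).
  by rewrite -[S in measurable S]setTI; exact: Z_at_measurable.
have := @cvg_expectation _ _ _ (Z_prob Z) (X Z t @^-1` @finite_configs R T)
  (fun K w => discretization f x K (X Z t w)) (fun w => f (X Z t w)) mX (Z_at_finite lam_gt0 Z t0).
rewrite AE => h.
have {}h : (\int[Z_prob Z]_w (discretization f x K (X Z t w))%:E @[K --> \oo] --> (A Z t)%:E)%E.
  apply: h.
  - move=> K; have mC c : measurable ((fun w => cell_counts (nearest_cell x K) (X Z t w)) @^-1` [set c]).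
      have mc : measurable (cell_counts (nearest_cell x K) @^-1` [set c]).
        by apply: measurable_cell_counts; exact: measurable_nearest_cell.
      by have := @Z_at_measurable _ _ _ _ _ Z t measurableT _ mc; rewrite setTI.
    exact: (measurable_count mC (F K)).
  - by move=> K w; exact: F01.
  - by move=> w; exact: Fdbar01.
  - by move=> w /finite_config_seq[s' ->]; exact: cvg_discretize.
have E K : (\int[Z_prob Z]_w (discretization f x K (X Z t w))%:E = (G K s t)%:E)%E.
  have := @expectation_cells _ _ _ lam_gt0 _ _ Z _ (nearest_cell x K) (@measurable_nearest_cell _ _ x K) (F K) t (@F01 K) t0.
  by [].
by move: h; under eq_fun do rewrite E; move/fine_cvg.
Qed.

Let stat : R := fine (conditional_mean Pi m f).
Let rate : R := Num.min (mass lam) 1 / m.+2%:R.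
Let C s : R := ((size s)%:R + m%:R + mass lam) * m.+2%:R.

Let A_near s (Z : immigration_death lam m (conf_of s)) t : (m <= size s)%N -> 0 <= t ->
  `|A Z t - stat| <= C s * expR (- rate * t).
Proof.
move=> ms t0.
have [cv _] := cvg_conditional_mean lam_gt0 Pi_poisson m Ff x_dense.
pose statK K := (fine (Pi (at_least m)))^-1 *
  fine (mean Pi (cell_counts (nearest_cell x K)) (fun c => above m c * F K c)).
have cvN : `|G K s t - statK K| @[K --> \oo] --> `|A Z t - stat|.
  by apply: cvg_norm; apply: cvgB => //; exact: cvgG.
rewrite -(cvg_lim (@Rhausdorff R) cvN).
apply: limr_le; first exact: cvgP cvN.
apply: nearW => K /=.
have mrho := @measurable_nearest_cell _ _ x K.
have pE := prob_above_cells lam_gt0 Pi_poisson m mrho.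
have p0 : 0 < prob_above m Pi (cell_counts (nearest_cell x K)).
  by rewrite pE; apply: Pi_at_least_gt0; eassumption.
have ms' : (m <= tot (count K s))%N by rewrite tot_cell_counts.
have := semigroup_cvg_mean (@l_ge0 K) (@total_gt0 K) m_gt0 (@F01 K) (@F_up K) (@F_swap K)
  (measurable_cell_counts mrho) (Pi_reversible lam_gt0 Pi_poisson mrho) p0 t0 ms'.
by rewrite pE /relaxation totalE tot_cell_counts -/rate mulrA.
Qed.

Let rate_gt0 : 0 < rate. Proof. by rewrite divr_gt0// lt_min lam_gt0 ltr01. Qed.

Let mA s (Z : immigration_death lam m (conf_of s)) (D : set R) :
  D `<=` half -> measurable D -> measurable_fun D (A Z).
Proof.
move=> Dh mD; apply: (@measurable_fun_cvg _ _ _ D (fun K => G K s)).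
  by move=> K; apply: measurable_funTS; exact: continuous_measurable_fun.
by move=> t /Dh; rewrite /= in_itv/= andbT => t0; exact: cvgG.
Qed.

Let integrable_excess s (Z : immigration_death lam m (conf_of s)) : (m <= size s)%N ->
  mu.-integrable half (EFin \o (fun t => A Z t - stat)).
Proof.
move=> ms; have hC := integrable_exp_decay (C s) rate_gt0.
apply: le_integrable hC => //.
- apply/measurable_EFinP; apply: measurable_funB; last exact: measurable_cst.
  exact: mA.
- move=> t; rewrite /= in_itv/= andbT => t0; rewrite lee_fin.
  by rewrite (le_trans (A_near Z ms t0))// ler_norm.
Qed.

Let stein_solutionE s (Z : immigration_death lam m (conf_of s)) :
  stein_solution Pi f Z = (- \int[mu]_(t in half) (A Z t - stat)%:E)%E.
Proof.
rewrite /stein_solution; congr (- _)%E; apply: eq_integral => t _.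
have [_ fc] := cvg_conditional_mean lam_gt0 Pi_poisson m Ff x_dense.
rewrite AE EFinB.
have -> : stat%:E = conditional_mean Pi m f by rewrite /stat fineK.
by [].
Qed.

Let contrast_integral s a (Z : immigration_death lam m (conf_of s))
    (Z' : immigration_death lam m (conf_of (a :: s))) (phi : nat -> R) (t : R) :
  barrier (mass lam) m phi -> (m <= size s)%N -> 0 <= t ->
  (`|\int[mu]_(v in `[0%R, t]) ((A Z' v - stat) - (A Z v - stat))%:E| <= (phi (size s).+1)%:E)%E.
Proof.
move=> bphi ms t0.
have Dh : (`[0%R, t]%classic : set R) `<=` half.
  by move=> v /=; rewrite !in_itv/= andbT => /andP[].
have cv : (\int[mu]_(v in `[0%R, t]) (G K (a :: s) v - G K s v)%:E @[K --> \oo] -->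
    \int[mu]_(v in `[0%R, t]) ((A Z' v - stat) - (A Z v - stat))%:E)%E.
  apply: (@cvg_integral_dominated _ _ _ mu `[0%R, t]%classic _ _ (fun=> 1)) => //.
  - move=> K; apply: measurable_funTS; apply: continuous_measurable_fun => v.
    by apply: cvgB; exact: cG.
  - by apply: measurable_funB; apply: measurable_funB => //; exact: mA.
  - move=> v /Dh; rewrite /= in_itv/= andbT => v0.
    rewrite (_ : _ - _ = A Z' v - A Z v); last by ring.
    by apply: cvgB; exact: cvgG.
  - apply: (@continuous_itv_integrable _ (fun=> 1)) => v; exact: cvg_cst.
  - move=> K v _; rewrite ler_norml.
    have /andP[? ?] := G01 K s v; have /andP[? ?] := G01 K (a :: s) v; lra.
apply: (cvge_le _ (cvg_abse cv)); apply: nearW => K.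
rewrite integralB_EFin//; try exact: continuous_itv_integrable.
rewrite !prim_integral// -EFinB lee_fin /G /count cell_counts_cons.
have := occupation_contrast (@l_ge0 K) (@total_gt0 K) m_gt0 (@F01 K) (@F_up K) (@F_swap K)
  (nearest_cell x K a) _ t0 _.
rewrite totalE => /(_ phi (count K s) bphi); rewrite tot_cell_counts; exact.
Qed.

(** The constant [stat] cancels in the difference, the integral over [0, n] is the limit
of the differences of occupations of the discretized chains, and n tends to
infinity thanks to the exponential convergence. *)
Lemma stein_contrast s a (Z : immigration_death lam m (conf_of s))
    (Z' : immigration_death lam m (conf_of (a :: s))) (phi : nat -> R) :
  barrier (mass lam) m phi -> (m <= size s)%N ->
  (`|stein_solution Pi f Z' - stein_solution Pi f Z| <= (phi (size s).+1)%:E)%E.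
Proof.
move=> bphi ms; have ms' : (m <= size (a :: s))%N by exact: leqW.
have [iZ iZ'] := (integrable_excess Z ms, integrable_excess Z' ms').
rewrite !stein_solutionE oppeK addeC -abseN oppeB; last first.
  by apply: fin_num_adde_defr; exact: (integrable_fin_num _ iZ).
rewrite addeC -integralB_EFin//.
apply: integral_half_line_bound; last by move=> n; exact: contrast_integral.
apply: eq_integrable (integrableB _ iZ' iZ) => // t _.
Qed.

End stein.

Section norm.
Context {R : realType} {T : completeMetricType R}.
Hypothesis T_separable : separable T.
Hypothesis d_le1 : forall x y : T, mdist x y <= 1.
Variable lam : {finite_measure set (borel T) -> \bar R}.
Hypothesis lam_gt0 : 0 < mass lam.
Variable Pi : probability (config T) R.
Hypothesis Pi_poisson : poisson_process lam Pi.
Variables (m : nat) (m_gt0 : (0 < m)%N).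
Variable Z : forall xi : config T, finite_ge m xi -> immigration_death lam m xi.

Lemma norm_Delta_h_le (phi : nat -> R) (B : R) : barrier (mass lam) m phi ->
  (forall n, (m < n)%N -> phi n <= B) -> (norm_Delta_h Pi Z <= B%:E)%E.
Proof.
move=> bphi phiB; have [x xd] := dense_sequence T_separable.
apply: ge_ereal_sup => r [xi [hxi [f [a [Ff ->]]]]].
have [s xiE] := finite_config_seq hxi.2; subst xi.
have ms : (m <= size s)%N.
  by move: hxi.1; rewrite npoints_conf_of lee_fin ler_nat.
apply: (le_trans (stein_contrast d_le1 lam_gt0 Pi_poisson m_gt0 Ff xd _
  (Z (finite_ge_add_point a hxi) : immigration_death lam m (conf_of (a :: s))) bphi ms)).
by rewrite lee_fin phiB.
Qed.
End norm.

Theorem theorem1p5 (R : realType) (Gam : completeMetricType R)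
    (Gam_locally_compact : locally_compact [set: Gam])
    (Gam_separable : separable Gam)
    (d0_le1 : forall x y : Gam, mdist x y <= 1)
    (lam : {finite_measure set (borel Gam) -> \bar R})
    (lam_diffuse : forall x : Gam, lam [set x] = 0%E)
    (lam_gt0 : 0 < mass lam)
    (Pi : probability (config Gam) R)
    (Pi_poisson : poisson_process lam Pi)
    (m : nat) (m_ge1 : (1 <= m)%N)
    (Z : forall xi : config Gam, finite_ge m xi -> immigration_death lam m xi) :
  let l := mass lam in
  let K1 := Num.min (m%:R^-1) ((95%:R / 100%:R + Num.max (ln l) 0) / l) in
  (norm_Delta_h Pi Z <= (l^-1 + (m%:R + 1) * K1)%:E)%E /\
  (m%:R + 2%:R < l ->
   (norm_Delta_h Pi Z <= (1 / (l * (l - m%:R)) + l / (l - m%:R) * K1)%:E)%E).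
Proof.
move=> l k; have [[phi bphi phiB] large] := barriers_exist lam_gt0 m_ge1.
split; first exact: (norm_Delta_h_le Gam_separable d0_le1 lam_gt0 Pi_poisson m_ge1 Z bphi phiB).
move=> /large[psi bpsi psiB].
exact: (norm_Delta_h_le Gam_separable d0_le1 lam_gt0 Pi_poisson m_ge1 Z bpsi psiB).
Qed.
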